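(* Let $E:=x\partial_x+y\partial_y$ and $T:=-y\partial_x+x\partial_y$, and let $\pi=T\wedge\partial_z$ be the Poisson structure on $\mathbb{R}^3$ associated with the Euclidean Lie algebra $\mathfrak{e}(2)$. The Poisson cohomology of $(\mathbb{R}^3,\pi)$ is as follows: - the Casimir functions, i.e. $H^0(\mathbb{R}^3,\pi)$, are the functions $f(x^2+y^2)$ with $f\in C^\infty([0,\infty))$; - $H^1(\mathbb{R}^3,\pi)$ is a free module over $H^0(\mathbb{R}^3,\pi)$ with two generators, the classes of $E$ and $\partial_z$; - in degree $2$ the cohomology classes are uniquely represented by $f(x^2+y^2)E\wedge\partial_z+g(z)\partial_x\wedge\partial_y$ with $f\in C^\infty([0,\infty))$, $g\in C^\infty(\mathbb{R})$; - in degree $3$ the cohomology classes are uniquely represented by $g(z)\,\partial_x\wedge\partial_y\wedge\partial_z$ with $g\in C^\infty(\mathbb{R})$. The algebraic structure (wedge product and Schouten–Nijenhuis bracket) is described by performing the operations on representatives and using the following relations in cohomology: $$[h(x^2+y^2,z)\partial_x\wedge\partial_y]=[h(0,z)\partial_x\wedge\partial_y],\qquad [h(x^2+y^2,z)\partial_x\wedge\partial_y\wedge\partial_z]=[h(0,z)\partial_x\wedge\partial_y\wedge\partial_z]$$ for any $h\in C^\infty([0,\infty)\times\mathbb{R})$ for which the given multivector fields are $d_\pi$-closed.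
   Context: For a Poisson structure $\pi$ on a manifold $M$ (a bivector field with $[\pi,\pi]=0$, where $[\cdot,\cdot]$ is the Schouten–Nijenhuis bracket), the Poisson cohomology $H^\bullet(M,\pi)$ is the cohomology of the complex $(\mathfrak{X}^\bullet(M),d_\pi:=[\pi,\cdot])$ of smooth multivector fields. The wedge product and Schouten–Nijenhuis bracket descend to $H^\bullet(M,\pi)$. Coordinates on $\mathbb{R}^3$ are $(x,y,z)$. ''Uniquely represented'' means that every multivector field of the listed form is a cocycle and every class contains exactly one of them. *)

(* Defs.v *)
From Stdlib Require Export Reals List Bool Arith.
From Coquelicot Require Export Coquelicot.
Export ListNotations.
Open Scope R_scope.

Definition R3 : Type := (R * R * R)%type.

Inductive axis : Set := ax | ay | az.

Definition axes : list axis := [ax; ay; az].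

Definition axis_rank (i : axis) : nat :=
  match i with ax => 0 | ay => 1 | az => 2 end.

Definition coord (i : axis) (p : R3) : R :=
  let '(x, y, z) := p in match i with ax => x | ay => y | az => z end.

Definition upd (p : R3) (i : axis) (t : R) : R3 :=
  let '(x, y, z) := p in
  match i with ax => (t, y, z) | ay => (x, t, z) | az => (x, y, t) end.

Definition ex_partial (i : axis) (f : R3 -> R) (p : R3) : Prop :=
  ex_derive (fun t => f (upd p i t)) (coord i p).

Definition partial (i : axis) (f : R3 -> R) (p : R3) : R :=
  Derive (fun t => f (upd p i t)) (coord i p).

Fixpoint Cn3 (n : nat) (f : R3 -> R) : Prop :=
  (forall p : R3, continuous f p) /\
  match n with
  | O => True
  | S m => forall i : axis,
      (forall p : R3, ex_partial i f p) /\ Cn3 m (partial i f)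
  end.

Definition smooth3 (f : R3 -> R) : Prop := forall n : nat, Cn3 n f.

Definition smooth_line (g : R -> R) : Prop :=
  forall (n : nat) (x : R), ex_derive_n g n x.

(** Functions on [[0,oo)] and on [[0,oo) x R] are encoded as total functions
    whose values for a negative first argument are irrelevant.  Derivatives in
    the first variable are taken within [[0,oo)], hence one-sided at [0]. *)

Definition half_line (s : R) : Prop := 0 <= s.

Definition deriv_half (f f' : R -> R) : Prop :=
  forall s : R, half_line s -> D_in f f' half_line s.

Definition smooth_half (f : R -> R) : Prop :=
  exists F : nat -> R -> R,
    F 0%nat = f /\ forall n : nat, deriv_half (F n) (F (S n)).

(** [H i j] is the partial derivative of order [i] in the first variable and
    [j] in the second; all of them are continuous up to the boundary. *)
Definition smooth_half_plane (h : R -> R -> R) : Prop :=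
  exists H : nat -> nat -> R -> R -> R,
    H 0%nat 0%nat = h /\
    forall (i j : nat) (s z : R), half_line s ->
      filterlim (fun q : R * R => H i j (fst q) (snd q))
        (within (fun q : R * R => half_line (fst q)) (locally (s, z)))
        (locally (H i j s z)) /\
      D_in (fun t => H i j t z) (fun t => H (S i) j t z) half_line s /\
      is_derive (fun w => H i j s w) z (H i (S j) s z).

(** A multi-index is a subset of the axes [x], [y], [z], given by its
    characteristic triple.  It stands for the wedge product, in increasing
    order, of the coordinate vector fields it contains. *)
Definition mindex : Set := (bool * bool * bool)%type.

Definition mem (i : axis) (I : mindex) : bool :=
  let '(a, b, c) := I in match i with ax => a | ay => b | az => c end.

Definition mk_mindex (m : axis -> bool) : mindex := (m ax, m ay, m az).

Definition mindices : list mindex :=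
  list_prod (list_prod [false; true] [false; true]) [false; true].

Definition mcard (I : mindex) : nat :=
  length (filter (fun i => mem i I) axes).

Definition mempty : mindex := mk_mindex (fun _ => false).

Definition single (i : axis) : mindex :=
  mk_mindex (fun j => Nat.eqb (axis_rank i) (axis_rank j)).

Definition msubset (I K : mindex) : bool :=
  forallb (fun i => implb (mem i I) (mem i K)) axes.

Definition mdiff (K I : mindex) : mindex :=
  mk_mindex (fun i => mem i K && negb (mem i I)).

Definition munion (I J : mindex) : mindex :=
  mk_mindex (fun i => mem i I || mem i J).

Definition meqb (I J : mindex) : bool := msubset I J && msubset J I.

(** Number of pairs [(i, j)] in [I x J] with [j < i]. *)
Definition inversions (I J : mindex) : nat :=
  length (filter (fun ij : axis * axis =>
                    mem (fst ij) I && mem (snd ij) J &&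
                    Nat.ltb (axis_rank (snd ij)) (axis_rank (fst ij)))
            (list_prod axes axes)).

Definition Rsum {A : Type} (l : list A) (F : A -> R) : R :=
  fold_right Rplus 0 (map F l).

(** Possibly inhomogeneous multivector field, given by its coefficients. *)
Definition mvf : Type := mindex -> R3 -> R.

Definition mzero : mvf := fun _ _ => 0.
Definition madd (P Q : mvf) : mvf := fun I p => P I p + Q I p.
Definition msub (P Q : mvf) : mvf := fun I p => P I p - Q I p.
Definition fmul (f : R3 -> R) (P : mvf) : mvf := fun I p => f p * P I p.

Definition fn (f : R3 -> R) : mvf :=
  fun I p => if meqb I mempty then f p else 0.

Definition dd (i : axis) : mvf :=
  fun I _ => if meqb I (single i) then 1 else 0.

Definition wedge (P Q : mvf) : mvf :=
  fun K p =>
    Rsum mindices (fun I =>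
      if msubset I K
      then (-1) ^ inversions I (mdiff K I) * P I p * Q (mdiff K I) p
      else 0).

Declare Scope mvf_scope.
Delimit Scope mvf_scope with mvf.
Notation "P [+] Q" := (madd P Q) (at level 50, left associativity) : mvf_scope.
Notation "P [-] Q" := (msub P Q) (at level 50, left associativity) : mvf_scope.
Notation "f [*] P" := (fmul f P) (at level 40, left associativity) : mvf_scope.
Notation "P [^] Q" := (wedge P Q) (at level 38, left associativity) : mvf_scope.
Open Scope mvf_scope.

(** Right derivative with respect to the odd variable [d/dx_i]: the factor
    [d/dx_i] is moved to the right end of each monomial and removed. *)
Definition odd_deriv (i : axis) (P : mvf) : mvf :=
  fun J p =>
    if mem i J then 0
    else (-1) ^ inversions J (single i) * P (munion J (single i)) p.

Definition coef_deriv (i : axis) (P : mvf) : mvf :=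
  fun I => partial i (P I).

(** Schouten-Nijenhuis bracket of [P] of degree [p] and [Q] of degree [q]:
    sum over [i] of (P <- d/dxi_i) /\ (dQ/dx_i)
      - (-1)^((p-1)(q-1)) (Q <- d/dxi_i) /\ (dP/dx_i),
    normalised so that [X, Q] is the Lie derivative for a vector field [X].
    The exponent is written [(p+1)(q+1)], of the same parity. *)
Definition schouten (p q : nat) (P Q : mvf) : mvf :=
  fun K x =>
    Rsum axes (fun i => (odd_deriv i P [^] coef_deriv i Q) K x)
    - (-1) ^ ((p + 1) * (q + 1)) *
      Rsum axes (fun i => (odd_deriv i Q [^] coef_deriv i P) K x).

(** [multivector k P]: [P] is a smooth multivector field of degree [k]. *)
Definition multivector (k : nat) (P : mvf) : Prop :=
  forall I : mindex, smooth3 (P I) /\ (mcard I <> k -> forall p, P I p = 0).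

Definition poisson (pi : mvf) : Prop :=
  multivector 2 pi /\ schouten 2 2 pi pi = mzero.

Definition dpi (pi : mvf) (k : nat) (P : mvf) : mvf := schouten 2 k pi P.

Definition cocycle (pi : mvf) (k : nat) (P : mvf) : Prop :=
  multivector k P /\ dpi pi k P = mzero.

Definition coboundary (pi : mvf) (k : nat) (P : mvf) : Prop :=
  match k with
  | O => P = mzero
  | S m => exists Q : mvf, multivector m Q /\ P = dpi pi m Q
  end.

(** Cohomology classes are sets of multivector fields. *)
Definition class (pi : mvf) (k : nat) (P : mvf) : mvf -> Prop :=
  fun Q => cocycle pi k Q /\ coboundary pi k (Q [-] P).

Definition cohomology (pi : mvf) (k : nat) (C : mvf -> Prop) : Prop :=
  exists P : mvf, cocycle pi k P /\ C = class pi k P.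

(** Operations on classes, without a choice of representatives: everything
    cohomologous to the result for some pair of representatives. *)
Definition class_add (pi : mvf) (k : nat) (C D : mvf -> Prop) : mvf -> Prop :=
  fun W => exists P Q : mvf, C P /\ D Q /\ class pi k (P [+] Q) W.

Definition class_wedge (pi : mvf) (p q : nat) (C D : mvf -> Prop) :
  mvf -> Prop :=
  fun W => exists P Q : mvf, C P /\ D Q /\ class pi (p + q) (P [^] Q) W.

(** The bracket has degree [p + q - 1]; for [p = q = 0] it vanishes, and the
    truncated degree [0] is harmless. *)
Definition class_bracket (pi : mvf) (p q : nat) (C D : mvf -> Prop) :
  mvf -> Prop :=
  fun W => exists P Q : mvf,
    C P /\ D Q /\ class pi (p + q - 1) (schouten p q P Q) W.

Definition casimir (pi : mvf) (a : R3 -> R) : Prop :=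
  smooth3 a /\ dpi pi 0 (fn a) = mzero.

Definition uniquely_represented (pi : mvf) (k : nat) (F : mvf -> Prop) : Prop :=
  (forall P : mvf, F P -> cocycle pi k P) /\
  (forall C : mvf -> Prop, cohomology pi k C -> exists! P : mvf, F P /\ C P).

(** The degree [k] cohomology is a free module over the degree [0] cohomology
    (acting by the wedge product) with generators [C1] and [C2]. *)
Definition free_on_two (pi : mvf) (k : nat) (C1 C2 : mvf -> Prop) : Prop :=
  let comb (A B : mvf -> Prop) :=
    class_add pi k (class_wedge pi 0 k A C1) (class_wedge pi 0 k B C2) in
  cohomology pi k C1 /\ cohomology pi k C2 /\
  (forall A B : mvf -> Prop,
     cohomology pi 0 A -> cohomology pi 0 B -> cohomology pi k (comb A B)) /\
  (forall C : mvf -> Prop, cohomology pi k C ->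
     exists! AB : (mvf -> Prop) * (mvf -> Prop),
       cohomology pi 0 (fst AB) /\ cohomology pi 0 (snd AB) /\
       C = comb (fst AB) (snd AB)).

Definition of_rho (f : R -> R) : R3 -> R :=
  fun '(x, y, z) => f (x ^ 2 + y ^ 2).
Definition of_z (g : R -> R) : R3 -> R := fun '(x, y, z) => g z.
Definition of_rho_z (h : R -> R -> R) : R3 -> R :=
  fun '(x, y, z) => h (x ^ 2 + y ^ 2) z.

Definition E_e2 : mvf := coord ax [*] dd ax [+] coord ay [*] dd ay.
Definition T_e2 : mvf :=
  (fun p => - coord ay p) [*] dd ax [+] coord ax [*] dd ay.
Definition pi_e2 : mvf := T_e2 [^] dd az.

Definition rep0 (f : R -> R) : mvf := fn (of_rho f).
Definition rep1 (f g : R -> R) : mvf :=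
  of_rho f [*] E_e2 [+] of_rho g [*] dd az.
Definition rep2 (f g : R -> R) : mvf :=
  of_rho f [*] (E_e2 [^] dd az) [+] of_z g [*] (dd ax [^] dd ay).
Definition rep3 (g : R -> R) : mvf := of_z g [*] (dd ax [^] dd ay [^] dd az).

(* Main.v *)
Require Import Defs.
From Stdlib Require Import Lra Lia FunctionalExtensionality PropExtensionality
  ClassicalEpsilon ZArith.

(** For [pi = T /\ d_z] the differential is [d P = T /\ L_(d_z) P - d_z /\ L_T P], so everything
    rests on inverting [d_z] (integration in [z]) and [rot = x d_y - y d_x].  The latter is
    inverted on functions of zero average over circles by
    [u |-> (2 pi)^(-1) int_0^(2 pi) t u(R_t p) dt].  For a 1-cocycle [(A, B, C)] the function
    [x A + y B] is a Casimir vanishing on the axis [x = y = 0], hence [(x^2 + y^2) i] with [i] a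
    Casimir; what remains after subtracting [i E] is orthogonal to [(x, y)], so it is a smooth
    multiple of [T], and [T w] is removed by integrating [w] in [z].  For a 2-cocycle with
    coefficients [b, c] of [d_x /\ d_z, d_y /\ d_z] the same role is played by the circle average
    of [x b + y c]; a primitive [A d_x + B d_y] is recovered from [U = x A + y B], and this needs
    [U = 0] on the axis, which produces the terms [g(z)].  A Casimir [f] satisfies
    [f_x = 2 x f1] and [f_y = 2 y f1] with [f1] again a Casimir; iterating, [f = F(x^2 + y^2)]
    with [F] smooth up to the boundary.  The Leibniz and Jacobi identities, which make products
    and brackets of classes well defined, are polynomial identities in the partial derivatives of
    the coefficients, checked by computation on symbolic multivector fields. *)

(** * Calculus of smooth functions on R^3 *)

(** The obstacle is the axis x = y = 0, where pi vanishes: away from it division by x, y or x^2 +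
    y^2 is harmless, on it smoothness must be proved. Quotients are therefore built as Hadamard
    integrals, and equations that hold after multiplication by a coordinate are cancelled by
    density. In each degree a cocycle carries data that decide its class: x A + y B and the circle
    average of C in degree 1; the restriction to the axis of the coefficient of d_x /\ d_y and the
    circle average of x b + y c in degree 2; the restriction of the coefficient to the axis in
    degree 3. The data vanish on coboundaries, which gives uniqueness, and a cocycle whose data
    vanish has an explicit primitive, which gives existence. The relations and the degree 2 and 3
    entries of the product and bracket tables then require no new primitive: it suffices to compare
    the data of the two sides. Dilations, integration in z and circle averages are integrals of f
    along a one-parameter family of linear maps, so their smoothness is proved once, for [pint]. *)

Definition is_partial (i : axis) (f : R3 -> R) (p : R3) (l : R) : Prop :=
  is_derive (fun t => f (upd p i t)) (coord i p) l.

Lemma is_derive_eq (f : R -> R) (x l l' : R) : is_derive f x l -> l = l' -> is_derive f x l'.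
Proof. now intros H <-. Qed.

Lemma is_partial_unique i f p l : is_partial i f p l -> partial i f p = l.
Proof. intros H; apply is_derive_unique; exact H. Qed.

Lemma is_partial_ex i f p l : is_partial i f p l -> ex_partial i f p.
Proof. intros H; exists l; exact H. Qed.

Lemma partial_correct i f p : ex_partial i f p -> is_partial i f p (partial i f p).
Proof. intros H; apply Derive_correct; exact H. Qed.

Lemma upd_coord p i : upd p i (coord i p) = p.
Proof. destruct p as [[x y] z]; destruct i; reflexivity. Qed.

Lemma coord_upd_same p i t : coord i (upd p i t) = t.
Proof. destruct p as [[x y] z]; destruct i; reflexivity. Qed.

Lemma upd_upd p i s t : upd (upd p i s) i t = upd p i t.
Proof. destruct p as [[x y] z]; destruct i; reflexivity. Qed.

(** The product rule leaves one factor undifferentiated in each term, so the induction in [Cn3_mult]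
    needs the factors themselves at the lower order. *)
Lemma Cn3_weaken n : forall f, Cn3 (S n) f -> Cn3 n f.
Proof.
  induction n as [|n IH]; intros f [Hc H].
  - split; [exact Hc | exact I].
  - split; [exact Hc|]; intros i; destruct (H i) as [He Hp]; split; [exact He|].
    apply IH; exact Hp.
Qed.

Lemma smooth3_cont f : smooth3 f -> forall p : R3, continuous f p.
Proof. intros H; destruct (H 0%nat) as [Hc _]; exact Hc. Qed.

Lemma smooth3_ex f i p : smooth3 f -> ex_partial i f p.
Proof. intros H; destruct (H 1%nat) as [_ H1]; apply (H1 i). Qed.

Lemma smooth3_partial f i : smooth3 f -> smooth3 (partial i f).
Proof. intros H n; destruct (H (S n)) as [_ H1]; apply (H1 i). Qed.

Lemma smooth3_is f i p : smooth3 f -> is_partial i f p (partial i f p).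
Proof. intros H; apply partial_correct, smooth3_ex, H. Qed.

Lemma is_partial_const i c p : is_partial i (fun _ => c) p 0.
Proof. exact (@is_derive_const R_AbsRing R_NormedModule c (coord i p)). Qed.

Lemma is_partial_coord i j p :
  is_partial i (coord j) p (if Nat.eqb (axis_rank i) (axis_rank j) then 1 else 0).
Proof.
  unfold is_partial; destruct p as [[x y] z]; destruct i, j; simpl;
    match goal with
    | |- is_derive (fun t => t) ?u _ => exact (@is_derive_id R_AbsRing u)
    | |- is_derive (fun t => ?c) ?u _ => exact (@is_derive_const R_AbsRing R_NormedModule c u)
    end.
Qed.

Lemma is_partial_plus i f g p a b : is_partial i f p a -> is_partial i g p b ->
  is_partial i (fun q => f q + g q) p (a + b).
Proof. intros; apply (@is_derive_plus R_AbsRing R_NormedModule); assumption. Qed.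

Lemma is_partial_mult i f g p a b : is_partial i f p a -> is_partial i g p b ->
  is_partial i (fun q => f q * g q) p (a * g p + f p * b).
Proof.
  intros Hf Hg.
  pose proof (is_derive_mult _ _ _ _ _ Hf Hg Rmult_comm) as H.
  cbv beta in H; rewrite !upd_coord in H; exact H.
Qed.

Lemma partial_const i c : partial i (fun _ => c) = fun _ => 0.
Proof.
  apply functional_extensionality; intros p; apply is_partial_unique, is_partial_const.
Qed.

Lemma partial_coord i j :
  partial i (coord j) = fun _ => if Nat.eqb (axis_rank i) (axis_rank j) then 1 else 0.
Proof.
  apply functional_extensionality; intros p; apply is_partial_unique, is_partial_coord.
Qed.

Lemma partial_plus i f g : (forall p, ex_partial i f p) -> (forall p, ex_partial i g p) ->
  partial i (fun p => f p + g p) = fun p => partial i f p + partial i g p.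
Proof.
  intros Hf Hg; apply functional_extensionality; intros p; apply is_partial_unique.
  apply is_partial_plus; apply partial_correct; auto.
Qed.

Lemma partial_mult i f g : (forall p, ex_partial i f p) -> (forall p, ex_partial i g p) ->
  partial i (fun p => f p * g p) = fun p => partial i f p * g p + f p * partial i g p.
Proof.
  intros Hf Hg; apply functional_extensionality; intros p; apply is_partial_unique.
  apply is_partial_mult; apply partial_correct; auto.
Qed.

Lemma partial_opp i f : partial i (fun p => - f p) = fun p => - partial i f p.
Proof. apply functional_extensionality; intros p; apply Derive_opp. Qed.

Lemma ex_partial_plus i f g p : ex_partial i f p -> ex_partial i g p ->
  ex_partial i (fun q => f q + g q) p.
Proof. intros [a Ha] [b Hb]; exists (a + b); now apply is_partial_plus. Qed.

Lemma ex_partial_mult i f g p : ex_partial i f p -> ex_partial i g p ->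
  ex_partial i (fun q => f q * g q) p.
Proof. intros [a Ha] [b Hb]; eexists; apply is_partial_mult; eassumption. Qed.

Lemma Cn3_const n : forall c, Cn3 n (fun _ => c).
Proof.
  induction n as [|n IH]; intros c; (split; [intros p; apply continuous_const|]).
  - exact I.
  - intros i; split.
    + intros p; eapply is_partial_ex, is_partial_const.
    + rewrite partial_const; apply IH.
Qed.

Lemma smooth3_const c : smooth3 (fun _ => c).
Proof. intros n; apply Cn3_const. Qed.

Lemma continuous_coord i (p : R3) : continuous (coord i) p.
Proof.
  destruct p as [[x y] z].
  apply (continuous_ext (fun q : R * R * R =>
    match i with ax => fst (fst q) | ay => snd (fst q) | az => snd q end)).
  { intros [[u v] w]; destruct i; reflexivity. }
  destruct i.
  - apply (continuous_comp (fun q : R * R * R => fst q) (fun q : R * R => fst q));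
      apply continuous_fst.
  - apply (continuous_comp (fun q : R * R * R => fst q) (fun q : R * R => snd q));
      [apply continuous_fst | apply continuous_snd].
  - apply continuous_snd.
Qed.

Lemma smooth3_coord i : smooth3 (coord i).
Proof.
  intros [|n]; (split; [intros p; apply continuous_coord|]); [exact I|].
  intros j; split.
  - intros p; eapply is_partial_ex, is_partial_coord.
  - rewrite partial_coord; apply Cn3_const.
Qed.

Lemma Cn3_plus n : forall f g, Cn3 n f -> Cn3 n g -> Cn3 n (fun p => f p + g p).
Proof.
  induction n as [|n IH]; intros f g [Hf Hf'] [Hg Hg'];
    (split; [intros p; apply (@continuous_plus _ R_AbsRing R_NormedModule f g p);
             [apply Hf | apply Hg]|]).
  - exact I.
  - intros i; destruct (Hf' i), (Hg' i); split.
    + intros p; apply ex_partial_plus; auto.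
    + rewrite partial_plus by auto; auto.
Qed.

Lemma Cn3_mult n : forall f g, Cn3 n f -> Cn3 n g -> Cn3 n (fun p => f p * g p).
Proof.
  induction n as [|n IH]; intros f g Hf Hg.
  - destruct Hf as [Hf _], Hg as [Hg _]; split; [|exact I].
    intros p; apply (@continuous_mult _ R_AbsRing f g p); [apply Hf | apply Hg].
  - pose proof (Cn3_weaken _ _ Hf) as Wf; pose proof (Cn3_weaken _ _ Hg) as Wg.
    destruct Hf as [Hf Hf'], Hg as [Hg Hg']; split.
    + intros p; apply (@continuous_mult _ R_AbsRing f g p); [apply Hf | apply Hg].
    + intros i; destruct (Hf' i), (Hg' i); split.
      * intros p; apply ex_partial_mult; auto.
      * rewrite partial_mult by auto; apply Cn3_plus; auto.
Qed.

Lemma smooth3_plus f g : smooth3 f -> smooth3 g -> smooth3 (fun p => f p + g p).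
Proof. intros Hf Hg n; apply Cn3_plus; auto. Qed.

Lemma smooth3_mult f g : smooth3 f -> smooth3 g -> smooth3 (fun p => f p * g p).
Proof. intros Hf Hg n; apply Cn3_mult; auto. Qed.

Lemma smooth3_ext f g : (forall p, f p = g p) -> smooth3 f -> smooth3 g.
Proof. intros H; replace g with f by (now apply functional_extensionality); auto. Qed.

Lemma smooth3_opp f : smooth3 f -> smooth3 (fun p => - f p).
Proof.
  intros H; apply (smooth3_ext (fun p => (-1) * f p)); [intros; ring|].
  apply smooth3_mult; [apply smooth3_const | exact H].
Qed.

Lemma smooth3_minus f g : smooth3 f -> smooth3 g -> smooth3 (fun p => f p - g p).
Proof. intros Hf Hg; apply smooth3_plus; [|apply smooth3_opp]; assumption. Qed.

Lemma smooth3_partial_plus i f g : smooth3 f -> smooth3 g ->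
  partial i (fun p => f p + g p) = fun p => partial i f p + partial i g p.
Proof. intros; apply partial_plus; intros; apply smooth3_ex; auto. Qed.

Lemma smooth3_partial_mult i f g : smooth3 f -> smooth3 g ->
  partial i (fun p => f p * g p) = fun p => partial i f p * g p + f p * partial i g p.
Proof. intros; apply partial_mult; intros; apply smooth3_ex; auto. Qed.

Lemma smooth3_partial_minus i f g : smooth3 f -> smooth3 g ->
  partial i (fun p => f p - g p) = fun p => partial i f p - partial i g p.
Proof.
  intros Hf Hg; unfold Rminus; rewrite smooth3_partial_plus, partial_opp;
    auto using smooth3_opp.
Qed.

(** * Tuples and the chain rule along curves *)

Lemma continuous_pair {U V W : UniformSpace} (f : U -> V) (g : U -> W) u :
  continuous f u -> continuous g u -> continuous (fun v => (f v, g v)) u.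
Proof.
  intros Hf Hg; apply filterlim_locally; intros eps.
  pose proof (proj1 (filterlim_locally f (f u)) Hf eps) as H1.
  pose proof (proj1 (filterlim_locally g (g u)) Hg eps) as H2.
  generalize (filter_and _ _ H1 H2); apply filter_imp.
  intros v [K1 K2]; split; assumption.
Qed.

Lemma continuous_tuple3 {U : UniformSpace} (a b c : U -> R) u :
  continuous a u -> continuous b u -> continuous c u ->
  continuous (fun v => (a v, b v, c v) : R3) u.
Proof.
  intros Ha Hb Hc.
  apply (continuous_pair (V := prod_UniformSpace R_UniformSpace R_UniformSpace)
           (fun v => (a v, b v)) c); [apply continuous_pair|]; assumption.
Qed.

Lemma is_derive_continuous (f : R -> R) x l : is_derive f x l -> continuous f x.
Proof. intros H; apply (@ex_derive_continuous R_AbsRing R_NormedModule); now exists l. Qed.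

(** Differentiability at [(a s, s)] needs continuity of only one of the two partial derivatives; the
    other is required just on the slice through that point. This asymmetry lets [is_derive_curve]
    treat the three arguments of [f] one at a time. *)
Lemma is_derive_two_args (g gu : R -> R -> R) (a : R -> R) (s a' l : R) :
  (forall u v, is_derive (fun w => g w v) u (gu u v)) ->
  continuous (fun q : R * R => gu (fst q) (snd q)) (a s, s) ->
  is_derive (fun v => g (a s) v) s l ->
  is_derive a s a' ->
  is_derive (fun v => g (a v) v) s (gu (a s) s * a' + l).
Proof.
  intros H1 Hc H2 Ha.
  assert (HF := is_derive_filterdiff g (a s) s gu l
    (filter_forall _ (fun u => H1 (fst u) (snd u))) H2 Hc).
  pose proof (filterdiff_comp'_2 a (fun v => v) g s _ _
    (fun u v : R => plus (scal u (gu (a s) s)) (scal v l)) Ha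
    (filterdiff_id (locally s)) HF) as H.
  apply (filterdiff_ext_lin _ _ _ H).
  intros y; unfold scal, plus; simpl; unfold mult; simpl; ring.
Qed.

Lemma is_derive_curve f (a b c : R -> R) s a' b' c' : smooth3 f ->
  is_derive a s a' -> is_derive b s b' -> is_derive c s c' ->
  is_derive (fun t => f (a t, b t, c t)) s
    (partial ax f (a s, b s, c s) * a' + partial ay f (a s, b s, c s) * b' +
     partial az f (a s, b s, c s) * c').
Proof.
  intros Hf Ha Hb Hc.
  assert (Ca : continuous a s) by (eapply is_derive_continuous; eassumption).
  assert (Cb : continuous b s) by (eapply is_derive_continuous; eassumption).
  assert (Cc : continuous c s) by (eapply is_derive_continuous; eassumption).
  rewrite Rplus_assoc.
  apply (is_derive_two_args (fun u t => f (u, b t, c t))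
           (fun u t => partial ax f (u, b t, c t))); [| | |exact Ha].
  - intros u v; exact (smooth3_is f ax (u, b v, c v) Hf).
  - apply (continuous_comp (fun q : R * R => (fst q, b (snd q), c (snd q)) : R3)
             (partial ax f)).
    + apply continuous_tuple3; [apply continuous_fst | |];
        (apply (continuous_comp (fun q : R * R => snd q)); [apply continuous_snd|]);
        assumption.
    + apply smooth3_cont, smooth3_partial, Hf.
  - apply (is_derive_two_args (fun u t => f (a s, u, c t))
             (fun u t => partial ay f (a s, u, c t))); [| | |exact Hb].
    + intros u v; exact (smooth3_is f ay (a s, u, c v) Hf).
    + apply (continuous_comp (fun q : R * R => (a s, fst q, c (snd q)) : R3)
             (partial ay f)).
      * apply continuous_tuple3; [apply continuous_const | apply continuous_fst |].
        apply (continuous_comp (fun q : R * R => snd q)); [apply continuous_snd|].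
        assumption.
      * apply smooth3_cont, smooth3_partial, Hf.
    + rewrite Rmult_comm.
      apply (is_derive_comp (fun w => f (a s, b s, w)) c); [|exact Hc].
      exact (smooth3_is f az (a s, b s, c s) Hf).
Qed.

(** * Symmetry of second partial derivatives *)

Lemma continuous_upd i j p (s t : R) :
  continuous (fun q : R * R => upd (upd p i (fst q)) j (snd q)) (s, t).
Proof.
  destruct p as [[x y] z].
  destruct i, j; simpl; apply continuous_tuple3;
    first [apply continuous_fst | apply continuous_snd | apply continuous_const].
Qed.

Lemma smooth3_continuity_2d f i j p s t : smooth3 f ->
  continuity_2d_pt (fun u v => f (upd (upd p i u) j v)) s t.
Proof.
  intros Hf; apply continuity_2d_pt_filterlim.
  apply (continuous_comp (fun q : R * R => upd (upd p i (fst q)) j (snd q)) f).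
  - apply continuous_upd.
  - apply smooth3_cont, Hf.
Qed.

Lemma upd_swap p i j s t : i <> j -> upd (upd p i s) j t = upd (upd p j t) i s.
Proof. destruct p as [[x y] z]; destruct i, j; intros H; try reflexivity; congruence. Qed.

Lemma coord_upd_other p i j s : i <> j -> coord j (upd p i s) = coord j p.
Proof. destruct p as [[x y] z]; destruct i, j; intros H; try reflexivity; congruence. Qed.

(** Translates derivatives of a two-variable slice, the form in which [Schwarz] is stated, back into
    [partial]. *)
Lemma partial_upd_1 f i j p u v : i <> j ->
  Derive (fun z => f (upd (upd p i z) j v)) u = partial i f (upd (upd p i u) j v).
Proof.
  intros Hij; unfold partial.
  rewrite coord_upd_other, coord_upd_same by congruence.
  apply Derive_ext; intros t; f_equal.
  rewrite (upd_swap p i j u v), upd_upd, upd_swap by congruence; reflexivity.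
Qed.

Lemma partial_upd_2 f i j p u v :
  Derive (fun z => f (upd (upd p i u) j z)) v = partial j f (upd (upd p i u) j v).
Proof.
  unfold partial; rewrite coord_upd_same.
  apply Derive_ext; intros t; now rewrite upd_upd.
Qed.

Lemma ex_partial_upd_1 f i j p u v : smooth3 f -> i <> j ->
  ex_derive (fun z => f (upd (upd p i z) j v)) u.
Proof.
  intros Hf Hij; pose proof (smooth3_ex f i (upd (upd p i u) j v) Hf) as H.
  unfold ex_partial in H; rewrite coord_upd_other, coord_upd_same in H by congruence.
  refine (ex_derive_ext _ _ _ _ H); intros t; cbv beta; f_equal.
  rewrite (upd_swap p i j u v), upd_upd, upd_swap by congruence; reflexivity.
Qed.

Lemma ex_partial_upd_2 f i j p u v : smooth3 f ->
  ex_derive (fun z => f (upd (upd p i u) j z)) v.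
Proof.
  intros Hf; pose proof (smooth3_ex f j (upd (upd p i u) j v) Hf) as H.
  unfold ex_partial in H; rewrite coord_upd_same in H.
  refine (ex_derive_ext _ _ _ _ H); intros t; cbv beta; now rewrite upd_upd.
Qed.

Lemma partial_comm f i j : smooth3 f ->
  partial i (partial j f) = partial j (partial i f).
Proof.
  intros Hf.
  assert (Hd : i = j \/ i <> j) by (destruct i, j; (left; reflexivity) || (right; congruence)).
  destruct Hd as [->|Hij]; [reflexivity|].
  apply functional_extensionality; intros p.
  pose proof (Schwarz (fun u v => f (upd (upd p i u) j v)) (coord i p) (coord j p)) as S.
  assert (E1 : forall u v, Derive (fun z => f (upd (upd p i z) j v)) u
            = partial i f (upd (upd p i u) j v)) by (intros; now apply partial_upd_1).
  assert (E2 : forall u v, Derive (fun z => f (upd (upd p i u) j z)) v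
            = partial j f (upd (upd p i u) j v)) by (intros; apply partial_upd_2).
  assert (E12 : forall u v, Derive (fun z => Derive (fun t => f (upd (upd p i z) j t)) v) u
            = partial i (partial j f) (upd (upd p i u) j v)).
  { intros u v; rewrite <- partial_upd_1 by exact Hij.
    apply Derive_ext; intros t; apply E2. }
  assert (E21 : forall u v, Derive (fun z => Derive (fun t => f (upd (upd p i t) j z)) u) v
            = partial j (partial i f) (upd (upd p i u) j v)).
  { intros u v; rewrite <- partial_upd_2.
    apply Derive_ext; intros t; apply E1. }
  assert (EP : upd (upd p i (coord i p)) j (coord j p) = p) by now rewrite !upd_coord.
  rewrite E12, E21, EP in S; apply S; clear S.
  - exists (mkposreal 1 Rlt_0_1); intros u v _ _; repeat split.
    + now apply ex_partial_upd_1.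
    + now apply ex_partial_upd_2.
    + refine (ex_derive_ext _ _ _ _
        (ex_partial_upd_1 (partial j f) i j p u v (smooth3_partial f j Hf) Hij)).
      intros t; cbv beta; now rewrite E2.
    + refine (ex_derive_ext _ _ _ _
        (ex_partial_upd_2 (partial i f) i j p u v (smooth3_partial f i Hf))).
      intros t; cbv beta; now rewrite E1.
  - eapply continuity_2d_pt_ext; [intros u v; symmetry; apply E12|].
    apply smooth3_continuity_2d; auto using smooth3_partial.
  - eapply continuity_2d_pt_ext; [intros u v; symmetry; apply E21|].
    apply smooth3_continuity_2d; auto using smooth3_partial.
Qed.

(** * Integrals with a linear parameter *)

Definition jointly_continuous {U : UniformSpace} (F : U -> R -> R) : Prop :=
  forall u t, continuous (fun q : U * R => F (fst q) (snd q)) (u, t).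

Lemma jointly_continuous_l {U : UniformSpace} (F : U -> R -> R) u t :
  jointly_continuous F -> continuous (F u) t.
Proof.
  intros H.
  apply (continuous_comp (fun s : R => (u, s)) (fun q : U * R => F (fst q) (snd q))).
  - apply continuous_pair; [apply continuous_const | apply continuous_id].
  - apply H.
Qed.

(** The tube lemma: compactness of the interval turns radii that depend on [t] into one
    neighbourhood of [u]. Both [F v t] and [F u t] are compared with [F u s] at a nearby centre [s],
    hence the halved tolerance. *)
Lemma jointly_continuous_uniform {U : UniformSpace} (F : U -> R -> R) a b u (e : posreal) :
  jointly_continuous F ->
  locally u (fun v => forall t, a <= t <= b -> Rabs (F v t - F u t) < e).
Proof.
  intros HF.
  assert (He : 0 < e / 2) by (destruct e as [e He]; simpl; lra).
  assert (HD : forall t, exists d : posreal, forall v s, ball u d v -> ball t d s ->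
            Rabs (F v s - F u t) < e / 2).
  { intros t.
    destruct (proj1 (filterlim_locally _ _) (HF u t) (mkposreal _ He)) as [d Hd].
    exists d; intros v s Hv Hs; apply (Hd (v, s)); split; assumption. }
  (* The compactness lemma takes a gauge, a function of [t], so the radii are selected by choice. *)
  set (delta := fun t => proj1_sig (constructive_indefinite_description _ (HD t))).
  assert (Hdelta : forall t v s, ball u (delta t) v -> ball t (delta t) s ->
            Rabs (F v s - F u t) < e / 2).
  { intros t; exact (proj2_sig (constructive_indefinite_description _ (HD t))). }
  destruct (compactness_value_1d a b delta) as [d Hd].
  exists d; intros v Hv t Ht.
  (* Compactness provides the centre [s] only under a double negation. *)
  apply NNPP; intros Hn; apply (Hd t Ht); intros [s [_ [Hts Hds]]]; apply Hn; clear Hn.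
  assert (K1 : Rabs (F v t - F u s) < e / 2).
  { apply Hdelta; [exact (ball_le u d (delta s) Hds v Hv) | exact Hts]. }
  assert (K2 : Rabs (F u t - F u s) < e / 2).
  { apply Hdelta; [apply ball_center | exact Hts]. }
  replace (F v t - F u t) with ((F v t - F u s) + - (F u t - F u s)) by ring.
  eapply Rle_lt_trans; [apply Rabs_triang|]; rewrite Rabs_Ropp; lra.
Qed.

Lemma jointly_continuous_ex_RInt {U : UniformSpace} (F : U -> R -> R) a b u :
  jointly_continuous F -> ex_RInt (F u) a b.
Proof.
  intros HF; apply (@ex_RInt_continuous R_CompleteNormedModule); intros t _.
  apply jointly_continuous_l, HF.
Qed.

Lemma continuous_RInt_param {U : UniformSpace} (F : U -> R -> R) a b u : a <= b ->
  jointly_continuous F -> continuous (fun v => RInt (F v) a b) u.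
Proof.
  intros Hab HF; apply filterlim_locally; intros e.
  (* The added 1 keeps the denominator positive when [a = b]. *)
  assert (Hc : 0 < e / (b - a + 1)) by (apply Rdiv_lt_0_compat; [apply cond_pos | lra]).
  generalize (jointly_continuous_uniform F a b u (mkposreal _ Hc) HF).
  apply filter_imp; simpl; intros v Hv.
  change (Rabs (RInt (F v) a b - RInt (F u) a b) < e).
  rewrite <- (RInt_minus (F v) (F u))
    by (apply jointly_continuous_ex_RInt; exact HF).
  eapply Rle_lt_trans.
  - apply (abs_RInt_le_const _ a b (e / (b - a + 1))); [exact Hab| |].
    + apply (@ex_RInt_minus R_NormedModule); apply jointly_continuous_ex_RInt; exact HF.
    + intros t Ht; left; apply (Hv t Ht).
  - assert (K : e / (b - a + 1) * (b - a + 1) = e) by (field; lra). nra.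
Qed.

Lemma RInt_Rplus (f g : R -> R) a b : ex_RInt f a b -> ex_RInt g a b ->
  RInt (fun x => f x + g x) a b = RInt f a b + RInt g a b.
Proof. intros Hf Hg; exact (RInt_plus f g a b Hf Hg). Qed.

Definition lin (m : axis -> axis -> R) (p : R3) : R3 :=
  let r i := m i ax * coord ax p + m i ay * coord ay p + m i az * coord az p in
  (r ax, r ay, r az).

(** Differentiating in a coordinate multiplies the weight [m] by an entry of [M] and replaces [f] by
    a partial derivative. With an arbitrary continuous weight the class of such integrals is thus
    stable under differentiation up to sums, and smoothness follows by induction. *)
Definition pint (a b : R) (M : R -> axis -> axis -> R) (m : R -> R) (f : R3 -> R) : R3 -> R :=
  fun p => RInt (fun t => m t * f (lin (M t) p)) a b.

Definition continuous_family (M : R -> axis -> axis -> R) : Prop :=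
  forall i j t, continuous (fun s => M s i j) t.

Lemma pint_integrand_continuous {U : UniformSpace} M (m : R -> R) (f : R3 -> R)
    (g : U -> R3) :
  continuous_family M -> (forall t : R, continuous m t) -> (forall p : R3, continuous f p) ->
  (forall u, continuous g u) ->
  jointly_continuous (fun u t => m t * f (lin (M t) (g u))).
Proof.
  intros HM Hm Hf Hg u t.
  assert (Cs : forall h : R -> R, (forall t, continuous h t) ->
            continuous (fun q : U * R => h (snd q)) (u, t)).
  { intros h Hh; apply (continuous_comp (fun q : U * R => snd q) h);
      [apply continuous_snd | apply Hh]. }
  assert (Cc : forall i, continuous (fun q : U * R => coord i (g (fst q))) (u, t)).
  { intros i; apply (continuous_comp (fun q : U * R => g (fst q)) (coord i)).
    - apply (continuous_comp (fun q : U * R => fst q) g); [apply continuous_fst | apply Hg].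
    - apply continuous_coord. }
  apply (@continuous_mult _ R_AbsRing (fun q : U * R => m (snd q))
           (fun q : U * R => f (lin (M (snd q)) (g (fst q))))); [now apply Cs|].
  apply (continuous_comp (fun q : U * R => lin (M (snd q)) (g (fst q))) f); [|apply Hf].
  assert (Cr : forall i, continuous (fun q : U * R =>
     M (snd q) i ax * coord ax (g (fst q)) + M (snd q) i ay * coord ay (g (fst q))
     + M (snd q) i az * coord az (g (fst q))) (u, t)).
  { intros i.
    assert (Cm : forall j, continuous (fun q : U * R => M (snd q) i j * coord j (g (fst q)))
                             (u, t)).
    { intros j; apply (@continuous_mult _ R_AbsRing (fun q : U * R => M (snd q) i j)
                         (fun q : U * R => coord j (g (fst q)))); [|apply Cc].
      apply (Cs (fun s => M s i j)), HM. }
    apply (@continuous_plus _ R_AbsRing R_NormedModule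
      (fun q : U * R => M (snd q) i ax * coord ax (g (fst q))
                        + M (snd q) i ay * coord ay (g (fst q)))); [|apply Cm].
    apply (@continuous_plus _ R_AbsRing R_NormedModule
      (fun q : U * R => M (snd q) i ax * coord ax (g (fst q)))); apply Cm. }
  apply continuous_tuple3; apply Cr.
Qed.

Lemma is_derive_linear_coord (m : axis -> axis -> R) i j p u :
  is_derive (fun z => m j ax * coord ax (upd p i z) + m j ay * coord ay (upd p i z)
                      + m j az * coord az (upd p i z)) u (m j i).
Proof. destruct p as [[x y] z]; destruct i; simpl; auto_derive; auto; ring. Qed.

Lemma is_derive_lin m f i p u : smooth3 f ->
  is_derive (fun z => f (lin m (upd p i z))) u
    (partial ax f (lin m (upd p i u)) * m ax i + partial ay f (lin m (upd p i u)) * m ay i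
     + partial az f (lin m (upd p i u)) * m az i).
Proof.
  intros Hf; exact (is_derive_curve f _ _ _ u _ _ _ Hf (is_derive_linear_coord m i ax p u)
    (is_derive_linear_coord m i ay p u) (is_derive_linear_coord m i az p u)).
Qed.

Section Pint.
Variables (a b : R) (M : R -> axis -> axis -> R).
Hypotheses (Hab : a <= b) (HM : continuous_family M).

Lemma pint_integrand_ex_RInt (m : R -> R) f p : (forall t : R, continuous m t) -> (forall q : R3, continuous f q) ->
  ex_RInt (fun t => m t * f (lin (M t) p)) a b.
Proof.
  intros Hm Hf.
  apply (jointly_continuous_ex_RInt (U := R_UniformSpace) (fun _ t => m t * f (lin (M t) p)) a b 0).
  apply (pint_integrand_continuous (U := R_UniformSpace) M m f (fun _ => p)); auto.
  intros; apply continuous_const.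
Qed.

Lemma pint_continuous (m : R -> R) f (p : R3) : (forall t : R, continuous m t) ->
  (forall q : R3, continuous f q) -> continuous (pint a b M m f) p.
Proof.
  intros Hm Hf.
  apply (continuous_RInt_param (fun (q : prod_UniformSpace (prod_UniformSpace R_UniformSpace R_UniformSpace) R_UniformSpace) t => m t * f (lin (M t) q))); [exact Hab|].
  apply (pint_integrand_continuous M m f (fun q => q)); auto.
  intros; apply continuous_id.
Qed.

Lemma continuous_mult_family (m : R -> R) j i : (forall t : R, continuous m t) ->
  forall t, continuous (fun s => m s * M s j i) t.
Proof. intros Hm t; apply (@continuous_mult _ R_AbsRing); [apply Hm | apply HM]. Qed.

Lemma pint_is_partial (m : R -> R) f i p : (forall t : R, continuous m t) -> smooth3 f ->
  is_partial i (pint a b M m f) p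
    (pint a b M (fun t => m t * M t ax i) (partial ax f) p
     + pint a b M (fun t => m t * M t ay i) (partial ay f) p
     + pint a b M (fun t => m t * M t az i) (partial az f) p).
Proof.
  intros Hm Hf; unfold is_partial, pint.
  assert (Hder : forall t u : R, is_derive (fun z => m t * f (lin (M t) (upd p i z))) u
     (m t * M t ax i * partial ax f (lin (M t) (upd p i u))
      + m t * M t ay i * partial ay f (lin (M t) (upd p i u))
      + m t * M t az i * partial az f (lin (M t) (upd p i u)))).
  { intros t u.
    eapply is_derive_eq.
    - exact (is_derive_scal _ u (m t) _ (is_derive_lin (M t) f i p u Hf)).
    - ring. }
  assert (HD : forall t u : R, Derive (fun z => m t * f (lin (M t) (upd p i z))) u =
     m t * M t ax i * partial ax f (lin (M t) (upd p i u))
      + m t * M t ay i * partial ay f (lin (M t) (upd p i u))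
      + m t * M t az i * partial az f (lin (M t) (upd p i u))).
  { intros t u; apply is_derive_unique, Hder. }
  assert (Cu : forall u : R, continuous (fun z : R => upd p i z) u).
  { intros u; destruct p as [[x y] z]; destruct i; simpl; apply continuous_tuple3;
      first [apply continuous_const | apply continuous_id]. }
  assert (H : is_derive (fun u => RInt (fun t => m t * f (lin (M t) (upd p i u))) a b)
    (coord i p)
    (RInt (fun t => Derive (fun z => m t * f (lin (M t) (upd p i z))) (coord i p)) a b)).
  { apply (is_derive_RInt_param (fun u t => m t * f (lin (M t) (upd p i u)))).
    + apply filter_forall; intros u t _; eexists; apply Hder.
    + intros t _.
      eapply continuity_2d_pt_ext; [intros u v; symmetry; apply HD|].
      apply continuity_2d_pt_filterlim.
      assert (J : forall j, jointly_continuous (U := R_UniformSpace)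
        (fun u v => m v * M v j i * partial j f (lin (M v) (upd p i u)))).
      { intros j; apply (pint_integrand_continuous M (fun v => m v * M v j i)); auto.
        - now apply continuous_mult_family.
        - apply smooth3_cont, smooth3_partial, Hf. }
      exact (@continuous_plus _ R_AbsRing R_NormedModule _ _ _
        (@continuous_plus _ R_AbsRing R_NormedModule _ _ _ (J ax _ t) (J ay _ t)) (J az _ t)).
    + apply filter_forall; intros u; apply pint_integrand_ex_RInt; auto.
      apply smooth3_cont, Hf. }
  apply (is_derive_eq _ _ _ _ H).
  rewrite (RInt_ext _ (fun t => m t * M t ax i * partial ax f (lin (M t) p)
    + m t * M t ay i * partial ay f (lin (M t) p)
    + m t * M t az i * partial az f (lin (M t) p)))
    by (intros t _; rewrite HD, upd_coord; reflexivity).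
  assert (Ex : forall j, ex_RInt (fun t => m t * M t j i * partial j f (lin (M t) p)) a b).
  { intros j; apply (pint_integrand_ex_RInt (fun t => m t * M t j i)).
    - now apply continuous_mult_family.
    - apply smooth3_cont, smooth3_partial, Hf. }
  rewrite (RInt_Rplus
    (fun t => m t * M t ax i * partial ax f (lin (M t) p)
              + m t * M t ay i * partial ay f (lin (M t) p)));
    [| apply (@ex_RInt_plus R_NormedModule); apply Ex | apply Ex].
  rewrite RInt_Rplus; [reflexivity | apply Ex | apply Ex].
Qed.

Lemma pint_partial (m : R -> R) f i : (forall t : R, continuous m t) -> smooth3 f ->
  partial i (pint a b M m f) = fun p =>
    pint a b M (fun t => m t * M t ax i) (partial ax f) p
    + pint a b M (fun t => m t * M t ay i) (partial ay f) p
    + pint a b M (fun t => m t * M t az i) (partial az f) p.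
Proof.
  intros Hm Hf; apply functional_extensionality; intros p.
  now apply is_partial_unique, pint_is_partial.
Qed.

Lemma pint_smooth3 (m : R -> R) f : (forall t : R, continuous m t) -> smooth3 f -> smooth3 (pint a b M m f).
Proof.
  intros Hm Hf n; revert m f Hm Hf; induction n as [|n IH]; intros m f Hm Hf;
    (split; [intros p; apply pint_continuous; [exact Hm | apply smooth3_cont, Hf]|]).
  - exact I.
  - intros i; split.
    + intros p; eapply is_partial_ex, pint_is_partial; auto.
    + rewrite pint_partial by auto.
      repeat apply Cn3_plus; apply IH; auto using continuous_mult_family, smooth3_partial.
Qed.
End Pint.

(** * Division lemmas and averaging over rotations *)

Lemma is_RInt_Rext (f g : R -> R) a b l : (forall t, f t = g t) ->
  is_RInt f a b l -> is_RInt g a b l.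
Proof. intros H; replace g with f; auto; now apply functional_extensionality. Qed.

Lemma is_RInt_Rplus (f g : R -> R) a b k l : is_RInt f a b k -> is_RInt g a b l ->
  is_RInt (fun t => f t + g t) a b (k + l).
Proof. intros Hf Hg; exact (is_RInt_plus f g a b k l Hf Hg). Qed.

Lemma is_RInt_Rscal (f : R -> R) a b c l : is_RInt f a b l ->
  is_RInt (fun t => c * f t) a b (c * l).
Proof. intros Hf; exact (is_RInt_scal f a b c l Hf). Qed.

Lemma is_RInt_Rmult_1 (f : R -> R) a b l : is_RInt f a b l ->
  is_RInt (fun t => 1 * f t) a b l.
Proof. apply is_RInt_Rext; intros t; ring. Qed.

Lemma is_RInt_ftc (f df : R -> R) a b : (forall t : R, is_derive f t (df t)) ->
  (forall t : R, continuous df t) -> is_RInt df a b (f b - f a).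
Proof. intros H1 H2; apply (is_RInt_derive f df a b); auto. Qed.

Lemma pint_is_RInt a b M (m : R -> R) f p : a <= b -> continuous_family M ->
  (forall t : R, continuous m t) -> (forall q : R3, continuous f q) ->
  is_RInt (fun t => m t * f (lin (M t) p)) a b (pint a b M m f p).
Proof.
  intros Hab HM Hm Hf; apply (RInt_correct (V := R_CompleteNormedModule)).
  now apply pint_integrand_ex_RInt.
Qed.

Lemma pint_eq a b M (m : R -> R) f p l :
  is_RInt (fun t => m t * f (lin (M t) p)) a b l -> pint a b M m f p = l.
Proof. intros H; apply is_RInt_unique, H. Qed.

(** Here the point is fixed and the matrix moves. For dilations this feeds the Hadamard formula, for
    rotations it identifies [rot] as the derivative along the flow. *)
Lemma is_derive_lin_family M M' f p (t : R) : smooth3 f ->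
  (forall i j, is_derive (fun s => M s i j) t (M' i j)) ->
  is_derive (fun s => f (lin (M s) p)) t
    (partial ax f (lin (M t) p) * coord ax (lin M' p)
     + partial ay f (lin (M t) p) * coord ay (lin M' p)
     + partial az f (lin (M t) p) * coord az (lin M' p)).
Proof.
  intros Hf HM.
  assert (Hr : forall i, is_derive (fun s => M s i ax * coord ax p + M s i ay * coord ay p
                                  + M s i az * coord az p) t (coord i (lin M' p))).
  { intros i.
    replace (coord i (lin M' p)) with (M' i ax * coord ax p + M' i ay * coord ay p
      + M' i az * coord az p) by (destruct i; reflexivity).
    assert (Hs : forall j, is_derive (fun s => M s i j * coord j p) t (M' i j * coord j p)).
    { intros j; apply (is_derive_ext (fun s => coord j p * M s i j)); [intros; apply Rmult_comm|].
      rewrite Rmult_comm; exact (is_derive_scal _ t (coord j p) _ (HM i j)). }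
    exact (@is_derive_plus R_AbsRing R_NormedModule _ _ _ _ _
      (@is_derive_plus R_AbsRing R_NormedModule _ _ _ _ _ (Hs ax) (Hs ay)) (Hs az)). }
  exact (is_derive_curve f _ _ _ t _ _ _ Hf (Hr ax) (Hr ay) (Hr az)).
Qed.

(** Closed with [Defined] so that the entries of [dilation] reduce on concrete axes. *)
Lemma axis_eq_dec (i j : axis) : {i = j} + {i <> j}.
Proof. decide equality. Defined.

(** Scales the axes in [S] and fixes the others. The choice {x, y} retracts onto the axis, {y} onto
    the plane y = 0, and {z} gives integration in z. *)
Definition dilation (S : axis -> bool) (t : R) (i j : axis) : R :=
  if axis_eq_dec i j then (if S i then t else 1) else 0.

Lemma dilation_is_derive S t i j :
  is_derive (fun s => dilation S s i j) t
    (if axis_eq_dec i j then (if S i then 1 else 0) else 0).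
Proof.
  unfold dilation; destruct (axis_eq_dec i j); [destruct (S i)|]; auto_derive; auto.
Qed.

Lemma dilation_continuous S : continuous_family (dilation S).
Proof. intros i j t; eapply is_derive_continuous, dilation_is_derive. Qed.

Lemma lin_dilation S t p :
  lin (dilation S t) p = ((if S ax then t else 1) * coord ax p,
    (if S ay then t else 1) * coord ay p, (if S az then t else 1) * coord az p).
Proof. unfold lin, dilation; simpl; f_equal; [f_equal|]; ring. Qed.

Lemma lin_dilation_1 S p : lin (dilation S 1) p = p.
Proof.
  rewrite lin_dilation; destruct p as [[x y] z]; simpl.
  destruct (S ax), (S ay), (S az); f_equal; [f_equal| |f_equal| |f_equal| |f_equal|
    |f_equal| |f_equal| |f_equal| |f_equal|]; ring.
Qed.

Definition quot (S : axis -> bool) (i : axis) (f : R3 -> R) : R3 -> R :=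
  pint 0 1 (dilation S) (fun _ => 1) (partial i f).

Lemma continuous_Rconst (c t : R) : continuous (fun _ : R => c) t.
Proof. apply continuous_const. Qed.

Lemma quot_smooth3 S i f : smooth3 f -> smooth3 (quot S i f).
Proof.
  intros Hf; exact (pint_smooth3 0 1 _ Rle_0_1 (dilation_continuous S) _ _
    (continuous_Rconst 1) (smooth3_partial f i Hf)).
Qed.

(** The fundamental theorem of calculus for [t |-> f (lin (dilation S t) p)] on [0, 1]: at 1 the
    dilation is the identity, at 0 it projects along the axes in [S], and each axis in [S]
    contributes its coordinate times the integral [quot]. *)
Lemma hadamard S f p : smooth3 f ->
  f p = f (lin (dilation S 0) p)
        + (if S ax then coord ax p else 0) * quot S ax f p
        + (if S ay then coord ay p else 0) * quot S ay f p
        + (if S az then coord az p else 0) * quot S az f p.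
Proof.
  intros Hf.
  set (c := fun i => if S i then coord i p else 0).
  set (df := fun t => c ax * (1 * partial ax f (lin (dilation S t) p))
    + c ay * (1 * partial ay f (lin (dilation S t) p))
    + c az * (1 * partial az f (lin (dilation S t) p))).
  assert (I : forall i, is_RInt (fun t => 1 * partial i f (lin (dilation S t) p)) 0 1
                          (quot S i f p)).
  { intros i; exact (pint_is_RInt 0 1 _ _ _ p Rle_0_1 (dilation_continuous S)
      (continuous_Rconst 1) (smooth3_cont _ (smooth3_partial f i Hf))). }
  assert (I1 : is_RInt df 0 1 (c ax * quot S ax f p + c ay * quot S ay f p
                               + c az * quot S az f p)).
  { exact (is_RInt_Rplus _ _ _ _ _ _ (is_RInt_Rplus _ _ _ _ _ _
      (is_RInt_Rscal _ _ _ (c ax) _ (I ax)) (is_RInt_Rscal _ _ _ (c ay) _ (I ay)))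
      (is_RInt_Rscal _ _ _ (c az) _ (I az))). }
  assert (Hd : forall t : R, is_derive (fun s => f (lin (dilation S s) p)) t (df t)).
  { intros t; eapply is_derive_eq.
    - apply (is_derive_lin_family (dilation S) (fun i j =>
        if axis_eq_dec i j then (if S i then 1 else 0) else 0) f p t Hf).
      intros i j; apply dilation_is_derive.
    - unfold df, c, lin; simpl; destruct (S ax), (S ay), (S az); ring. }
  assert (Hc : forall t : R, continuous df t).
  { intros t.
    assert (Ci : forall i, continuous (fun t => c i * (1 * partial i f (lin (dilation S t) p))) t).
    { intros i; apply (@continuous_scal_r _ R_AbsRing R_NormedModule (c i)
        (fun t => 1 * partial i f (lin (dilation S t) p))).
      apply (jointly_continuous_l (U := R_UniformSpace)
        (fun _ t => 1 * partial i f (lin (dilation S t) p)) 0 t).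
      exact (pint_integrand_continuous (dilation S) (fun _ => 1) (partial i f) (fun _ => p)
        (dilation_continuous S) (continuous_Rconst 1)
        (smooth3_cont _ (smooth3_partial f i Hf)) (fun u => continuous_const p u)). }
    exact (@continuous_plus _ R_AbsRing R_NormedModule _ _ _
      (@continuous_plus _ R_AbsRing R_NormedModule _ _ _ (Ci ax) (Ci ay)) (Ci az)). }
  pose proof (is_RInt_ftc _ _ 0 1 Hd Hc) as I2; cbv beta in I2.
  rewrite lin_dilation_1 in I2.
  pose proof (is_RInt_unique _ _ _ _ I1) as E1; rewrite (is_RInt_unique _ _ _ _ I2) in E1.
  unfold c in E1; lra.
Qed.

Definition on_axis (z : R) : R3 := (0, 0, z).

Lemma hadamard_axis f : smooth3 f -> (forall z, f (on_axis z) = 0) ->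
  exists g h, smooth3 g /\ smooth3 h /\
    f = fun p => coord ax p * g p + coord ay p * h p.
Proof.
  intros Hf H0.
  set (S := fun i => match i with az => false | _ => true end).
  exists (quot S ax f), (quot S ay f); repeat split; auto using quot_smooth3.
  apply functional_extensionality; intros p.
  rewrite (hadamard S f p Hf) at 1; rewrite lin_dilation; simpl.
  rewrite Rmult_0_l, Rmult_0_l, Rmult_1_l.
  change (0, 0, coord az p) with (on_axis (coord az p)); rewrite H0; ring.
Qed.

Lemma continuous_upd_1 i p (t : R) : continuous (fun s => upd p i s) t.
Proof.
  destruct p as [[x y] z]; destruct i; simpl; apply continuous_tuple3;
    first [apply continuous_const | apply continuous_id].
Qed.

Lemma continuous_zero_punctured (f : R -> R) (a : R) : continuous f a ->
  (forall t, t <> a -> f t = 0) -> f a = 0.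
Proof.
  intros Hc H; apply NNPP; intros Hn.
  assert (He : 0 < Rabs (f a)) by now apply Rabs_pos_lt.
  destruct (proj1 (filterlim_locally _ _) Hc (mkposreal _ He)) as [d Hd].
  assert (Hb : ball a d (a + d / 2)).
  { change (Rabs (a + d / 2 - a) < d); replace (a + d / 2 - a) with (d / 2) by ring.
    pose proof (cond_pos d); rewrite Rabs_pos_eq; lra. }
  specialize (Hd _ Hb); rewrite H in Hd by (pose proof (cond_pos d); lra).
  change (Rabs (0 - f a) < Rabs (f a)) in Hd.
  rewrite Rminus_0_l, Rabs_Ropp in Hd; lra.
Qed.

(** The complement of a coordinate plane is dense. This is the device by which an identity
    multiplied by x or y is divided again. *)
Lemma coord_cancel i f : (forall p : R3, continuous f p) ->
  (forall p, coord i p * f p = 0) -> f = fun _ => 0.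
Proof.
  intros Hc H; apply functional_extensionality; intros p.
  assert (Hq : forall q, coord i q <> 0 -> f q = 0).
  { intros q Hq; destruct (Rmult_integral _ _ (H q)); [contradiction | assumption]. }
  destruct (Req_dec (coord i p) 0) as [E|E]; [|now apply Hq].
  rewrite <- (upd_coord p i); rewrite E.
  apply (continuous_zero_punctured (fun t => f (upd p i t))).
  - apply (continuous_comp (fun t => upd p i t) f); [apply continuous_upd_1 | apply Hc].
  - intros t Ht; apply Hq; now rewrite coord_upd_same.
Qed.

(** Where x^2 + y^2 vanishes so does x, which reduces the claim to [coord_cancel ax]. *)
Lemma rho_cancel f : (forall p : R3, continuous f p) ->
  (forall p, (coord ax p ^ 2 + coord ay p ^ 2) * f p = 0) -> f = fun _ => 0.
Proof.
  intros Hc H; apply (coord_cancel ax); [exact Hc|]; intros p.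
  destruct (Rmult_integral _ _ (H p)) as [E|E]; [|rewrite E; ring].
  replace (coord ax p) with 0 by nra; ring.
Qed.

(* On [y = 0] the relation forces [b = 0], so [b] is divisible by [y]. *)
Lemma orthogonal_to_radial b c : smooth3 b -> smooth3 c ->
  (forall p, coord ax p * b p + coord ay p * c p = 0) ->
  exists w, smooth3 w /\ b = (fun p => - (coord ay p * w p)) /\ c = fun p => coord ax p * w p.
Proof.
  intros Hb Hc H.
  set (S := fun i => match i with ay => true | _ => false end).
  assert (Hb0 : (fun p => b (upd p ay 0)) = fun _ => 0).
  { apply (coord_cancel ax).
    - intros p; apply (continuous_comp (fun q : R3 => upd q ay 0) b); [|apply smooth3_cont, Hb].
      apply (continuous_ext (fun q : R3 => (coord ax q, 0, coord az q) : R3)).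
      { intros [[x y] z]; reflexivity. }
      apply continuous_tuple3; [apply continuous_coord | apply continuous_const
        | apply continuous_coord].
    - intros p; specialize (H (upd p ay 0)); destruct p as [[x y] z]; simpl in *; lra. }
  exists (fun p => - quot S ay b p); split; [apply smooth3_opp, quot_smooth3, Hb|].
  assert (Eb : forall p, b p = coord ay p * quot S ay b p).
  { intros p; rewrite (hadamard S b p Hb) at 1; rewrite lin_dilation; simpl.
    pose proof (f_equal (fun g => g p) Hb0) as E; cbv beta in E.
    replace (1 * coord ax p, 0 * coord ay p, 1 * coord az p) with (upd p ay 0).
    - rewrite E; ring.
    - destruct p as [[x y] z]; simpl; now rewrite !Rmult_1_l, Rmult_0_l. }
  split; apply functional_extensionality; intros p; [rewrite Eb; ring|].
  apply Rminus_diag_uniq.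
  assert (E : (fun p => c p - coord ax p * - quot S ay b p) = fun _ => 0).
  { apply (coord_cancel ay).
    - intros q; apply smooth3_cont.
      apply smooth3_minus; [exact Hc|]; apply smooth3_mult;
        auto using smooth3_coord, smooth3_opp, quot_smooth3.
    - intros q; specialize (H q); rewrite Eb in H; lra. }
  exact (f_equal (fun g => g p) E).
Qed.

(** The integral of [w] from 0 to z in the third variable, rescaled to [0, 1]: written as z times a
    [pint] it inherits smoothness. [zint_RInt] undoes the rescaling. *)
Definition zint (w : R3 -> R) : R3 -> R := fun p =>
  coord az p *
  pint 0 1 (dilation (fun i => match i with az => true | _ => false end)) (fun _ => 1) w p.

Lemma zint_smooth3 w : smooth3 w -> smooth3 (zint w).
Proof.
  intros Hw; apply smooth3_mult; [apply smooth3_coord|].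
  exact (pint_smooth3 0 1 _ Rle_0_1 (dilation_continuous _) _ _ (continuous_Rconst 1) Hw).
Qed.

Lemma zint_RInt w x y z : smooth3 w -> zint w (x, y, z) = RInt (fun s => w (x, y, s)) 0 z.
Proof.
  intros Hw; unfold zint, pint; simpl.
  assert (Hc : forall s : R, continuous (fun s => w (x, y, s)) s).
  { intros s; apply (continuous_comp (fun t => upd (x, y, 0) az t) w);
      [apply continuous_upd_1 | apply smooth3_cont, Hw]. }
  pose proof (RInt_comp_lin (fun s => w (x, y, s)) z 0 0 1) as E.
  rewrite Rmult_0_r, Rmult_1_r, !Rplus_0_r in E.
  rewrite <- E by (apply (@ex_RInt_continuous R_CompleteNormedModule); auto).
  rewrite (RInt_scal (fun s => w (x, y, z * s + 0))).
  - change (scal z ?u) with (z * u); f_equal; apply RInt_ext; intros t _.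
    rewrite lin_dilation; simpl; rewrite !Rmult_1_l, Rplus_0_r; do 2 f_equal; ring.
  - apply (@ex_RInt_continuous R_CompleteNormedModule); intros t _.
    apply (continuous_comp (fun t => z * t + 0) (fun s => w (x, y, s))); [|apply Hc].
    eapply is_derive_continuous; auto_derive; auto.
Qed.

Lemma partial_zint w : smooth3 w -> partial az (zint w) = w.
Proof.
  intros Hw; apply functional_extensionality; intros [[x y] z]; apply is_partial_unique.
  unfold is_partial; simpl.
  apply (is_derive_ext (fun t => RInt (fun s => w (x, y, s)) 0 t)).
  { intros t; now rewrite zint_RInt. }
  assert (Hc : forall s : R, continuous (fun s => w (x, y, s)) s).
  { intros s; apply (continuous_comp (fun t => upd (x, y, 0) az t) w);
      [apply continuous_upd_1 | apply smooth3_cont, Hw]. }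
  apply (is_derive_RInt (fun s => w (x, y, s)) _ 0 z); [|apply Hc].
  apply filter_forall; intros t; apply (RInt_correct (V := R_CompleteNormedModule)).
  apply (@ex_RInt_continuous R_CompleteNormedModule); auto.
Qed.

Lemma zint_plane w x y : zint w (x, y, 0) = 0.
Proof. unfold zint; simpl; ring. Qed.

Lemma z_invariant f : smooth3 f -> (forall p, partial az f p = 0) ->
  forall x y z z', f (x, y, z) = f (x, y, z').
Proof.
  intros Hf H x y z z'.
  assert (K : forall a b, a < b -> f (x, y, a) = f (x, y, b)).
  { intros a b Hab; apply (eq_is_derive (fun t => f (x, y, t)) a b); [|exact Hab].
    intros t _; pose proof (smooth3_is f az (x, y, t) Hf) as D; rewrite H in D; exact D. }
  destruct (Rtotal_order z z') as [h|[->|h]]; [now apply K | reflexivity | now symmetry; apply K].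
Qed.

(** * Rotations about the z-axis and weighted circle averages *)

Definition rot (f : R3 -> R) : R3 -> R :=
  fun p => coord ax p * partial ay f p - coord ay p * partial ax f p.

Lemma rot_smooth3 f : smooth3 f -> smooth3 (rot f).
Proof.
  intros Hf; apply smooth3_minus; apply smooth3_mult; auto using smooth3_coord, smooth3_partial.
Qed.

Definition rotm (t : R) (i j : axis) : R :=
  match i, j with
  | ax, ax => cos t | ax, ay => - sin t
  | ay, ax => sin t | ay, ay => cos t
  | az, az => 1 | _, _ => 0
  end.

Lemma rotm_is_derive t i j : is_derive (fun s => rotm s i j) t
  (match i, j with
  | ax, ax => - sin t | ax, ay => - cos t
  | ay, ax => cos t | ay, ay => - sin t
  | _, _ => 0 end).
Proof. destruct i, j; simpl; auto_derive; auto; ring. Qed.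

Lemma rotm_continuous : continuous_family rotm.
Proof. intros i j t; eapply is_derive_continuous, rotm_is_derive. Qed.

Lemma is_derive_rotation f p (t : R) : smooth3 f ->
  is_derive (fun s => f (lin (rotm s) p)) t (rot f (lin (rotm t) p)).
Proof.
  intros Hf; eapply is_derive_eq.
  - apply (is_derive_lin_family rotm _ f p t Hf (rotm_is_derive t)).
  - unfold rot; simpl; ring.
Qed.

Lemma lin_rotm_period p : lin (rotm (2 * PI)) p = p.
Proof.
  destruct p as [[x y] z]; unfold lin, rotm; simpl; rewrite cos_2PI, sin_2PI.
  f_equal; [f_equal|]; ring.
Qed.

Lemma lin_rotm_0 p : lin (rotm 0) p = p.
Proof.
  destruct p as [[x y] z]; unfold lin, rotm; simpl; rewrite cos_0, sin_0.
  f_equal; [f_equal|]; ring.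
Qed.

Lemma lin_rotm_axis t z : lin (rotm t) (on_axis z) = on_axis z.
Proof. unfold lin, rotm, on_axis; simpl; f_equal; [f_equal|]; ring. Qed.

Definition circ (m : R -> R) : (R3 -> R) -> R3 -> R := pint 0 (2 * PI) rotm m.

Lemma two_PI_nonneg : 0 <= 2 * PI.
Proof. pose proof PI_RGT_0; lra. Qed.

Section Circ.
Variable m : R -> R.
Hypothesis Hm : forall t : R, continuous m t.

Lemma circ_smooth3 f : smooth3 f -> smooth3 (circ m f).
Proof.
  intros Hf; exact (pint_smooth3 _ _ _ two_PI_nonneg rotm_continuous _ _ Hm Hf).
Qed.

Lemma circ_is_RInt f p : smooth3 f ->
  is_RInt (fun t => m t * f (lin (rotm t) p)) 0 (2 * PI) (circ m f p).
Proof.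
  intros Hf; exact (pint_is_RInt _ _ _ _ _ p two_PI_nonneg rotm_continuous Hm (smooth3_cont _ Hf)).
Qed.

(** The three terms of the derivative are gathered into one integral, so that commutation statements
    reduce to equality of integrands. *)
Lemma circ_partial_is_RInt f i p : smooth3 f ->
  is_RInt (fun t => m t * (rotm t ax i * partial ax f (lin (rotm t) p)
     + rotm t ay i * partial ay f (lin (rotm t) p)
     + rotm t az i * partial az f (lin (rotm t) p))) 0 (2 * PI)
   (partial i (circ m f) p).
Proof.
  intros Hf; unfold circ.
  rewrite (pint_partial _ _ _ rotm_continuous _ _ i Hm Hf).
  assert (I : forall j, is_RInt (fun t => m t * rotm t j i * partial j f (lin (rotm t) p))
    0 (2 * PI) (pint 0 (2 * PI) rotm (fun t => m t * rotm t j i) (partial j f) p)).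
  { intros j; exact (pint_is_RInt _ _ _ _ _ p two_PI_nonneg rotm_continuous
      (continuous_mult_family rotm rotm_continuous m j i Hm)
      (smooth3_cont _ (smooth3_partial f j Hf))). }
  eapply is_RInt_Rext; [|exact (is_RInt_Rplus _ _ _ _ _ _
    (is_RInt_Rplus _ _ _ _ _ _ (I ax) (I ay)) (I az))].
  intros t; cbv beta; ring.
Qed.

(** Rotations commute with one another, so no property of the weight enters beyond continuity; in
    particular the non-periodic weight [t] is allowed. *)
Lemma rot_circ f p : smooth3 f -> rot (circ m f) p = circ m (rot f) p.
Proof.
  intros Hf; symmetry; apply pint_eq; unfold rot at 2.
  unfold Rminus; rewrite (Ropp_mult_distr_l (coord ay p)).
  eapply is_RInt_Rext; [|exact (is_RInt_Rplus _ _ _ _ _ _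
    (is_RInt_Rscal _ _ _ (coord ax p) _ (circ_partial_is_RInt f ay p Hf))
    (is_RInt_Rscal _ _ _ (- coord ay p) _ (circ_partial_is_RInt f ax p Hf)))].
  intros t; unfold rot; simpl; ring.
Qed.

Lemma partial_z_circ f p : smooth3 f -> partial az (circ m f) p = circ m (partial az f) p.
Proof.
  intros Hf; symmetry; apply pint_eq.
  eapply is_RInt_Rext; [|exact (circ_partial_is_RInt f az p Hf)].
  intros t; simpl; ring.
Qed.

Lemma circ_zero f p : (forall t, f (lin (rotm t) p) = 0) -> circ m f p = 0.
Proof.
  intros H; apply pint_eq.
  apply (is_RInt_Rext (fun _ => 0)); [intros t; rewrite H; ring|].
  pose proof (is_RInt_const 0 (2 * PI) (0 : R)) as K.
  change (scal (2 * PI - 0) (0 : R)) with ((2 * PI - 0) * 0) in K; now rewrite Rmult_0_r in K.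
Qed.
End Circ.

Definition avg (f : R3 -> R) : R3 -> R := fun p => / (2 * PI) * circ (fun _ => 1) f p.

(* Integrating by parts over the circle, the weight [t] turns rotation-invariant averaging
   into a right inverse of [rot] on functions of zero average. *)
Definition rot_inv (f : R3 -> R) : R3 -> R := fun p => / (2 * PI) * circ (fun t => t) f p.

Lemma continuous_Rid (t : R) : continuous (fun s : R => s) t.
Proof. apply continuous_id. Qed.

Lemma scal_smooth3 c f : smooth3 f -> smooth3 (fun p => c * f p).
Proof. intros; apply smooth3_mult; auto using smooth3_const. Qed.

Lemma partial_scal i c f : smooth3 f ->
  partial i (fun p => c * f p) = fun p => c * partial i f p.
Proof.
  intros Hf; rewrite smooth3_partial_mult, partial_const by auto using smooth3_const.
  apply functional_extensionality; intros p; ring.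
Qed.

Lemma avg_smooth3 f : smooth3 f -> smooth3 (avg f).
Proof. intros H; exact (scal_smooth3 _ _ (circ_smooth3 _ (continuous_Rconst 1) f H)). Qed.

Lemma rot_inv_smooth3 f : smooth3 f -> smooth3 (rot_inv f).
Proof. intros H; exact (scal_smooth3 _ _ (circ_smooth3 _ continuous_Rid f H)). Qed.

Lemma rot_scal c f p : smooth3 f -> rot (fun q => c * f q) p = c * rot f p.
Proof. intros; unfold rot; rewrite !partial_scal by assumption; ring. Qed.

Lemma continuous_along_rotation f p (t : R) : smooth3 f ->
  continuous (fun s => f (lin (rotm s) p)) t.
Proof. intros Hf; eapply is_derive_continuous, is_derive_rotation, Hf. Qed.

(** The integrand is the total derivative of [f] along a full turn, which starts and ends at [p]. *)
Lemma circ_rot_1 f p : smooth3 f -> circ (fun _ => 1) (rot f) p = 0.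
Proof.
  intros Hf; apply pint_eq, is_RInt_Rmult_1.
  pose proof (is_RInt_ftc (fun s => f (lin (rotm s) p)) (fun s => rot f (lin (rotm s) p))
    0 (2 * PI)) as H.
  cbv beta in H; rewrite lin_rotm_period, lin_rotm_0, Rminus_diag in H; apply H.
  - intros; now apply is_derive_rotation.
  - intros; now apply continuous_along_rotation, rot_smooth3.
Qed.

(** The term [2 * PI * f p] is the boundary term: [t * f (R_t p)] is 0 at the start and the full
    turn brings the point back to [p]. *)
Lemma circ_rot_id f p : smooth3 f ->
  circ (fun t => t) (rot f) p = 2 * PI * f p - circ (fun _ => 1) f p.
Proof.
  intros Hf; apply pint_eq.
  pose proof (is_RInt_ftc (fun s => s * f (lin (rotm s) p))
    (fun s => 1 * f (lin (rotm s) p) + s * rot f (lin (rotm s) p)) 0 (2 * PI)) as H.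
  cbv beta in H; rewrite lin_rotm_period, lin_rotm_0 in H.
  assert (I1 := H ltac:(intros t; exact (is_derive_mult _ _ t _ _
      (@is_derive_id R_AbsRing t) (is_derive_rotation f p t Hf) Rmult_comm))
    ltac:(intros t; exact (@continuous_plus _ R_AbsRing R_NormedModule _ _ _
      (@continuous_mult _ R_AbsRing _ _ _ (continuous_Rconst 1 t) (continuous_along_rotation f p t Hf))
      (@continuous_mult _ R_AbsRing _ _ _ (continuous_Rid t)
        (continuous_along_rotation (rot f) p t (rot_smooth3 f Hf)))))).
  clear H.
  pose proof (circ_is_RInt (fun _ => 1) (continuous_Rconst 1) f p Hf) as I2.
  replace (2 * PI * f p - circ (fun _ => 1) f p)
    with ((2 * PI * f p - 0 * f p) + (-1) * circ (fun _ => 1) f p) by ring.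
  eapply is_RInt_Rext; [|exact (is_RInt_Rplus _ _ _ _ _ _ I1 (is_RInt_Rscal _ _ _ (-1) _ I2))].
  intros t; cbv beta; ring.
Qed.

Lemma rot_avg f p : smooth3 f -> rot (avg f) p = 0.
Proof.
  intros Hf; unfold avg; rewrite rot_scal by exact (circ_smooth3 _ (continuous_Rconst 1) f Hf).
  rewrite rot_circ, circ_rot_1 by first [exact (continuous_Rconst 1) | exact Hf]; ring.
Qed.

Lemma avg_rot f p : smooth3 f -> avg (rot f) p = 0.
Proof. intros Hf; unfold avg; rewrite circ_rot_1 by exact Hf; ring. Qed.

Lemma rot_rot_inv f p : smooth3 f -> rot (rot_inv f) p = f p - avg f p.
Proof.
  intros Hf; unfold rot_inv, avg.
  rewrite rot_scal by exact (circ_smooth3 _ continuous_Rid f Hf).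
  rewrite rot_circ, circ_rot_id by first [exact continuous_Rid | exact Hf].
  field; pose proof PI_RGT_0; lra.
Qed.

Lemma partial_z_avg f p : smooth3 f -> partial az (avg f) p = avg (partial az f) p.
Proof.
  intros Hf; unfold avg; rewrite partial_scal by exact (circ_smooth3 _ (continuous_Rconst 1) f Hf).
  now rewrite partial_z_circ by first [exact (continuous_Rconst 1) | exact Hf].
Qed.

Lemma partial_z_rot_inv f p : smooth3 f -> partial az (rot_inv f) p = rot_inv (partial az f) p.
Proof.
  intros Hf; unfold rot_inv; rewrite partial_scal by exact (circ_smooth3 _ continuous_Rid f Hf).
  now rewrite partial_z_circ by first [exact continuous_Rid | exact Hf].
Qed.

Lemma avg_axis_zero f z : f (on_axis z) = 0 -> avg f (on_axis z) = 0.
Proof.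
  intros H; unfold avg; rewrite circ_zero; [ring|]; intros t; now rewrite lin_rotm_axis.
Qed.

Lemma rot_inv_axis_zero f z : f (on_axis z) = 0 -> rot_inv f (on_axis z) = 0.
Proof.
  intros H; unfold rot_inv; rewrite circ_zero; [ring|]; intros t; now rewrite lin_rotm_axis.
Qed.

Lemma avg_zero p : avg (fun _ => 0) p = 0.
Proof. unfold avg; rewrite circ_zero; [ring | reflexivity]. Qed.

Lemma rot_inv_zero p : rot_inv (fun _ => 0) p = 0.
Proof. unfold rot_inv; rewrite circ_zero; [ring | reflexivity]. Qed.

Lemma rotation_invariant f p : smooth3 f -> (forall q, rot f q = 0) ->
  forall t, f (lin (rotm t) p) = f p.
Proof.
  intros Hf H t.
  assert (K : forall a b, a < b -> f (lin (rotm a) p) = f (lin (rotm b) p)).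
  { intros a b Hab; apply (eq_is_derive (fun s => f (lin (rotm s) p)) a b); [|exact Hab].
    intros s _; pose proof (is_derive_rotation f p s Hf) as D; rewrite H in D; exact D. }
  rewrite <- (lin_rotm_0 p) at 2.
  destruct (Rtotal_order 0 t) as [h|[<-|h]]; [now symmetry; apply K | reflexivity | now apply K].
Qed.

Lemma avg_invariant f p : smooth3 f -> (forall q, rot f q = 0) -> avg f p = f p.
Proof.
  intros Hf H; unfold avg.
  replace (circ (fun _ => 1) f p) with (2 * PI * f p).
  - field; pose proof PI_RGT_0; lra.
  - symmetry; apply pint_eq.
    apply (is_RInt_Rext (fun _ => f p)).
    + intros t; rewrite rotation_invariant by assumption; ring.
    + pose proof (is_RInt_const 0 (2 * PI) (f p)) as K.
      change (scal (2 * PI - 0) (f p)) with ((2 * PI - 0) * f p) in K.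
      now rewrite Rminus_0_r in K.
Qed.

Lemma avg_plus f g p : smooth3 f -> smooth3 g ->
  avg (fun q => f q + g q) p = avg f p + avg g p.
Proof.
  intros Hf Hg; unfold avg; rewrite <- Rmult_plus_distr_l; f_equal; apply pint_eq.
  eapply is_RInt_Rext; [|exact (is_RInt_Rplus _ _ _ _ _ _
    (circ_is_RInt _ (continuous_Rconst 1) f p Hf) (circ_is_RInt _ (continuous_Rconst 1) g p Hg))].
  intros t; cbv beta; ring.
Qed.

(** The angle is the arccosine of x / r with the sign of y; for r = 0 any angle serves. *)
Lemma polar x y : exists t, x = sqrt (x ^ 2 + y ^ 2) * cos t /\ y = sqrt (x ^ 2 + y ^ 2) * sin t.
Proof.
  set (r := sqrt (x ^ 2 + y ^ 2)).
  assert (Hr2 : r * r = x ^ 2 + y ^ 2) by (apply sqrt_sqrt; nra).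
  assert (Hr0 : 0 <= r) by apply sqrt_pos.
  destruct (Req_dec r 0) as [E|E].
  - exists 0; rewrite E in *; assert (x = 0) by nra; assert (y = 0) by nra; lra.
  - assert (Hb : -1 <= x / r <= 1).
    { set (c := x / r); assert (K : c * r = x) by (unfold c; field; exact E).
      assert (Hr : 0 < r * r) by nra.
      assert (Hsq : c * c * (r * r) <= r * r).
      { replace (c * c * (r * r)) with ((c * r) * (c * r)) by ring; rewrite K; nra. }
      assert (Hc : c * c <= 1) by nra.
      split; nra. }
    assert (Hs : sin (acos (x / r)) * sin (acos (x / r)) * (r * r) = y * y).
    { pose proof (sin2_cos2 (acos (x / r))) as S; unfold Rsqr in S.
      rewrite cos_acos in S by exact Hb.
      replace (sin (acos (x / r)) * sin (acos (x / r))) with (1 - x / r * (x / r)) by lra.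
      replace ((1 - x / r * (x / r)) * (r * r)) with (r * r - x * x) by (field; exact E).
      rewrite Hr2; ring. }
    assert (Hp : 0 <= sin (acos (x / r))).
    { pose proof (acos_bound (x / r)); apply sin_ge_0; lra. }
    destruct (Rle_dec 0 y) as [Hy|Hy].
    + exists (acos (x / r)); rewrite cos_acos by exact Hb; split; [field; exact E|].
      apply Rsqr_inj; [exact Hy | now apply Rmult_le_pos | unfold Rsqr; lra].
    + exists (- acos (x / r)); rewrite cos_neg, sin_neg, cos_acos by exact Hb.
      split; [field; exact E|].
      rewrite Ropp_mult_distr_r_reverse; apply Ropp_eq_reg; rewrite Ropp_involutive.
      apply Rsqr_inj; [lra | now apply Rmult_le_pos | unfold Rsqr; lra].
Qed.

(** * Invariant functions and smooth functions of x^2 + y^2 *)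

(** The Casimir condition freed of the bracket; [casimir_invariant] proves the equivalence. *)
Definition invariant (f : R3 -> R) : Prop :=
  smooth3 f /\ (forall p, rot f p = 0) /\ (forall p, partial az f p = 0).

Definition rho (p : R3) : R := coord ax p ^ 2 + coord ay p ^ 2.

Lemma of_rho_eq f : of_rho f = fun p => f (rho p).
Proof. apply functional_extensionality; intros [[x y] z]; reflexivity. Qed.

Lemma rho_smooth3 : smooth3 rho.
Proof.
  apply (smooth3_ext (fun p => coord ax p * coord ax p + coord ay p * coord ay p)).
  - intros p; unfold rho; ring.
  - apply smooth3_plus; apply smooth3_mult; apply smooth3_coord.
Qed.

Lemma rho_nonneg p : 0 <= rho p.
Proof. unfold rho; nra. Qed.

Lemma rot_mult f g p : smooth3 f -> smooth3 g ->
  rot (fun q => f q * g q) p = rot f p * g p + f p * rot g p.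
Proof. intros; unfold rot; rewrite !smooth3_partial_mult by assumption; ring. Qed.

Lemma rot_plus f g p : smooth3 f -> smooth3 g ->
  rot (fun q => f q + g q) p = rot f p + rot g p.
Proof. intros; unfold rot; rewrite !smooth3_partial_plus by assumption; ring. Qed.

Lemma rot_coord_x p : rot (coord ax) p = - coord ay p.
Proof. unfold rot; rewrite !partial_coord; simpl; ring. Qed.

Lemma rot_coord_y p : rot (coord ay) p = coord ax p.
Proof. unfold rot; rewrite !partial_coord; simpl; ring. Qed.

Lemma rot_partial_z f p : smooth3 f -> rot (partial az f) p = partial az (rot f) p.
Proof.
  intros Hf; unfold rot.
  rewrite smooth3_partial_minus, !smooth3_partial_mult, !partial_coord
    by (try apply smooth3_mult; auto using smooth3_coord, smooth3_partial).
  rewrite (partial_comm f ay az), (partial_comm f ax az) by exact Hf; simpl; ring.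
Qed.

Lemma rot_partial_x f p : smooth3 f ->
  rot (partial ax f) p = partial ax (rot f) p - partial ay f p.
Proof.
  intros Hf; unfold rot.
  rewrite smooth3_partial_minus, !smooth3_partial_mult, !partial_coord
    by (try apply smooth3_mult; auto using smooth3_coord, smooth3_partial).
  rewrite (partial_comm f ay ax) by exact Hf; simpl; ring.
Qed.

Lemma zero_fun_partial i f p : (forall q, f q = 0) -> partial i f p = 0.
Proof.
  intros H; replace f with (fun _ : R3 => 0).
  - now rewrite partial_const.
  - apply functional_extensionality; intros q; now rewrite H.
Qed.

Lemma invariant_const c : invariant (fun _ => c).
Proof.
  split; [apply smooth3_const|split]; intros p; unfold rot; rewrite ?partial_const; ring.
Qed.

Lemma invariant_mult f g : invariant f -> invariant g -> invariant (fun p => f p * g p).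
Proof.
  intros (Hf & Rf & Zf) (Hg & Rg & Zg); split; [now apply smooth3_mult|split]; intros p.
  - rewrite rot_mult, Rf, Rg by assumption; ring.
  - rewrite smooth3_partial_mult, Zf, Zg by assumption; ring.
Qed.

Lemma invariant_plus f g : invariant f -> invariant g -> invariant (fun p => f p + g p).
Proof.
  intros (Hf & Rf & Zf) (Hg & Rg & Zg); split; [now apply smooth3_plus|split]; intros p.
  - rewrite rot_plus, Rf, Rg by assumption; ring.
  - rewrite smooth3_partial_plus, Zf, Zg by assumption; ring.
Qed.

Lemma invariant_minus f g : invariant f -> invariant g -> invariant (fun p => f p - g p).
Proof.
  intros Hf Hg.
  replace (fun p => f p - g p) with (fun p => f p + (-1) * g p)
    by (apply functional_extensionality; intros p; ring).
  apply invariant_plus, invariant_mult; auto using invariant_const.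
Qed.

Lemma invariant_avg f : smooth3 f -> (forall p, avg (partial az f) p = 0) -> invariant (avg f).
Proof.
  intros Hf H; split; [now apply avg_smooth3|split]; intros p.
  - now apply rot_avg.
  - rewrite partial_z_avg by exact Hf; apply H.
Qed.

Lemma invariant_polar f p : invariant f -> f p = f (sqrt (rho p), 0, 0).
Proof.
  intros (Hf & Hr & Hz); destruct p as [[x y] z].
  rewrite (z_invariant f Hf Hz x y z 0).
  destruct (polar x y) as [t [Ex Ey]].
  change (rho (x, y, z)) with (x ^ 2 + y ^ 2).
  set (r := sqrt (x ^ 2 + y ^ 2)) in *; clearbody r.
  rewrite <- (rotation_invariant f (r, 0, 0) Hf Hr t).
  f_equal; unfold lin; simpl; rewrite Ex, Ey; f_equal; [f_equal|]; ring.
Qed.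

(* [f1] is the derivative with respect to [rho = x^2 + y^2]. *)
Lemma invariant_deriv f : invariant f -> exists f1, invariant f1 /\
  (forall p, partial ax f p = 2 * coord ax p * f1 p) /\
  (forall p, partial ay f p = 2 * coord ay p * f1 p).
Proof.
  intros (Hf & Hr & Hz).
  (* [rot f = 0] says that (f_y, - f_x) is orthogonal to (x, y). *)
  destruct (orthogonal_to_radial (partial ay f) (fun p => - partial ax f p)) as (w & Hw & Eb & Ec).
  - now apply smooth3_partial.
  - now apply smooth3_opp, smooth3_partial.
  - intros p; pose proof (Hr p) as H; unfold rot in H; lra.
  (* The lemma gives f_y = - y w and - f_x = x w; comparison with 2 y f1 and 2 x f1 yields f1 = - w
     / 2. *)
  - set (f1 := fun p => (-1/2) * w p).
    assert (H1 : smooth3 f1) by now apply scal_smooth3.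
    assert (Ex : forall p, partial ax f p = 2 * coord ax p * f1 p).
    { intros p; pose proof (f_equal (fun g => g p) Ec) as E; cbv beta in E; unfold f1; lra. }
    assert (Ey : forall p, partial ay f p = 2 * coord ay p * f1 p).
    { intros p; pose proof (f_equal (fun g => g p) Eb) as E; cbv beta in E; unfold f1; lra. }
    clearbody f1; exists f1; split; [split; [exact H1|split]|split; assumption].
    (* Apply [rot] to f_x = 2 x f1. The left side gives - f_y = - 2 y f1, because the commutator of
       [rot] with the x-derivative is minus the y-derivative; the right side gives - 2 y f1 + 2 x
       rot f1. Hence x rot f1 = 0. *)
    + assert (K : rot f1 = fun _ => 0); [|intros p; now rewrite K].
      apply (coord_cancel ax); [now apply smooth3_cont, rot_smooth3|]; intros p.
      assert (E : rot (partial ax f) p = - (2 * coord ay p * f1 p)).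
      { rewrite rot_partial_x, Ey by exact Hf.
        rewrite (zero_fun_partial ax (rot f) p Hr); ring. }
      assert (F : partial ax f = fun q => 2 * (coord ax q * f1 q)).
      { apply functional_extensionality; intros q; rewrite Ex; ring. }
      rewrite F, rot_scal, rot_mult, rot_coord_x in E
        by (try apply smooth3_mult; auto using smooth3_coord).
      lra.
    + assert (K : partial az f1 = fun _ => 0); [|intros p; now rewrite K].
      apply (coord_cancel ax); [now apply smooth3_cont, smooth3_partial|]; intros p.
      assert (E : partial az (partial ax f) p = 0).
      { rewrite partial_comm by exact Hf; now apply zero_fun_partial. }
      assert (F : partial ax f = fun q => 2 * (coord ax q * f1 q)).
      { apply functional_extensionality; intros q; rewrite Ex; ring. }
      rewrite F, partial_scal, smooth3_partial_mult, partial_coord in E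
        by (try apply smooth3_mult; auto using smooth3_coord).
      simpl in E; lra.
Qed.

Lemma partial_rho i p :
  partial i rho p = match i with ax => 2 * coord ax p | ay => 2 * coord ay p | az => 0 end.
Proof.
  replace rho with (fun q => coord ax q * coord ax q + coord ay q * coord ay q)
    by (apply functional_extensionality; intros q; unfold rho; ring).
  rewrite smooth3_partial_plus, !smooth3_partial_mult, !partial_coord
    by (try apply smooth3_mult; apply smooth3_coord).
  destruct i; simpl; ring.
Qed.

Lemma invariant_rho : invariant rho.
Proof.
  split; [apply rho_smooth3|]; unfold rot; split; intros p; rewrite !partial_rho; ring.
Qed.

Lemma invariant_divide f : invariant f -> f (0, 0, 0) = 0 ->
  exists w, invariant w /\ f = fun p => rho p * w p.
Proof.
  intros Hi H0; destruct (invariant_deriv f Hi) as (f1 & (H1 & _) & Ex & Ey).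
  pose proof Hi as (Hf & Hr & Hz).
  set (S := fun i => match i with az => false | _ => true end).
  (* At the dilated point f_x equals 2 t x f1, so the Hadamard quotient in x is x times the integral
     of 2 t f1. The y quotient is y times the same integral, and f becomes x (x w) + y (y w). *)
  set (w := pint 0 1 (dilation S) (fun t => 2 * t) f1).
  assert (Hm : forall t : R, continuous (fun t => 2 * t) t).
  { intros t; eapply is_derive_continuous; auto_derive; auto. }
  assert (Hw : smooth3 w)
    by exact (pint_smooth3 _ _ _ Rle_0_1 (dilation_continuous S) _ _ Hm H1).
  assert (Q : forall i p, S i = true -> (forall q, partial i f q = 2 * coord i q * f1 q) ->
            quot S i f p = coord i p * w p).
  { intros i p HS E; unfold quot; apply pint_eq.
    eapply is_RInt_Rext; [|exact (is_RInt_Rscal _ _ _ (coord i p) _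
      (pint_is_RInt _ _ _ _ _ p Rle_0_1 (dilation_continuous S) Hm (smooth3_cont _ H1)))].
    intros t; cbv beta; rewrite E, (lin_dilation S t p).
    destruct i; simpl; try discriminate; ring. }
  assert (Ew : f = fun p => rho p * w p).
  { apply functional_extensionality; intros p.
    rewrite (hadamard S f p Hf), !Q by auto; rewrite lin_dilation; simpl.
    rewrite !Rmult_0_l, (z_invariant f Hf Hz 0 0 _ 0), H0; unfold rho; ring. }
  destruct invariant_rho as (Sr & Rr & Zr).
  exists w; split; [split; [exact Hw|split]|exact Ew].
  - assert (K : rot w = fun _ => 0); [|intros p; now rewrite K].
    apply rho_cancel; [now apply smooth3_cont, rot_smooth3|]; intros p.
    pose proof (Hr p) as E; rewrite Ew, rot_mult, Rr in E by assumption.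
    unfold rho in E; lra.
  - assert (K : partial az w = fun _ => 0); [|intros p; now rewrite K].
    apply rho_cancel; [now apply smooth3_cont, smooth3_partial|]; intros p.
    pose proof (Hz p) as E; rewrite Ew, smooth3_partial_mult, Zr in E by assumption.
    unfold rho in E; lra.
Qed.

Lemma derivable_pt_lim_D_in f f' (D : R -> Prop) s :
  is_derive f s (f' s) -> D_in f f' D s.
Proof.
  intros H eps He; apply is_derive_Reals in H; destruct (H eps He) as [d Hd].
  exists d; split; [apply cond_pos|]; intros x [[_ Hx] Hxd]; simpl in *; unfold Rdist in *.
  specialize (Hd (x - s)); replace (s + (x - s)) with x in Hd by ring; apply Hd; lra.
Qed.

(** For s > 0 the factor 2 sqrt s in f_x cancels the derivative 1 / (2 sqrt s) of the square root,
    so the derivative is again the radial profile of an invariant function. *)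
Lemma invariant_radial_D_in f f1 s : invariant f -> invariant f1 ->
  (forall p, partial ax f p = 2 * coord ax p * f1 p) -> 0 <= s ->
  D_in (fun s => f (sqrt s, 0, 0)) (fun s => f1 (sqrt s, 0, 0)) half_line s.
Proof.
  intros (Hf & _) (H1 & _) Ex Hs.
  assert (Hd : forall t, 0 < t ->
    is_derive (fun s => f (sqrt s, 0, 0)) t (f1 (sqrt t, 0, 0))).
  { intros t Ht.
    assert (Hq : is_derive sqrt t (/ (2 * sqrt t))) by (auto_derive; [exact Ht | field; apply Rgt_not_eq, sqrt_lt_R0, Ht]).
    eapply is_derive_eq.
    - exact (is_derive_comp (fun x => f (x, 0, 0)) sqrt t _ _
        (smooth3_is f ax (sqrt t, 0, 0) Hf) Hq).
    - rewrite Ex; simpl; unfold scal; simpl; unfold mult; simpl; field.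
      apply Rgt_not_eq, sqrt_lt_R0, Ht. }
  assert (Hc : forall g, smooth3 g -> forall t, 0 <= t -> continuous (fun s => g (sqrt s, 0, 0)) t).
  { intros g Hg t Ht; apply (continuous_comp sqrt (fun x => g (x, 0, 0))).
    - apply continuity_pt_filterlim, continuity_pt_sqrt, Ht.
    - apply (continuous_comp (fun x => upd (0, 0, 0) ax x) g);
        [apply continuous_upd_1 | apply smooth3_cont, Hg]. }
  destruct Hs as [Hs|<-]; [now apply derivable_pt_lim_D_in, Hd|].
  (* At s = 0 the square root has no derivative. The mean value theorem equates the difference
     quotient with the profile of [f1] at an intermediate point, and continuity of [f1] finishes. *)
  intros eps He.
  destruct (proj1 (filterlim_locally _ _) (Hc f1 H1 0 (Rle_refl 0)) (mkposreal _ He)) as [d K].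
  exists d; split; [apply cond_pos|]; intros x [[Hx Hx0] Hxd].
  unfold half_line in Hx; simpl in *; unfold Rdist in *.
  destruct (MVT_gen (fun s => f (sqrt s, 0, 0)) 0 x (fun s => f1 (sqrt s, 0, 0)))
    as (c & Hcx & Ec).
  - intros t; rewrite Rmin_left by exact Hx; intros [Ht _]; now apply Hd.
  - intros t; rewrite Rmin_left by exact Hx; intros [Ht _].
    now apply continuity_pt_filterlim, Hc.
  - rewrite Rmin_left, Rmax_right in Hcx by exact Hx.
    cbv beta in Ec; rewrite Ec.
    replace (f1 (sqrt c, 0, 0) * (x - 0) / (x - 0)) with (f1 (sqrt c, 0, 0))
      by (field; lra).
    apply (K c); change (Rabs (c - 0) < d).
    rewrite Rabs_pos_eq in * by lra; lra.
Qed.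

Lemma smooth_half_of_invariant f : invariant f -> exists F, smooth_half F /\ f = of_rho F.
Proof.
  intros Hf.
  (* Each derivative is chosen together with its invariance, so the recursion can continue; the n-th
     term of [seq] supplies the n-th one-sided derivative. *)
  set (next := fun g : {g | invariant g} =>
    constructive_indefinite_description _ (invariant_deriv (proj1_sig g) (proj2_sig g))).
  set (seq := fix seq n : {g | invariant g} := match n with
     | O => exist _ f Hf
     | S n => exist _ (proj1_sig (next (seq n))) (proj1 (proj2_sig (next (seq n)))) end).
  exists (fun s => f (sqrt s, 0, 0)); split.
  - exists (fun n s => proj1_sig (seq n) (sqrt s, 0, 0)); split; [reflexivity|].
    intros n s Hs; apply invariant_radial_D_in; [apply proj2_sig | apply proj2_sig | | exact Hs].
    simpl; exact (proj1 (proj2 (proj2_sig (next (seq n))))).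
  - rewrite of_rho_eq; apply functional_extensionality; intros p; now apply invariant_polar.
Qed.

(* The affine continuation to negative arguments turns one-sided derivatives into two-sided ones. *)
Definition extend_half (F F' : R -> R) (s : R) : R :=
  if Rle_dec 0 s then F s else F 0 + F' 0 * s.

Lemma extend_half_is_derive F F' s : deriv_half F F' -> 0 <= s ->
  is_derive (extend_half F F') s (F' s).
Proof.
  intros H Hs; apply is_derive_Reals; intros eps He.
  destruct (H s Hs eps He) as (d & Hd & K); simpl in K; unfold Rdist in K.
  assert (Hneg : 0 < s \/ s = 0) by lra.
  assert (Hm : 0 < (if Req_EM_T s 0 then d else Rmin d s)).
  { destruct (Req_EM_T s 0); [exact Hd | apply Rmin_glb_lt; lra]. }
  exists (mkposreal _ Hm); simpl; intros h Hh Hhd.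
  assert (Hhd' : Rabs h < d).
  { destruct (Req_EM_T s 0); [exact Hhd | eapply Rlt_le_trans; [exact Hhd | apply Rmin_l]]. }
  unfold extend_half; destruct (Rle_dec 0 s) as [_|]; [|contradiction].
  destruct (Rle_dec 0 (s + h)) as [Hp|Hn].
  - specialize (K (s + h)); replace (s + h - s) with h in K by ring; apply K.
    repeat split; [exact Hp | lra | exact Hhd'].
  - destruct (Req_EM_T s 0) as [->|E].
    + replace ((F 0 + F' 0 * (0 + h) - F 0) / h - F' 0) with 0 by (field; exact Hh).
      now rewrite Rabs_R0.
    + exfalso; assert (Rabs h < s) by (eapply Rlt_le_trans; [exact Hhd | apply Rmin_r]).
      apply Rabs_def2 in H0; lra.
Qed.

Lemma extend_half_rho F F' p : extend_half F F' (rho p) = F (rho p).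
Proof.
  unfold extend_half; destruct (Rle_dec 0 (rho p)) as [_|n]; [reflexivity|].
  destruct (n (rho_nonneg p)).
Qed.

Lemma of_rho_continuous F F' (p : R3) : deriv_half F F' -> continuous (of_rho F) p.
Proof.
  intros H; rewrite of_rho_eq.
  apply (continuous_ext (fun q : R3 => extend_half F F' (rho q))).
  - intros q; apply extend_half_rho.
  - apply (continuous_comp rho (extend_half F F')).
    + apply smooth3_cont, rho_smooth3.
    + eapply is_derive_continuous, extend_half_is_derive; [exact H | apply rho_nonneg].
Qed.

Lemma of_rho_is_partial F F' i p : deriv_half F F' ->
  is_partial i (of_rho F) p (partial i rho p * of_rho F' p).
Proof.
  intros H; rewrite !of_rho_eq.
  apply (is_derive_ext (fun t => extend_half F F' (rho (upd p i t)))).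
  - intros t; apply extend_half_rho.
  - pose proof (extend_half_is_derive F F' (rho p) H (rho_nonneg p)) as D.
    pose proof (smooth3_is rho i p rho_smooth3) as Dr.
    rewrite <- (upd_coord p i) in D at 1.
    exact (is_derive_comp (extend_half F F') (fun t => rho (upd p i t)) (coord i p) _ _ D Dr).
Qed.

Lemma partial_of_rho F F' i p : deriv_half F F' -> partial i (of_rho F) p =
  match i with ax => 2 * coord ax p | ay => 2 * coord ay p | az => 0 end * of_rho F' p.
Proof.
  intros H; rewrite <- partial_rho; apply is_partial_unique, of_rho_is_partial, H.
Qed.

(** The bracket table receives an arbitrary one-sided derivative [F'], while [smooth_half] carries
    its own. Uniqueness of limits identifies the two on the half-line, the only place where [of_rho]
    evaluates them. *)
Lemma smooth_half_shift F F' : smooth_half F -> deriv_half F F' ->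
  exists G, smooth_half G /\ deriv_half F G /\ of_rho F' = of_rho G.
Proof.
  intros (S & E & H) H'; subst F; exists (S 1%nat); split; [|split; [apply H|]].
  - exists (fun n => S (Datatypes.S n)); split; [reflexivity|]; intros n; apply H.
  - rewrite !of_rho_eq; apply functional_extensionality; intros p.
    eapply (single_limit _ (D_x half_line (rho p)));
      [|exact (H' _ (rho_nonneg p))|exact (H 0%nat _ (rho_nonneg p))].
    intros al Hal; exists (rho p + al / 2); pose proof (rho_nonneg p).
    unfold D_x, half_line; simpl; unfold Rdist; repeat split; try lra.
    replace (rho p + al / 2 - rho p) with (al / 2) by ring; rewrite Rabs_pos_eq; lra.
Qed.

Lemma smooth_half_smooth3 F : smooth_half F -> smooth3 (of_rho F).
Proof.
  (* The claim is generalized to all members of the derivative sequence, since differentiating moves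
     to the next one. *)
  intros (S & E & H); subst F; intros n; generalize 0%nat; induction n as [|n IH]; intros k;
    (split; [intros p; exact (of_rho_continuous _ _ p (H k))|]); [exact I|].
  intros i; split.
  - intros p; eapply is_partial_ex, of_rho_is_partial, H.
  - replace (partial i (of_rho (S k)))
      with (fun p => partial i rho p * of_rho (S (Datatypes.S k)) p).
    + apply Cn3_mult; [apply smooth3_partial, rho_smooth3 | apply IH].
    + apply functional_extensionality; intros p; symmetry.
      apply is_partial_unique, of_rho_is_partial, H.
Qed.

Lemma smooth_half_deriv F : smooth_half F -> exists F', smooth_half F' /\ deriv_half F F'.
Proof.
  intros (S & E & H); subst F; exists (S 1%nat); split; [|apply H].
  exists (fun n => S (Datatypes.S n)); split; [reflexivity|]; intros n; apply H.
Qed.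

Lemma invariant_of_smooth_half F : smooth_half F -> invariant (of_rho F).
Proof.
  intros H; destruct (smooth_half_deriv F H) as (F' & _ & H').
  split; [now apply smooth_half_smooth3|]; unfold rot; split; intros p;
    rewrite !(partial_of_rho F F') by exact H'; ring.
Qed.

Lemma deriv_invariant F F' : smooth_half F -> deriv_half F F' -> invariant (of_rho F').
Proof.
  intros H H'; destruct (smooth_half_shift F F' H H') as (G & HG & _ & ->).
  now apply invariant_of_smooth_half.
Qed.

(** * Functions of z alone *)

Lemma of_z_eq g : of_z g = fun p => g (coord az p).
Proof. apply functional_extensionality; intros [[x y] z]; reflexivity. Qed.

Lemma of_z_is_partial g i p : ex_derive g (coord az p) ->
  is_partial i (of_z g) p (match i with az => of_z (Derive g) p | _ => 0 end).
Proof.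
  destruct p as [[x y] z]; simpl; intros H; destruct i; unfold is_partial; simpl.
  - exact (@is_derive_const R_AbsRing R_NormedModule (g z) x).
  - exact (@is_derive_const R_AbsRing R_NormedModule (g z) y).
  - now apply Derive_correct.
Qed.

Lemma smooth_line_Derive g : smooth_line g -> smooth_line (Derive g).
Proof.
  intros H [|n] x; [exact I|].
  refine (ex_derive_ext _ _ _ _ (H (S (S n)) x)); intros t; symmetry.
  etransitivity; [exact (Derive_n_comp g n 1 t) | now rewrite Nat.add_1_r].
Qed.

Lemma smooth_line_ex_derive g x : smooth_line g -> ex_derive g x.
Proof. intros H; exact (H 1%nat x). Qed.

Lemma partial_of_z g i p : smooth_line g ->
  partial i (of_z g) p = match i with az => of_z (Derive g) p | _ => 0 end.
Proof.
  intros H; apply is_partial_unique, of_z_is_partial, smooth_line_ex_derive, H.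
Qed.

Lemma of_z_smooth3 g : smooth_line g -> smooth3 (of_z g).
Proof.
  intros H n; revert g H; induction n as [|n IH]; intros g H;
    (split; [intros p; rewrite of_z_eq|]); [| exact I | |].
  1, 2: apply (continuous_comp (coord az) g); [apply continuous_coord |];
    apply (@ex_derive_continuous R_AbsRing R_NormedModule), smooth_line_ex_derive, H.
  intros i; split.
  - intros p; eapply is_partial_ex, of_z_is_partial, smooth_line_ex_derive, H.
  - replace (partial i (of_z g))
      with (match i with az => of_z (Derive g) | _ => fun _ => 0 end).
    + destruct i; try apply Cn3_const; apply IH, smooth_line_Derive, H.
    + apply functional_extensionality; intros p; rewrite partial_of_z by exact H.
      destruct i; reflexivity.
Qed.

Lemma smooth_line_of_axis f : smooth3 f -> smooth_line (fun z => f (on_axis z)).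
Proof.
  intros Hf.
  assert (K : forall n z, Derive_n (fun z => f (on_axis z)) n z
     = Nat.iter n (partial az) f (on_axis z)).
  { induction n as [|n IH]; intros z; [reflexivity|]; simpl.
    unfold partial at 1, on_axis at 2; simpl; apply Derive_ext; intros t; apply IH. }
  assert (Hs : forall n, smooth3 (Nat.iter n (partial az) f)).
  { induction n; [exact Hf | simpl; now apply smooth3_partial]. }
  intros [|n] z; [exact I|]; simpl.
  refine (ex_derive_ext _ _ _ _ (smooth3_ex _ az (on_axis z) (Hs n))).
  intros t; symmetry; apply K.
Qed.

(** * Symbolic multivector fields: the Leibniz and Jacobi identities *)

(** Reified differential polynomials: [DVar n a b c] is the derivative of orders a, b, c of the n-th
    unknown function. Differentiation acts on syntax, so an identity for arbitrary coefficients
    becomes a polynomial identity in finitely many atoms. *)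
Inductive dexp : Set :=
  | DVar (n a b c : nat)
  | DCst (z : Z)
  | DCrd (i : axis)
  | DAdd (e f : dexp)
  | DMul (e f : dexp)
  | DOpp (e : dexp).

(* The order of differentiation is fixed, so that equal mixed partials become identical atoms
   for [ring]. *)
Definition dpart (a b c : nat) (f : R3 -> R) : R3 -> R :=
  Nat.iter a (partial ax) (Nat.iter b (partial ay) (Nat.iter c (partial az) f)).

Fixpoint interp (env : nat -> R3 -> R) (e : dexp) (p : R3) : R :=
  match e with
  | DVar n a b c => dpart a b c (env n) p
  | DCst z => IZR z
  | DCrd i => coord i p
  | DAdd e f => interp env e p + interp env f p
  | DMul e f => interp env e p * interp env f p
  | DOpp e => - interp env e p
  end.

(** These constructors discard zeros and units. Iterated brackets run over nested sums of axes and
    multi-indices in which most terms vanish, and without pruning the final [ring] goals would be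
    far larger. *)
Definition dadd (e f : dexp) : dexp :=
  match e, f with DCst 0, _ => f | _, DCst 0 => e | _, _ => DAdd e f end.

Definition dmul (e f : dexp) : dexp :=
  match e, f with
  | DCst 0, _ => DCst 0 | _, DCst 0 => DCst 0
  | DCst 1, _ => f | _, DCst 1 => e
  | _, _ => DMul e f end.

Definition dopp (e : dexp) : dexp := match e with DCst 0 => DCst 0 | _ => DOpp e end.

Fixpoint dder (i : axis) (e : dexp) : dexp :=
  match e with
  | DVar n a b c =>
      match i with ax => DVar n (S a) b c | ay => DVar n a (S b) c | az => DVar n a b (S c) end
  | DCst _ => DCst 0
  | DCrd j => DCst (if Nat.eqb (axis_rank i) (axis_rank j) then 1 else 0)
  | DAdd e f => dadd (dder i e) (dder i f)
  | DMul e f => dadd (dmul (dder i e) f) (dmul e (dder i f))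
  | DOpp e => dopp (dder i e)
  end.

Lemma interp_dadd env e f p : interp env (dadd e f) p = interp env e p + interp env f p.
Proof. destruct e as [| [] | | | |], f as [| [] | | | |]; simpl; ring. Qed.

Lemma interp_dmul env e f p : interp env (dmul e f) p = interp env e p * interp env f p.
Proof.
  destruct e as [| [|[]|] | | | |], f as [| [|[]|] | | | |]; simpl; ring.
Qed.

Lemma interp_dopp env e p : interp env (dopp e) p = - interp env e p.
Proof. destruct e as [| [] | | | |]; simpl; ring. Qed.

Lemma iter_partial_smooth3 i n f : smooth3 f -> smooth3 (Nat.iter n (partial i) f).
Proof. intros Hf; induction n; [exact Hf | now apply smooth3_partial]. Qed.

Lemma partial_iter i j n f : smooth3 f ->
  partial i (Nat.iter n (partial j) f) = Nat.iter n (partial j) (partial i f).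
Proof.
  intros Hf; induction n as [|n IH]; [reflexivity|]; simpl.
  now rewrite partial_comm, IH by now apply iter_partial_smooth3.
Qed.

Lemma interp_smooth3 env e : (forall n, smooth3 (env n)) -> smooth3 (interp env e).
Proof.
  intros H; induction e.
  - repeat apply iter_partial_smooth3; apply H.
  - exact (smooth3_const (IZR z)).
  - exact (smooth3_coord i).
  - now apply (smooth3_plus (interp env e1) (interp env e2)).
  - now apply (smooth3_mult (interp env e1) (interp env e2)).
  - now apply (smooth3_opp (interp env e)).
Qed.

Lemma partial_interp env i e : (forall n, smooth3 (env n)) ->
  partial i (interp env e) = interp env (dder i e).
Proof.
  intros H; induction e.
  - destruct i; simpl; unfold dpart; [reflexivity| |].
    (* A new derivative in y or z has to be moved inward to restore the fixed order of [dpart]. *)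
    + change (partial ay (Nat.iter a (partial ax) (Nat.iter b (partial ay)
        (Nat.iter c (partial az) (env n)))) = dpart a (S b) c (env n)).
      rewrite partial_iter by (repeat apply iter_partial_smooth3; apply H); reflexivity.
    + change (partial az (Nat.iter a (partial ax) (Nat.iter b (partial ay)
        (Nat.iter c (partial az) (env n)))) = dpart a b (S c) (env n)).
      rewrite !partial_iter by (repeat apply iter_partial_smooth3; apply H).
      unfold dpart; simpl; rewrite partial_iter by apply H; reflexivity.
  - apply (partial_const i (IZR z)).
  - change (interp env (DCrd i0)) with (coord i0); rewrite partial_coord.
    apply functional_extensionality; intros p; simpl.
    destruct (Nat.eqb (axis_rank i) (axis_rank i0)); reflexivity.
  - change (interp env (DAdd e1 e2)) with (fun p => interp env e1 p + interp env e2 p).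
    rewrite smooth3_partial_plus, IHe1, IHe2 by now apply interp_smooth3.
    apply functional_extensionality; intros p; simpl; now rewrite interp_dadd.
  - change (interp env (DMul e1 e2)) with (fun p => interp env e1 p * interp env e2 p).
    rewrite smooth3_partial_mult, IHe1, IHe2 by now apply interp_smooth3.
    apply functional_extensionality; intros p; simpl; now rewrite interp_dadd, !interp_dmul.
  - change (interp env (DOpp e)) with (fun p => - interp env e p).
    rewrite partial_opp, IHe.
    apply functional_extensionality; intros p; simpl; now rewrite interp_dopp.
Qed.

Definition smvf : Set := mindex -> dexp.

Definition sem (env : nat -> R3 -> R) (P : smvf) : mvf := fun I => interp env (P I).

Definition dsum {A : Type} (l : list A) (F : A -> dexp) : dexp :=
  fold_right dadd (DCst 0) (map F l).

Definition dsign (n : nat) : dexp := DCst (if Nat.even n then 1 else -1).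

Definition swedge (P Q : smvf) : smvf := fun K =>
  dsum mindices (fun I => if msubset I K
    then dmul (dmul (dsign (inversions I (mdiff K I))) (P I)) (Q (mdiff K I)) else DCst 0).

Definition sodd (i : axis) (P : smvf) : smvf := fun J =>
  if mem i J then DCst 0 else dmul (dsign (inversions J (single i))) (P (munion J (single i))).

Definition scoef (i : axis) (P : smvf) : smvf := fun I => dder i (P I).

Definition sschouten (p q : nat) (P Q : smvf) : smvf := fun K =>
  dadd (dsum axes (fun i => swedge (sodd i P) (scoef i Q) K))
    (dopp (dmul (dsign ((p + 1) * (q + 1)))
       (dsum axes (fun i => swedge (sodd i Q) (scoef i P) K)))).

Definition sadd (P Q : smvf) : smvf := fun I => dadd (P I) (Q I).
Definition sscal (n : nat) (P : smvf) : smvf := fun I => dmul (dsign n) (P I).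

Lemma minus_one_pow n : (-1) ^ n = if Nat.even n then 1 else -1.
Proof.
  induction n as [|n IH]; [reflexivity|].
  rewrite Nat.even_succ, <- Nat.negb_even; simpl; rewrite IH.
  destruct (Nat.even n); simpl; ring.
Qed.

Lemma interp_dsign env n p : interp env (dsign n) p = (-1) ^ n.
Proof. rewrite minus_one_pow; simpl; destruct (Nat.even n); reflexivity. Qed.

Lemma interp_dsum {A : Type} env (l : list A) F p :
  interp env (dsum l F) p = Rsum l (fun x => interp env (F x) p).
Proof.
  induction l as [|x l IH]; [reflexivity|].
  unfold dsum, Rsum; simpl; rewrite interp_dadd; f_equal; exact IH.
Qed.

Lemma Rsum_ext {A : Type} (l : list A) F G : (forall x, F x = G x) -> Rsum l F = Rsum l G.
Proof. intros H; unfold Rsum; f_equal; now apply map_ext. Qed.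

Lemma sem_wedge env P Q : sem env (swedge P Q) = sem env P [^] sem env Q.
Proof.
  apply functional_extensionality; intros K; apply functional_extensionality; intros p.
  unfold sem, swedge, wedge; rewrite interp_dsum; apply Rsum_ext; intros I.
  destruct (msubset I K); [|reflexivity]; now rewrite !interp_dmul, interp_dsign.
Qed.

Lemma sem_odd env i P : sem env (sodd i P) = odd_deriv i (sem env P).
Proof.
  apply functional_extensionality; intros K; apply functional_extensionality; intros p.
  unfold sem, sodd, odd_deriv; destruct (mem i K); [reflexivity|].
  now rewrite interp_dmul, interp_dsign.
Qed.

Lemma sem_coef env i P : (forall n, smooth3 (env n)) ->
  sem env (scoef i P) = coef_deriv i (sem env P).
Proof.
  intros H; apply functional_extensionality; intros K.
  unfold sem, scoef, coef_deriv; now rewrite partial_interp.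
Qed.

Lemma sem_schouten env p q P Q : (forall n, smooth3 (env n)) ->
  sem env (sschouten p q P Q) = schouten p q (sem env P) (sem env Q).
Proof.
  intros H; apply functional_extensionality; intros K; apply functional_extensionality; intros x.
  unfold schouten; unfold sem at 1; unfold sschouten.
  rewrite interp_dadd, interp_dopp, interp_dmul, interp_dsign, !interp_dsum.
  assert (K1 : forall A B, Rsum axes (fun i => interp env (swedge (sodd i A) (scoef i B) K) x)
    = Rsum axes (fun i => (odd_deriv i (sem env A) [^] coef_deriv i (sem env B)) K x)).
  { intros A B; apply Rsum_ext; intros i.
    rewrite <- sem_odd, <- sem_coef, <- sem_wedge by exact H; reflexivity. }
  rewrite !K1; ring.
Qed.

Lemma sem_add env P Q : sem env (sadd P Q) = sem env P [+] sem env Q.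
Proof.
  apply functional_extensionality; intros K; apply functional_extensionality; intros p.
  unfold sem, sadd, madd; now rewrite interp_dadd.
Qed.

Definition mscal (c : R) (P : mvf) : mvf := (fun _ => c) [*] P.

Lemma sem_scal env n P : sem env (sscal n P) = mscal ((-1) ^ n) (sem env P).
Proof.
  apply functional_extensionality; intros K; apply functional_extensionality; intros p.
  unfold sem, sscal, mscal, fmul; now rewrite interp_dmul, interp_dsign.
Qed.

Definition spi : smvf := fun I =>
  match I with
  | (true, false, true) => DOpp (DCrd ay)
  | (false, true, true) => DCrd ax
  | _ => DCst 0
  end.

Lemma sem_pi env : sem env spi = pi_e2.
Proof.
  apply functional_extensionality; intros K; apply functional_extensionality; intros p.
  destruct K as [[[] []] []];
    cbv [sem spi interp pi_e2 T_e2 wedge Rsum mindices list_prod map fold_right msubset forallb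
      axes implb mem andb app madd fmul dd meqb mk_mindex single mdiff axis_rank Nat.eqb negb
      inversions filter length Nat.ltb Nat.leb fst snd pow]; ring.
Qed.

Definition sdpi (k : nat) (P : smvf) : smvf := sschouten 2 k spi P.

Lemma sem_dpi env k P : (forall n, smooth3 (env n)) ->
  sem env (sdpi k P) = dpi pi_e2 k (sem env P).
Proof. intros H; unfold sdpi, dpi; rewrite sem_schouten, sem_pi by exact H; reflexivity. Qed.

Definition mcode (I : mindex) : nat :=
  let '(a, b, c) := I in (4 * Nat.b2n a + 2 * Nat.b2n b + Nat.b2n c)%nat.

Definition mdecode (n : nat) : mindex := (Nat.testbit n 2, Nat.testbit n 1, Nat.testbit n 0).

(** Unknowns 0 to 7 are the coefficients of [P], indexed by the bits of the multi-index, and 8 to 15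
    those of [Q]. *)
Definition env2 (P Q : mvf) (n : nat) : R3 -> R :=
  if Nat.ltb n 8 then P (mdecode n) else Q (mdecode (n - 8)).

(** Components of the wrong degree are syntactically 0, so homogeneity is built in and the degree of
    a result can be read off by computation. *)
Definition svars (base k : nat) : smvf := fun I =>
  if Nat.eqb (mcard I) k then DVar (base + mcode I) 0 0 0 else DCst 0.

Lemma multivector_smooth3 k P I : multivector k P -> smooth3 (P I).
Proof. intros H; apply H. Qed.

Lemma env2_smooth3 p q P Q : multivector p P -> multivector q Q ->
  forall n, smooth3 (env2 P Q n).
Proof.
  intros HP HQ n; unfold env2; destruct (Nat.ltb n 8); eapply multivector_smooth3; eassumption.
Qed.

Lemma sem_vars_l p P Q : multivector p P -> sem (env2 P Q) (svars 0 p) = P.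
Proof.
  intros HP; apply functional_extensionality; intros K; apply functional_extensionality; intros x.
  unfold sem, svars; destruct (Nat.eqb (mcard K) p) eqn:E.
  - destruct K as [[[] []] []]; reflexivity.
  - apply Nat.eqb_neq in E; symmetry; exact (proj2 (HP K) E x).
Qed.

Lemma sem_vars_r q P Q : multivector q Q -> sem (env2 P Q) (svars 8 q) = Q.
Proof.
  intros HQ; apply functional_extensionality; intros K; apply functional_extensionality; intros x.
  unfold sem, svars; destruct (Nat.eqb (mcard K) q) eqn:E.
  - destruct K as [[[] []] []]; reflexivity.
  - apply Nat.eqb_neq in E; symmetry; exact (proj2 (HQ K) E x).
Qed.

Ltac sem_ring :=
  apply functional_extensionality; intros [[[] []] []];
  apply functional_extensionality; intros ?; unfold sem;
  match goal with |- interp ?env ?e ?x = interp ?env ?f ?x =>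
    let a := eval vm_compute in e in let b := eval vm_compute in f in
    change (interp env a x = interp env b x)
  end; cbn [interp]; ring.

Ltac degree_cases p Hp :=
  destruct p as [|[|[|[|p]]]]; [| | | | exfalso; lia].

(** Sixteen cases suffice: fields of degree above 3 vanish by [multivector_high] and are treated
    where the identity is transferred to actual fields. *)
Lemma sem_leibniz env p q : (p <= 3)%nat -> (q <= 3)%nat ->
  sem env (sdpi (p + q) (swedge (svars 0 p) (svars 8 q))) =
  sem env (sadd (swedge (sdpi p (svars 0 p)) (svars 8 q))
                (sscal p (swedge (svars 0 p) (sdpi q (svars 8 q))))).
Proof. intros Hp Hq; degree_cases p Hp; degree_cases q Hq; sem_ring. Qed.

(** For p = q = 0 the degree p + q - 1 truncates to 0; the left side is then 0, since two functions
    have zero bracket. *)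
Lemma sem_jacobi env p q : (p <= 3)%nat -> (q <= 3)%nat ->
  sem env (sdpi (p + q - 1) (sschouten p q (svars 0 p) (svars 8 q))) =
  sem env (sadd (sschouten (p + 1) q (sdpi p (svars 0 p)) (svars 8 q))
                (sscal (p + 1) (sschouten p (q + 1) (svars 0 p) (sdpi q (svars 8 q))))).
Proof. intros Hp Hq; degree_cases p Hp; degree_cases q Hq; sem_ring. Qed.

(** * Formulas in components *)

Definition mk1 (A B C : R3 -> R) : mvf := fun I =>
  match I with
  | (true, false, false) => A | (false, true, false) => B | (false, false, true) => C
  | _ => fun _ => 0
  end.

Definition mk2 (a b c : R3 -> R) : mvf := fun I =>
  match I with
  | (true, true, false) => a | (true, false, true) => b | (false, true, true) => c
  | _ => fun _ => 0
  end.

Definition mk3 (m : R3 -> R) : mvf := fun I =>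
  match I with (true, true, true) => m | _ => fun _ => 0 end.

Definition env_list (l : list (R3 -> R)) (n : nat) : R3 -> R := nth n l (fun _ => 0).

Lemma env_list_smooth3 l : List.Forall smooth3 l -> forall n, smooth3 (env_list l n).
Proof.
  intros H n; unfold env_list; revert n; induction H as [|f l Hf H IH]; intros [|n]; simpl;
    auto using smooth3_const.
Qed.

Definition var0 (n : nat) : dexp := DVar n 0 0 0.

Definition sk0 (n : nat) : smvf := fun I =>
  match I with (false, false, false) => var0 n | _ => DCst 0 end.

Definition sk1 (n : nat) : smvf := fun I =>
  match I with
  | (true, false, false) => var0 n | (false, true, false) => var0 (S n)
  | (false, false, true) => var0 (S (S n)) | _ => DCst 0
  end.

Definition sk2 (n : nat) : smvf := fun I =>
  match I with
  | (true, true, false) => var0 n | (true, false, true) => var0 (S n)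
  | (false, true, true) => var0 (S (S n)) | _ => DCst 0
  end.

Definition sk3 (n : nat) : smvf := fun I =>
  match I with (true, true, true) => var0 n | _ => DCst 0 end.

Ltac sem_components :=
  let K := fresh in let q := fresh in
  apply functional_extensionality; intros K; apply functional_extensionality; intros q;
  destruct K as [[[] []] []]; reflexivity.

Ltac sem_formula l P SP Q SQ :=
  let H := fresh in
  assert (H : forall n, smooth3 (env_list l n))
    by (apply env_list_smooth3; repeat (apply List.Forall_cons || apply List.Forall_nil); assumption);
  replace P with (sem (env_list l) SP) by sem_components;
  try replace Q with (sem (env_list l) SQ) by sem_components;
  rewrite <- ?sem_schouten, <- ?sem_dpi, <- ?sem_wedge by exact H;
  apply functional_extensionality; intros [[[] []] []];
  apply functional_extensionality; intros ?; unfold sem;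
  match goal with |- interp ?env ?e ?x = ?r =>
    let a := eval vm_compute in e in change (interp env a x = r)
  end;
  cbv [fn mk1 mk2 mk3 meqb msubset forallb axes mem mempty mk_mindex implb andb];
  cbn [interp env_list nth dpart Nat.iter]; unfold dpart, rot; simpl Nat.iter; ring.

Lemma dpi_fn f : smooth3 f -> dpi pi_e2 0 (fn f) =
  mk1 (fun p => - (coord ay p * partial az f p)) (fun p => coord ax p * partial az f p)
      (fun p => - rot f p).
Proof. cbv zeta; intros; sem_formula [f] (fn f) (sk0 0) (fn f) (sk0 0). Qed.

(** With U = x A + y B, the first component is - U_z, and x times the second plus y times the third
    is [rot U], with [C] cancelling out. Solving for a primitive therefore begins with U. *)
Lemma dpi_mk1 A B C : smooth3 A -> smooth3 B -> smooth3 C -> dpi pi_e2 1 (mk1 A B C) =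
  mk2 (fun p => - (coord ax p * partial az A p + coord ay p * partial az B p))
      (fun p => rot A p + B p - coord ay p * partial az C p)
      (fun p => rot B p - A p + coord ax p * partial az C p).
Proof. cbv zeta; intros; sem_formula [A; B; C] (mk1 A B C) (sk1 0) (mk1 A B C) (sk1 0). Qed.

(** Closedness constrains only [a] and u = x b + y c: it reads rot a + u_z = 0. *)
Lemma dpi_mk2 a b c : smooth3 a -> smooth3 b -> smooth3 c -> dpi pi_e2 2 (mk2 a b c) =
  mk3 (fun p => - (rot a p + coord ax p * partial az b p + coord ay p * partial az c p)).
Proof. cbv zeta; intros; sem_formula [a; b; c] (mk2 a b c) (sk2 0) (mk2 a b c) (sk2 0). Qed.

Lemma schouten_10 A B C f : smooth3 A -> smooth3 B -> smooth3 C -> smooth3 f ->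
  schouten 1 0 (mk1 A B C) (fn f) =
  fn (fun p => A p * partial ax f p + B p * partial ay f p + C p * partial az f p).
Proof. cbv zeta; intros; sem_formula [A; B; C; f] (mk1 A B C) (sk1 0) (fn f) (sk0 3). Qed.

Lemma schouten_20 a b c f : smooth3 a -> smooth3 b -> smooth3 c -> smooth3 f ->
  schouten 2 0 (mk2 a b c) (fn f) =
  mk1 (fun p => a p * partial ay f p + b p * partial az f p)
      (fun p => - (a p * partial ax f p) + c p * partial az f p)
      (fun p => - (b p * partial ax f p + c p * partial ay f p)).
Proof. cbv zeta; intros; sem_formula [a; b; c; f] (mk2 a b c) (sk2 0) (fn f) (sk0 3). Qed.

Lemma schouten_30 m f : smooth3 m -> smooth3 f ->
  schouten 3 0 (mk3 m) (fn f) =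
  mk2 (fun p => m p * partial az f p) (fun p => - (m p * partial ay f p))
      (fun p => m p * partial ax f p).
Proof. cbv zeta; intros; sem_formula [m; f] (mk3 m) (sk3 0) (fn f) (sk0 1). Qed.

Lemma schouten_11 A B C A' B' C' : smooth3 A -> smooth3 B -> smooth3 C ->
  smooth3 A' -> smooth3 B' -> smooth3 C' ->
  let D f := fun p => A p * partial ax f p + B p * partial ay f p + C p * partial az f p in
  let D' f := fun p => A' p * partial ax f p + B' p * partial ay f p + C' p * partial az f p in
  schouten 1 1 (mk1 A B C) (mk1 A' B' C') =
  mk1 (fun p => D A' p - D' A p) (fun p => D B' p - D' B p) (fun p => D C' p - D' C p).
Proof.
  cbv zeta; intros; sem_formula [A; B; C; A'; B'; C'] (mk1 A B C) (sk1 0) (mk1 A' B' C') (sk1 3).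
Qed.

Lemma schouten_12 A B C a b c : smooth3 A -> smooth3 B -> smooth3 C ->
  smooth3 a -> smooth3 b -> smooth3 c ->
  let D f := fun p => A p * partial ax f p + B p * partial ay f p + C p * partial az f p in
  schouten 1 2 (mk1 A B C) (mk2 a b c) =
  mk2 (fun p => D a p - a p * (partial ax A p + partial ay B p)
                - b p * partial az B p + c p * partial az A p)
      (fun p => D b p - b p * (partial ax A p + partial az C p)
                - a p * partial ay C p - c p * partial ay A p)
      (fun p => D c p - c p * (partial ay B p + partial az C p)
                + a p * partial ax C p - b p * partial ax B p).
Proof. cbv zeta; intros; sem_formula [A; B; C; a; b; c] (mk1 A B C) (sk1 0) (mk2 a b c) (sk2 3). Qed.

Lemma schouten_13 A B C m : smooth3 A -> smooth3 B -> smooth3 C -> smooth3 m ->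
  schouten 1 3 (mk1 A B C) (mk3 m) =
  mk3 (fun p => A p * partial ax m p + B p * partial ay m p + C p * partial az m p
                - m p * (partial ax A p + partial ay B p + partial az C p)).
Proof. cbv zeta; intros; sem_formula [A; B; C; m] (mk1 A B C) (sk1 0) (mk3 m) (sk3 3). Qed.

Lemma schouten_22 a b c a' b' c' : smooth3 a -> smooth3 b -> smooth3 c ->
  smooth3 a' -> smooth3 b' -> smooth3 c' ->
  schouten 2 2 (mk2 a b c) (mk2 a' b' c') =
  mk3 (fun p => a p * (partial ax b' p + partial ay c' p)
    + b p * (partial az c' p - partial ax a' p) - c p * (partial ay a' p + partial az b' p)
    + a' p * (partial ax b p + partial ay c p)
    + b' p * (partial az c p - partial ax a p) - c' p * (partial ay a p + partial az b p)).
Proof.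
  cbv zeta; intros; sem_formula [a; b; c; a'; b'; c'] (mk2 a b c) (sk2 0) (mk2 a' b' c') (sk2 3).
Qed.

Lemma wedge_11 A B C A' B' C' : smooth3 A -> smooth3 B -> smooth3 C ->
  smooth3 A' -> smooth3 B' -> smooth3 C' ->
  mk1 A B C [^] mk1 A' B' C' =
  mk2 (fun p => A p * B' p - B p * A' p) (fun p => A p * C' p - C p * A' p)
      (fun p => B p * C' p - C p * B' p).
Proof.
  cbv zeta; intros; sem_formula [A; B; C; A'; B'; C'] (mk1 A B C) (sk1 0) (mk1 A' B' C') (sk1 3).
Qed.

Lemma wedge_12 A B C a b c : smooth3 A -> smooth3 B -> smooth3 C ->
  smooth3 a -> smooth3 b -> smooth3 c ->
  mk1 A B C [^] mk2 a b c = mk3 (fun p => A p * c p - B p * b p + C p * a p).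
Proof. cbv zeta; intros; sem_formula [A; B; C; a; b; c] (mk1 A B C) (sk1 0) (mk2 a b c) (sk2 3). Qed.

Lemma wedge_01 f A B C : smooth3 f -> smooth3 A -> smooth3 B -> smooth3 C ->
  fn f [^] mk1 A B C = mk1 (fun p => f p * A p) (fun p => f p * B p) (fun p => f p * C p).
Proof. cbv zeta; intros; sem_formula [A; B; C; f] (mk1 A B C) (sk1 0) (fn f) (sk0 3). Qed.

Lemma wedge_02 f a b c : smooth3 f -> smooth3 a -> smooth3 b -> smooth3 c ->
  fn f [^] mk2 a b c = mk2 (fun p => f p * a p) (fun p => f p * b p) (fun p => f p * c p).
Proof. cbv zeta; intros; sem_formula [a; b; c; f] (mk2 a b c) (sk2 0) (fn f) (sk0 3). Qed.

Lemma wedge_03 f m : smooth3 f -> smooth3 m ->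
  fn f [^] mk3 m = mk3 (fun p => f p * m p).
Proof. cbv zeta; intros; sem_formula [m; f] (mk3 m) (sk3 0) (fn f) (sk0 1). Qed.

Lemma wedge_00 f g : smooth3 f -> smooth3 g -> fn f [^] fn g = fn (fun p => f p * g p).
Proof. cbv zeta; intros; sem_formula [f; g] (fn f) (sk0 0) (fn g) (sk0 1). Qed.

(** * The graded algebra of cohomology classes *)

Lemma Rsum_plus {A : Type} (l : list A) F G :
  Rsum l F + Rsum l G = Rsum l (fun x => F x + G x).
Proof. induction l as [|x l IH]; unfold Rsum in *; simpl; [ring | rewrite <- IH; ring]. Qed.

Lemma Rsum_scal {A : Type} (l : list A) c F : c * Rsum l F = Rsum l (fun x => c * F x).
Proof. induction l as [|x l IH]; unfold Rsum in *; simpl; [ring | rewrite <- IH; ring]. Qed.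

Ltac mvf_ext := apply functional_extensionality; intros ?K; apply functional_extensionality; intros ?x.

Lemma wedge_add_l P P' Q : (P [+] P') [^] Q = P [^] Q [+] P' [^] Q.
Proof.
  mvf_ext; unfold wedge, madd; rewrite Rsum_plus; apply Rsum_ext; intros I.
  destruct (msubset I K); ring.
Qed.

Lemma wedge_add_r P Q Q' : P [^] (Q [+] Q') = P [^] Q [+] P [^] Q'.
Proof.
  mvf_ext; unfold wedge, madd; rewrite Rsum_plus; apply Rsum_ext; intros I.
  destruct (msubset I K); ring.
Qed.

Lemma wedge_scal_l c P Q : mscal c P [^] Q = mscal c (P [^] Q).
Proof.
  mvf_ext; unfold mscal, wedge, fmul; rewrite Rsum_scal; apply Rsum_ext; intros I.
  destruct (msubset I K); ring.
Qed.

Lemma wedge_scal_r c P Q : P [^] mscal c Q = mscal c (P [^] Q).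
Proof.
  mvf_ext; unfold mscal, wedge, fmul; rewrite Rsum_scal; apply Rsum_ext; intros I.
  destruct (msubset I K); ring.
Qed.

Lemma odd_add i P Q : odd_deriv i (P [+] Q) = odd_deriv i P [+] odd_deriv i Q.
Proof. mvf_ext; unfold odd_deriv, madd; destruct (mem i K); ring. Qed.

Lemma odd_scal i c P : odd_deriv i (mscal c P) = mscal c (odd_deriv i P).
Proof. mvf_ext; unfold mscal, odd_deriv, fmul; destruct (mem i K); ring. Qed.

Definition smooth_mvf (P : mvf) : Prop := forall I, smooth3 (P I).

Lemma multivector_smooth k P : multivector k P -> smooth_mvf P.
Proof. intros H I; apply H. Qed.

Lemma coef_add i P Q : smooth_mvf P -> smooth_mvf Q ->
  coef_deriv i (P [+] Q) = coef_deriv i P [+] coef_deriv i Q.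
Proof.
  intros HP HQ; apply functional_extensionality; intros K.
  exact (smooth3_partial_plus i _ _ (HP K) (HQ K)).
Qed.

Lemma coef_scal i c P : smooth_mvf P -> coef_deriv i (mscal c P) = mscal c (coef_deriv i P).
Proof.
  intros HP; apply functional_extensionality; intros K; exact (partial_scal i c _ (HP K)).
Qed.

Lemma schouten_add_l p q P P' Q : smooth_mvf P -> smooth_mvf P' ->
  schouten p q (P [+] P') Q = schouten p q P Q [+] schouten p q P' Q.
Proof.
  intros HP HP'; mvf_ext; change ((schouten p q P Q [+] schouten p q P' Q) K x)
    with (schouten p q P Q K x + schouten p q P' Q K x); unfold schouten.
  rewrite (Rsum_ext axes _ (fun i => (odd_deriv i P [^] coef_deriv i Q) K x
    + (odd_deriv i P' [^] coef_deriv i Q) K x))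
    by (intros i; rewrite odd_add, wedge_add_l; reflexivity).
  rewrite (Rsum_ext axes (fun i => (odd_deriv i Q [^] coef_deriv i (P [+] P')) K x)
    (fun i => (odd_deriv i Q [^] coef_deriv i P) K x
    + (odd_deriv i Q [^] coef_deriv i P') K x))
    by (intros i; rewrite coef_add, wedge_add_r by assumption; reflexivity).
  rewrite <- !Rsum_plus; ring.
Qed.

Lemma schouten_add_r p q P Q Q' : smooth_mvf Q -> smooth_mvf Q' ->
  schouten p q P (Q [+] Q') = schouten p q P Q [+] schouten p q P Q'.
Proof.
  intros HQ HQ'; mvf_ext; change ((schouten p q P Q [+] schouten p q P Q') K x)
    with (schouten p q P Q K x + schouten p q P Q' K x); unfold schouten.
  rewrite (Rsum_ext axes _ (fun i => (odd_deriv i P [^] coef_deriv i Q) K x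
    + (odd_deriv i P [^] coef_deriv i Q') K x))
    by (intros i; rewrite coef_add, wedge_add_r by assumption; reflexivity).
  rewrite (Rsum_ext axes (fun i => (odd_deriv i (Q [+] Q') [^] coef_deriv i P) K x)
    (fun i => (odd_deriv i Q [^] coef_deriv i P) K x
    + (odd_deriv i Q' [^] coef_deriv i P) K x))
    by (intros i; rewrite odd_add, wedge_add_l; reflexivity).
  rewrite <- !Rsum_plus; ring.
Qed.

Lemma schouten_scal_r p q c P Q : smooth_mvf Q ->
  schouten p q P (mscal c Q) = mscal c (schouten p q P Q).
Proof.
  intros HQ; mvf_ext; change (mscal c (schouten p q P Q) K x) with (c * schouten p q P Q K x); unfold schouten.
  rewrite (Rsum_ext axes _ (fun i => c * (odd_deriv i P [^] coef_deriv i Q) K x))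
    by (intros i; rewrite coef_scal, wedge_scal_r by assumption; reflexivity).
  rewrite (Rsum_ext axes (fun i => (odd_deriv i (mscal c Q) [^] coef_deriv i P) K x)
    (fun i => c * (odd_deriv i Q [^] coef_deriv i P) K x))
    by (intros i; rewrite odd_scal, wedge_scal_l; reflexivity).
  rewrite <- !Rsum_scal; ring.
Qed.

Lemma schouten_scal_l p q c P Q : smooth_mvf P ->
  schouten p q (mscal c P) Q = mscal c (schouten p q P Q).
Proof.
  intros HP; mvf_ext; change (mscal c (schouten p q P Q) K x) with (c * schouten p q P Q K x); unfold schouten.
  rewrite (Rsum_ext axes _ (fun i => c * (odd_deriv i P [^] coef_deriv i Q) K x))
    by (intros i; rewrite odd_scal, wedge_scal_l; reflexivity).
  rewrite (Rsum_ext axes (fun i => (odd_deriv i Q [^] coef_deriv i (mscal c P)) K x)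
    (fun i => c * (odd_deriv i Q [^] coef_deriv i P) K x))
    by (intros i; rewrite coef_scal, wedge_scal_r by assumption; reflexivity).
  rewrite <- !Rsum_scal; ring.
Qed.

Lemma mscal_zero P : mscal 0 P = mzero.
Proof. mvf_ext; unfold mscal, fmul, mzero; ring. Qed.

Lemma mscal_mzero c : mscal c mzero = mzero.
Proof. mvf_ext; unfold mscal, fmul, mzero; ring. Qed.

Lemma mscal_mscal c d P : mscal c (mscal d P) = mscal (c * d) P.
Proof. mvf_ext; unfold mscal, fmul; ring. Qed.

Lemma mscal_1 P : mscal 1 P = P.
Proof. mvf_ext; unfold mscal, fmul; ring. Qed.

Lemma madd_zero_l P : mzero [+] P = P.
Proof. mvf_ext; unfold madd, mzero; ring. Qed.

Lemma madd_zero_r P : P [+] mzero = P.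
Proof. mvf_ext; unfold madd, mzero; ring. Qed.

Lemma msub_add P Q : P [-] Q = P [+] mscal (-1) Q.
Proof. mvf_ext; unfold mscal, msub, madd, fmul; ring. Qed.

Lemma smooth_mzero : smooth_mvf mzero.
Proof. intros I; exact (smooth3_const 0). Qed.

Lemma wedge_zero_l Q : mzero [^] Q = mzero.
Proof. now rewrite <- (mscal_zero mzero), wedge_scal_l, !mscal_zero. Qed.

Lemma wedge_zero_r P : P [^] mzero = mzero.
Proof. now rewrite <- (mscal_zero mzero), wedge_scal_r, !mscal_zero. Qed.

Lemma schouten_zero_l p q Q : schouten p q mzero Q = mzero.
Proof. rewrite <- (mscal_zero mzero), schouten_scal_l, !mscal_zero; auto using smooth_mzero. Qed.

Lemma schouten_zero_r p q P : schouten p q P mzero = mzero.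
Proof. rewrite <- (mscal_zero mzero), schouten_scal_r, !mscal_zero; auto using smooth_mzero. Qed.

(** * Degrees of sums, products and brackets *)

Lemma multivector_zero k : multivector k mzero.
Proof. intros I; split; [exact (smooth3_const 0) | reflexivity]. Qed.

Lemma multivector_add k P Q : multivector k P -> multivector k Q -> multivector k (P [+] Q).
Proof.
  intros HP HQ I; destruct (HP I) as [SP ZP], (HQ I) as [SQ ZQ]; split.
  - now apply smooth3_plus.
  - intros H p; unfold madd; rewrite ZP, ZQ by exact H; ring.
Qed.

Lemma multivector_scal k c P : multivector k P -> multivector k (mscal c P).
Proof.
  intros HP I; destruct (HP I) as [SP ZP]; split.
  - exact (scal_smooth3 c (P I) SP).
  - intros H p; unfold mscal, fmul; rewrite ZP by exact H; ring.
Qed.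

Lemma multivector_high k P : (3 < k)%nat -> multivector k P -> P = mzero.
Proof.
  intros Hk H; mvf_ext; apply H; intros E; revert Hk; rewrite <- E.
  apply Nat.le_ngt; destruct K as [[[] []] []]; now apply Nat.leb_le.
Qed.

Ltac sem_degree :=
  match goal with
  | |- multivector _ (sem ?env ?S) =>
    intros [[[] []] []]; (split; [apply interp_smooth3; assumption|]);
    (let H := fresh in let q := fresh in intros H q;
     first [exfalso; apply H; reflexivity |
      match goal with |- sem _ ?T ?K _ = _ =>
        let a := eval vm_compute in (T K) in change (interp env a q = 0) end;
      reflexivity])
  end.

Lemma sem_wedge_degree env p q : (forall n, smooth3 (env n)) -> (p <= 3)%nat -> (q <= 3)%nat ->
  multivector (p + q) (sem env (swedge (svars 0 p) (svars 8 q))).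
Proof. intros He Hp Hq; degree_cases p Hp; degree_cases q Hq; sem_degree. Qed.

Lemma sem_schouten_degree env p q : (forall n, smooth3 (env n)) -> (p <= 3)%nat -> (q <= 3)%nat ->
  multivector (p + q - 1) (sem env (sschouten p q (svars 0 p) (svars 8 q))).
Proof. intros He Hp Hq; degree_cases p Hp; degree_cases q Hq; sem_degree. Qed.

Lemma multivector_wedge p q P Q : multivector p P -> multivector q Q ->
  multivector (p + q) (P [^] Q).
Proof.
  intros HP HQ.
  destruct (le_lt_dec p 3) as [Lp|Lp];
    [|rewrite (multivector_high p P Lp HP), wedge_zero_l; apply multivector_zero].
  destruct (le_lt_dec q 3) as [Lq|Lq];
    [|rewrite (multivector_high q Q Lq HQ), wedge_zero_r; apply multivector_zero].
  pose proof (sem_wedge_degree _ p q (env2_smooth3 p q P Q HP HQ) Lp Lq) as H.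
  now rewrite sem_wedge, (sem_vars_l p P Q HP), (sem_vars_r q P Q HQ) in H.
Qed.

Lemma multivector_schouten p q P Q : multivector p P -> multivector q Q ->
  multivector (p + q - 1) (schouten p q P Q).
Proof.
  intros HP HQ.
  destruct (le_lt_dec p 3) as [Lp|Lp];
    [|rewrite (multivector_high p P Lp HP), schouten_zero_l; apply multivector_zero].
  destruct (le_lt_dec q 3) as [Lq|Lq];
    [|rewrite (multivector_high q Q Lq HQ), schouten_zero_r; apply multivector_zero].
  pose proof (env2_smooth3 p q P Q HP HQ) as He.
  pose proof (sem_schouten_degree _ p q He Lp Lq) as H.
  now rewrite sem_schouten, (sem_vars_l p P Q HP), (sem_vars_r q P Q HQ) in H by exact He.
Qed.

Lemma multivector_pi : multivector 2 pi_e2.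
Proof.
  rewrite <- (sem_pi (fun _ _ => 0)).
  assert (He : forall n : nat, smooth3 ((fun (_ : nat) (_ : R3) => 0) n))
    by (intros; apply smooth3_const).
  sem_degree.
Qed.

(** * The differential as a graded derivation of both operations *)

Lemma multivector_dpi k P : multivector k P -> multivector (S k) (dpi pi_e2 k P).
Proof. intros H; exact (multivector_schouten 2 k pi_e2 P multivector_pi H). Qed.

Lemma dpi_zero k : dpi pi_e2 k mzero = mzero.
Proof. apply schouten_zero_r. Qed.

Lemma dpi_leibniz p q P Q : multivector p P -> multivector q Q ->
  dpi pi_e2 (p + q) (P [^] Q) =
  dpi pi_e2 p P [^] Q [+] mscal ((-1) ^ p) (P [^] dpi pi_e2 q Q).
Proof.
  intros HP HQ.
  destruct (le_lt_dec p 3) as [Lp|Lp];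
    [|now rewrite (multivector_high p P Lp HP), dpi_zero, !wedge_zero_l, dpi_zero,
        mscal_mzero, madd_zero_l].
  destruct (le_lt_dec q 3) as [Lq|Lq];
    [|now rewrite (multivector_high q Q Lq HQ), dpi_zero, !wedge_zero_r, dpi_zero,
        mscal_mzero, madd_zero_l].
  pose proof (env2_smooth3 p q P Q HP HQ) as He.
  pose proof (sem_leibniz (env2 P Q) p q Lp Lq) as E.
  rewrite sem_add, sem_scal, sem_dpi, !sem_wedge, !sem_dpi in E by exact He.
  now rewrite (sem_vars_l p P Q HP), (sem_vars_r q P Q HQ) in E.
Qed.

Lemma dpi_jacobi p q P Q : multivector p P -> multivector q Q ->
  dpi pi_e2 (p + q - 1) (schouten p q P Q) =
  schouten (p + 1) q (dpi pi_e2 p P) Q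
  [+] mscal ((-1) ^ (p + 1)) (schouten p (q + 1) P (dpi pi_e2 q Q)).
Proof.
  intros HP HQ.
  destruct (le_lt_dec p 3) as [Lp|Lp];
    [|now rewrite (multivector_high p P Lp HP), dpi_zero, !schouten_zero_l, dpi_zero,
        mscal_mzero, madd_zero_l].
  destruct (le_lt_dec q 3) as [Lq|Lq];
    [|now rewrite (multivector_high q Q Lq HQ), dpi_zero, !schouten_zero_r, dpi_zero,
        mscal_mzero, madd_zero_l].
  pose proof (env2_smooth3 p q P Q HP HQ) as He.
  pose proof (sem_jacobi (env2 P Q) p q Lp Lq) as E.
  rewrite sem_add, sem_scal, sem_dpi, !sem_schouten, !sem_dpi in E by exact He.
  now rewrite (sem_vars_l p P Q HP), (sem_vars_r q P Q HQ) in E.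
Qed.

Lemma dpi_add k P Q : multivector k P -> multivector k Q ->
  dpi pi_e2 k (P [+] Q) = dpi pi_e2 k P [+] dpi pi_e2 k Q.
Proof. intros; apply schouten_add_r; eapply multivector_smooth; eassumption. Qed.

Lemma dpi_scal k c P : multivector k P -> dpi pi_e2 k (mscal c P) = mscal c (dpi pi_e2 k P).
Proof. intros; apply schouten_scal_r; eapply multivector_smooth; eassumption. Qed.

(** * Cocycles form a subalgebra in which coboundaries form an ideal *)

Lemma cocycle_zero k : cocycle pi_e2 k mzero.
Proof. split; [apply multivector_zero | apply dpi_zero]. Qed.

Lemma cocycle_add k P Q : cocycle pi_e2 k P -> cocycle pi_e2 k Q -> cocycle pi_e2 k (P [+] Q).
Proof.
  intros [HP DP] [HQ DQ]; split; [now apply multivector_add|].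
  rewrite dpi_add, DP, DQ by assumption; apply madd_zero_l.
Qed.

Lemma cocycle_scal k c P : cocycle pi_e2 k P -> cocycle pi_e2 k (mscal c P).
Proof.
  intros [HP DP]; split; [now apply multivector_scal|].
  rewrite dpi_scal, DP by assumption; apply mscal_mzero.
Qed.

Lemma cocycle_sub k P Q : cocycle pi_e2 k P -> cocycle pi_e2 k Q -> cocycle pi_e2 k (P [-] Q).
Proof. intros; rewrite msub_add; auto using cocycle_add, cocycle_scal. Qed.

Lemma coboundary_zero k : coboundary pi_e2 k mzero.
Proof.
  destruct k as [|k]; simpl; [reflexivity|].
  exists mzero; split; [apply multivector_zero | symmetry; apply dpi_zero].
Qed.

Lemma coboundary_add k P Q : coboundary pi_e2 k P -> coboundary pi_e2 k Q ->
  coboundary pi_e2 k (P [+] Q).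
Proof.
  destruct k as [|k]; simpl.
  - intros -> ->; apply madd_zero_l.
  - intros (A & HA & ->) (B & HB & ->); exists (A [+] B).
    split; [now apply multivector_add | now rewrite dpi_add].
Qed.

Lemma coboundary_scal k c P : coboundary pi_e2 k P -> coboundary pi_e2 k (mscal c P).
Proof.
  destruct k as [|k]; simpl.
  - intros ->; apply mscal_mzero.
  - intros (A & HA & ->); exists (mscal c A).
    split; [now apply multivector_scal | now rewrite dpi_scal].
Qed.

Lemma cocycle_wedge p q P Q : cocycle pi_e2 p P -> cocycle pi_e2 q Q ->
  cocycle pi_e2 (p + q) (P [^] Q).
Proof.
  intros [HP DP] [HQ DQ]; split; [now apply multivector_wedge|].
  rewrite dpi_leibniz, DP, DQ, wedge_zero_l, wedge_zero_r, mscal_mzero by assumption.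
  apply madd_zero_l.
Qed.

Lemma cocycle_schouten p q P Q : cocycle pi_e2 p P -> cocycle pi_e2 q Q ->
  cocycle pi_e2 (p + q - 1) (schouten p q P Q).
Proof.
  intros [HP DP] [HQ DQ]; split; [now apply multivector_schouten|].
  rewrite dpi_jacobi, DP, DQ, schouten_zero_l, schouten_zero_r, mscal_mzero by assumption.
  apply madd_zero_l.
Qed.

Lemma minus_one_pow_sq n : (-1) ^ n * (-1) ^ n = 1.
Proof. rewrite minus_one_pow; destruct (Nat.even n); ring. Qed.

Lemma coboundary_wedge_l p q P Q : coboundary pi_e2 p P -> cocycle pi_e2 q Q ->
  coboundary pi_e2 (p + q) (P [^] Q).
Proof.
  intros HP [HQ DQ]; destruct p as [|p]; simpl in HP.
  - rewrite HP, wedge_zero_l; apply coboundary_zero.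
  - destruct HP as (A & HA & ->); exists (A [^] Q); split; [now apply multivector_wedge|].
    rewrite dpi_leibniz, DQ, wedge_zero_r, mscal_mzero by assumption.
    symmetry; apply madd_zero_r.
Qed.

Lemma coboundary_wedge_r p q P Q : cocycle pi_e2 p P -> coboundary pi_e2 q Q ->
  coboundary pi_e2 (p + q) (P [^] Q).
Proof.
  intros [HP DP] HQ; destruct q as [|q]; simpl in HQ.
  - rewrite HQ, wedge_zero_r; apply coboundary_zero.
  - destruct HQ as (A & HA & ->); rewrite Nat.add_succ_r.
    (* As [P] is closed, d (P /\ A) = (-1)^p P /\ d A, and the sign squares to 1. *)
    exists (mscal ((-1) ^ p) (P [^] A)).
    split; [now apply multivector_scal, multivector_wedge|].
    rewrite dpi_scal by now apply multivector_wedge.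
    rewrite dpi_leibniz, DP, wedge_zero_l, madd_zero_l, mscal_mscal, minus_one_pow_sq by assumption.
    symmetry; apply mscal_1.
Qed.

Lemma schouten_00 P Q : multivector 0 P -> multivector 0 Q -> schouten 0 0 P Q = mzero.
Proof.
  intros HP HQ; pose proof (env2_smooth3 0 0 P Q HP HQ) as He.
  transitivity (sem (env2 P Q) (sschouten 0 0 (svars 0 0) (svars 8 0))).
  - now rewrite sem_schouten, (sem_vars_l 0 P Q HP), (sem_vars_r 0 P Q HQ) by exact He.
  - mvf_ext; destruct K as [[[] []] []]; reflexivity.
Qed.

Lemma coboundary_schouten_l p q P Q : coboundary pi_e2 p P -> cocycle pi_e2 q Q ->
  coboundary pi_e2 (p + q - 1) (schouten p q P Q).
Proof.
  intros HP [HQ DQ]; destruct p as [|p]; simpl in HP.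
  - rewrite HP, schouten_zero_l; apply coboundary_zero.
  - destruct HP as (A & HA & ->).
    pose proof (dpi_jacobi p q A Q HA HQ) as E.
    rewrite DQ, schouten_zero_r, mscal_mzero, madd_zero_r, Nat.add_1_r in E.
    replace (S p + q - 1)%nat with (p + q)%nat by lia.
    (* When both [A] and [Q] are functions the bracket lands in degree 0, where a coboundary must be
       zero; indeed [d A, Q] = d [A, Q] and [A, Q] = 0. *)
    destruct (p + q)%nat as [|n] eqn:En.
    + assert (p = 0%nat) by lia; assert (q = 0%nat) by lia; subst p q; simpl.
      rewrite <- E, schouten_00 by assumption; apply dpi_zero.
    + exists (schouten p q A Q); split.
      * replace n with (p + q - 1)%nat by lia; now apply multivector_schouten.
      * rewrite <- E; f_equal; lia.
Qed.

Lemma coboundary_schouten_r p q P Q : cocycle pi_e2 p P -> coboundary pi_e2 q Q ->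
  coboundary pi_e2 (p + q - 1) (schouten p q P Q).
Proof.
  intros [HP DP] HQ; destruct q as [|q]; simpl in HQ.
  - rewrite HQ, schouten_zero_r; apply coboundary_zero.
  - destruct HQ as (A & HA & ->).
    pose proof (dpi_jacobi p q P A HP HA) as E.
    rewrite DP, schouten_zero_l, madd_zero_l, (Nat.add_1_r q) in E.
    assert (E' : schouten p (S q) P (dpi pi_e2 q A) =
      mscal ((-1) ^ (p + 1)) (dpi pi_e2 (p + q - 1) (schouten p q P A)))
      by (rewrite E, mscal_mscal, minus_one_pow_sq; symmetry; apply mscal_1).
    replace (p + S q - 1)%nat with (p + q)%nat by lia; rewrite E'.
    destruct (p + q)%nat as [|n] eqn:En.
    + assert (p = 0%nat) by lia; assert (q = 0%nat) by lia; subst p q; simpl.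
      rewrite schouten_00, dpi_zero by assumption; apply mscal_mzero.
    + apply coboundary_scal; exists (schouten p q P A); split.
      * replace n with (p + q - 1)%nat by lia; now apply multivector_schouten.
      * f_equal; lia.
Qed.

(** * Operations on classes do not depend on representatives *)

Lemma set_ext (C D : mvf -> Prop) : (forall W, C W <-> D W) -> C = D.
Proof.
  intros H; apply functional_extensionality; intros W; apply propositional_extensionality, H.
Qed.

Lemma class_self k P : cocycle pi_e2 k P -> class pi_e2 k P P.
Proof.
  intros H; split; [exact H|].
  replace (P [-] P) with mzero by (mvf_ext; unfold mzero, msub; ring).
  apply coboundary_zero.
Qed.

Lemma class_eq k P Q : coboundary pi_e2 k (P [-] Q) -> class pi_e2 k P = class pi_e2 k Q.
Proof.
  intros H; apply set_ext; intros W; split; intros [HW KW]; (split; [exact HW|]).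
  - replace (W [-] Q) with ((W [-] P) [+] (P [-] Q)) by (mvf_ext; unfold madd, msub; ring).
    now apply coboundary_add.
  - replace (W [-] P) with ((W [-] Q) [+] mscal (-1) (P [-] Q))
      by (mvf_ext; unfold mscal, fmul, madd, msub; ring).
    now apply coboundary_add; [|apply coboundary_scal].
Qed.

Lemma class_eq_inv k P Q : cocycle pi_e2 k P -> class pi_e2 k P = class pi_e2 k Q ->
  coboundary pi_e2 k (P [-] Q).
Proof. intros HP E; pose proof (class_self k P HP) as H; rewrite E in H; apply H. Qed.

Lemma cohomology_class k P : cocycle pi_e2 k P -> cohomology pi_e2 k (class pi_e2 k P).
Proof. intros H; now exists P. Qed.

Lemma class_add_class k P Q : cocycle pi_e2 k P -> cocycle pi_e2 k Q ->
  class_add pi_e2 k (class pi_e2 k P) (class pi_e2 k Q) = class pi_e2 k (P [+] Q).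
Proof.
  intros HP HQ; apply set_ext; intros W; split.
  - intros (P' & Q' & [_ KP] & [_ KQ] & H).
    rewrite <- (class_eq k (P' [+] Q') (P [+] Q)); [exact H|].
    replace ((P' [+] Q') [-] (P [+] Q)) with ((P' [-] P) [+] (Q' [-] Q))
      by (mvf_ext; unfold madd, msub; ring).
    now apply coboundary_add.
  - intros H; exists P, Q; auto using class_self.
Qed.

Lemma class_wedge_class p q P Q : cocycle pi_e2 p P -> cocycle pi_e2 q Q ->
  class_wedge pi_e2 p q (class pi_e2 p P) (class pi_e2 q Q) = class pi_e2 (p + q) (P [^] Q).
Proof.
  intros HP HQ; apply set_ext; intros W; split.
  - intros (P' & Q' & [CP KP] & [CQ KQ] & H).
    rewrite <- (class_eq (p + q) (P' [^] Q') (P [^] Q)); [exact H|].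
    replace ((P' [^] Q') [-] (P [^] Q)) with ((P' [-] P) [^] Q' [+] P [^] (Q' [-] Q)).
    + apply coboundary_add; [now apply coboundary_wedge_l | now apply coboundary_wedge_r].
    + rewrite !msub_add, wedge_add_l, wedge_add_r, wedge_scal_l, wedge_scal_r.
      mvf_ext; unfold mscal, fmul, madd; ring.
  - intros H; exists P, Q; auto using class_self.
Qed.

Lemma class_bracket_class p q P Q : cocycle pi_e2 p P -> cocycle pi_e2 q Q ->
  class_bracket pi_e2 p q (class pi_e2 p P) (class pi_e2 q Q) =
  class pi_e2 (p + q - 1) (schouten p q P Q).
Proof.
  intros HP HQ; apply set_ext; intros W; split.
  - intros (P' & Q' & [CP KP] & [CQ KQ] & H).
    rewrite <- (class_eq (p + q - 1) (schouten p q P' Q') (schouten p q P Q)); [exact H|].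
    replace (schouten p q P' Q' [-] schouten p q P Q)
      with (schouten p q (P' [-] P) Q' [+] schouten p q P (Q' [-] Q)).
    + apply coboundary_add; [now apply coboundary_schouten_l | now apply coboundary_schouten_r].
    + assert (SP : smooth_mvf P) by (eapply multivector_smooth; apply HP).
      assert (SQ : smooth_mvf Q) by (eapply multivector_smooth; apply HQ).
      assert (SP' : smooth_mvf P') by (eapply multivector_smooth; apply CP).
      assert (SQ' : smooth_mvf Q') by (eapply multivector_smooth; apply CQ).
      assert (Sc : forall c A, smooth_mvf A -> smooth_mvf (mscal c A))
        by (intros c A HA I; exact (scal_smooth3 c (A I) (HA I))).
      rewrite !msub_add, schouten_add_l, schouten_add_r, schouten_scal_l, schouten_scal_r by auto.
      mvf_ext; unfold mscal, fmul, madd; ring.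
  - intros H; exists P, Q; auto using class_self.
Qed.

(** * The cohomology in each degree *)

Lemma ptwise {A : Type} (f g : A -> R) x : f = g -> f x = g x.
Proof. now intros ->. Qed.

Ltac mk_multivector :=
  let H := fresh in let q := fresh in
  intros [[[] []] []]; (split; [first [assumption | exact (smooth3_const 0)]|]);
  intros H q; first [reflexivity | exfalso; apply H; reflexivity].

Lemma multivector_fn f : smooth3 f -> multivector 0 (fn f).
Proof. intros Hf; mk_multivector. Qed.

Lemma multivector_mk1 A B C : smooth3 A -> smooth3 B -> smooth3 C -> multivector 1 (mk1 A B C).
Proof. intros; mk_multivector. Qed.

Lemma multivector_mk2 a b c : smooth3 a -> smooth3 b -> smooth3 c -> multivector 2 (mk2 a b c).
Proof. intros; mk_multivector. Qed.

Lemma multivector_mk3 m : smooth3 m -> multivector 3 (mk3 m).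
Proof. intros; mk_multivector. Qed.

Ltac mk_elim HP :=
  mvf_ext; match goal with K : mindex |- _ => destruct K as [[[] []] []] end;
  first [reflexivity | apply HP; discriminate].

Lemma multivector_0_elim P : multivector 0 P -> exists f, smooth3 f /\ P = fn f.
Proof. intros HP; exists (P mempty); split; [apply HP | mk_elim HP]. Qed.

Lemma multivector_1_elim P : multivector 1 P -> exists A B C,
  smooth3 A /\ smooth3 B /\ smooth3 C /\ P = mk1 A B C.
Proof.
  intros HP; exists (P (true, false, false)), (P (false, true, false)), (P (false, false, true)).
  repeat (split; [apply HP|]); mk_elim HP.
Qed.

Lemma multivector_2_elim P : multivector 2 P -> exists a b c,
  smooth3 a /\ smooth3 b /\ smooth3 c /\ P = mk2 a b c.
Proof.
  intros HP; exists (P (true, true, false)), (P (true, false, true)), (P (false, true, true)).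
  repeat (split; [apply HP|]); mk_elim HP.
Qed.

Lemma multivector_3_elim P : multivector 3 P -> exists m, smooth3 m /\ P = mk3 m.
Proof. intros HP; exists (P (true, true, true)); split; [apply HP | mk_elim HP]. Qed.

Lemma mk1_inj A B C A' B' C' : mk1 A B C = mk1 A' B' C' -> A = A' /\ B = B' /\ C = C'.
Proof.
  intros H; repeat split.
  - exact (f_equal (fun P : mvf => P (true, false, false)) H).
  - exact (f_equal (fun P : mvf => P (false, true, false)) H).
  - exact (f_equal (fun P : mvf => P (false, false, true)) H).
Qed.

Lemma mk2_inj A B C A' B' C' : mk2 A B C = mk2 A' B' C' -> A = A' /\ B = B' /\ C = C'.
Proof.
  intros H; repeat split.
  - exact (f_equal (fun P : mvf => P (true, true, false)) H).
  - exact (f_equal (fun P : mvf => P (true, false, true)) H).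
  - exact (f_equal (fun P : mvf => P (false, true, true)) H).
Qed.

Lemma mk3_inj m m' : mk3 m = mk3 m' -> m = m'.
Proof. intros H; exact (f_equal (fun P : mvf => P (true, true, true)) H). Qed.

Lemma mzero_mk1 : mzero = mk1 (fun _ => 0) (fun _ => 0) (fun _ => 0).
Proof. apply functional_extensionality; intros [[[] []] []]; reflexivity. Qed.

Lemma mzero_mk2 : mzero = mk2 (fun _ => 0) (fun _ => 0) (fun _ => 0).
Proof. apply functional_extensionality; intros [[[] []] []]; reflexivity. Qed.

Lemma mzero_mk3 : mzero = mk3 (fun _ => 0).
Proof. apply functional_extensionality; intros [[[] []] []]; reflexivity. Qed.

Lemma msub_mk1 A B C A' B' C' : mk1 A B C [-] mk1 A' B' C' =
  mk1 (fun p => A p - A' p) (fun p => B p - B' p) (fun p => C p - C' p).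
Proof. mvf_ext; destruct K as [[[] []] []]; unfold msub; simpl; ring. Qed.

Lemma msub_mk2 A B C A' B' C' : mk2 A B C [-] mk2 A' B' C' =
  mk2 (fun p => A p - A' p) (fun p => B p - B' p) (fun p => C p - C' p).
Proof. mvf_ext; destruct K as [[[] []] []]; unfold msub; simpl; ring. Qed.

Lemma msub_mk3 m m' : mk3 m [-] mk3 m' = mk3 (fun p => m p - m' p).
Proof. mvf_ext; destruct K as [[[] []] []]; unfold msub; simpl; ring. Qed.

(** The component x f_z of d f forces f_z = 0 off the plane x = 0, hence everywhere; the third
    component is - rot f. *)
Lemma casimir_invariant f : casimir pi_e2 f <-> invariant f.
Proof.
  split.
  - intros [Hf H]; rewrite dpi_fn, mzero_mk1 in H by exact Hf.
    apply mk1_inj in H; destruct H as (_ & Hx & Hr); split; [exact Hf|split]; intros p.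
    + pose proof (ptwise _ _ p Hr) as E; cbv beta in E; lra.
    + apply (ptwise (partial az f) (fun _ => 0)), (coord_cancel ax).
      * now apply smooth3_cont, smooth3_partial.
      * intros q; exact (ptwise _ _ q Hx).
  - intros (Hf & Hr & Hz); split; [exact Hf|]; rewrite dpi_fn, mzero_mk1 by exact Hf.
    f_equal; apply functional_extensionality; intros p; rewrite ?Hr, ?Hz; ring.
Qed.

Lemma cocycle_fn f : invariant f -> cocycle pi_e2 0 (fn f).
Proof.
  intros H; split; [apply multivector_fn, H | now apply casimir_invariant].
Qed.

Lemma cohomology_0_elim C : cohomology pi_e2 0 C ->
  exists f, invariant f /\ C = class pi_e2 0 (fn f).
Proof.
  intros (P & [HP DP] & ->); destruct (multivector_0_elim P HP) as (f & Hf & ->).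
  exists f; split; [now apply casimir_invariant | reflexivity].
Qed.

Lemma cocycle_mk1_elim A B C : smooth3 A -> smooth3 B -> smooth3 C ->
  cocycle pi_e2 1 (mk1 A B C) -> forall p,
  coord ax p * partial az A p + coord ay p * partial az B p = 0 /\
  rot A p + B p - coord ay p * partial az C p = 0 /\
  rot B p - A p + coord ax p * partial az C p = 0.
Proof.
  intros HA HB HC [_ H] p; rewrite dpi_mk1, mzero_mk2 in H by assumption.
  apply mk2_inj in H; destruct H as (H1 & H2 & H3).
  apply (ptwise _ _ p) in H1; apply (ptwise _ _ p) in H2; apply (ptwise _ _ p) in H3.
  repeat split; lra.
Qed.

Lemma cocycle_mk2_elim a b c : smooth3 a -> smooth3 b -> smooth3 c ->
  cocycle pi_e2 2 (mk2 a b c) -> forall p,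
  rot a p + coord ax p * partial az b p + coord ay p * partial az c p = 0.
Proof.
  intros Ha Hb Hc [_ H] p; rewrite dpi_mk2, mzero_mk3 in H by assumption.
  apply mk3_inj, (ptwise _ _ p) in H; cbv beta in H; lra.
Qed.

Lemma invariant_times_coord i j : invariant i -> smooth3 (fun p => i p * coord j p).
Proof. intros H; apply smooth3_mult; [apply H | apply smooth3_coord]. Qed.

Lemma rot_invariant_mult i f p : invariant i -> smooth3 f ->
  rot (fun q => i q * f q) p = i p * rot f p.
Proof. intros (Hi & Hr & _) Hf; rewrite rot_mult, Hr by assumption; ring. Qed.

Lemma partial_z_invariant_coord i j p : invariant i -> j <> az ->
  partial az (fun q => i q * coord j q) p = 0.
Proof.
  intros (Hi & _ & Hz) Hj.
  rewrite smooth3_partial_mult, Hz, partial_coord by auto using smooth3_coord.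
  destruct j; simpl; [ring | ring | congruence].
Qed.

Lemma cocycle_radial_1 i g : invariant i -> invariant g ->
  cocycle pi_e2 1 (mk1 (fun p => i p * coord ax p) (fun p => i p * coord ay p) g).
Proof.
  intros Hi Hg.
  assert (Hg' := Hg); destruct Hg' as (Sg & _ & Zg).
  split; [apply multivector_mk1; auto using invariant_times_coord|].
  rewrite dpi_mk1, mzero_mk2 by auto using invariant_times_coord.
  f_equal; apply functional_extensionality; intros p;
    rewrite ?rot_invariant_mult, ?rot_coord_x, ?rot_coord_y, ?Zg,
      ?partial_z_invariant_coord by (auto using smooth3_coord; congruence); ring.
Qed.

Lemma rot_of_z g p : smooth_line g -> rot (of_z g) p = 0.
Proof. intros H; unfold rot; rewrite !partial_of_z by exact H; ring. Qed.

Lemma cocycle_radial_2 i g : invariant i -> smooth_line g ->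
  cocycle pi_e2 2 (mk2 (of_z g) (fun p => i p * coord ax p) (fun p => i p * coord ay p)).
Proof.
  intros Hi Hg; pose proof (of_z_smooth3 g Hg) as Sg.
  split; [apply multivector_mk2; auto using invariant_times_coord|].
  rewrite dpi_mk2, mzero_mk3 by auto using invariant_times_coord.
  f_equal; apply functional_extensionality; intros p;
    rewrite rot_of_z, !partial_z_invariant_coord by (auto; congruence); ring.
Qed.

Lemma cocycle_mk3 m : smooth3 m -> cocycle pi_e2 3 (mk3 m).
Proof.
  intros Hm; assert (HP := multivector_mk3 m Hm); split; [exact HP|].
  apply (multivector_high 4); [lia | now apply multivector_dpi].
Qed.

Lemma coord_mult_smooth3 i f : smooth3 f -> smooth3 (fun p => coord i p * f p).
Proof. intros H; apply smooth3_mult; [apply smooth3_coord | exact H]. Qed.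

(** The pairing of the planar part with half the differential of x^2 + y^2. It does not see
    multiples of [T]. *)
Definition radial_part (f g : R3 -> R) : R3 -> R := fun p => coord ax p * f p + coord ay p * g p.

Lemma radial_part_smooth3 f g : smooth3 f -> smooth3 g -> smooth3 (radial_part f g).
Proof. intros; apply smooth3_plus; now apply coord_mult_smooth3. Qed.

Lemma rot_radial_part f g p : smooth3 f -> smooth3 g ->
  rot (radial_part f g) p
  = - coord ay p * f p + coord ax p * rot f p + coord ax p * g p + coord ay p * rot g p.
Proof.
  intros Hf Hg; unfold radial_part.
  rewrite rot_plus, !rot_mult, rot_coord_x, rot_coord_y by auto using coord_mult_smooth3, smooth3_coord.
  ring.
Qed.

Lemma partial_z_radial_part f g p : smooth3 f -> smooth3 g ->
  partial az (radial_part f g) p = coord ax p * partial az f p + coord ay p * partial az g p.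
Proof.
  intros Hf Hg; unfold radial_part.
  rewrite smooth3_partial_plus, !smooth3_partial_mult, !partial_coord
    by auto using coord_mult_smooth3, smooth3_coord.
  simpl; ring.
Qed.

Lemma avg_zero_fun f p : (forall q, f q = 0) -> avg f p = 0.
Proof.
  intros H; replace f with (fun _ : R3 => 0); [apply avg_zero|].
  apply functional_extensionality; intros q; now rewrite H.
Qed.

Lemma rot_inv_zero_fun f p : (forall q, f q = 0) -> rot_inv f p = 0.
Proof.
  intros H; replace f with (fun _ : R3 => 0); [apply rot_inv_zero|].
  apply functional_extensionality; intros q; now rewrite H.
Qed.

Lemma rot_minus f g p : smooth3 f -> smooth3 g ->
  rot (fun q => f q - g q) p = rot f p - rot g p.
Proof. intros; unfold rot; rewrite !smooth3_partial_minus by assumption; ring. Qed.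

(** The statement records how [i] and [g] arise from A, B, C, not just that they exist, so that
    [class_eq_1] can conclude that they vanish for a difference of two cocycles. *)
Lemma cocycle_1_normal_form A B C : smooth3 A -> smooth3 B -> smooth3 C ->
  cocycle pi_e2 1 (mk1 A B C) -> exists i g, invariant i /\ invariant g /\
    (forall p, radial_part A B p = rho p * i p) /\ (forall p, g p = avg C p) /\
    coboundary pi_e2 1 (mk1 A B C [-]
      mk1 (fun p => i p * coord ax p) (fun p => i p * coord ay p) g).
Proof.
  intros HA HB HC H; pose proof (cocycle_mk1_elim A B C HA HB HC H) as E; clear H.
  (* The last two cocycle equations, weighted by x and y, give rot (x A + y B) = 0 after [C]
     cancels; the first says that x A + y B is independent of z. *)
  assert (Hu : invariant (radial_part A B)).
  { split; [now apply radial_part_smooth3|split]; intros p; destruct (E p) as (E1 & E2 & E3).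
    - rewrite rot_radial_part by assumption.
      replace (rot A p) with (coord ay p * partial az C p - B p) by lra.
      replace (rot B p) with (A p - coord ax p * partial az C p) by lra; ring.
    - rewrite partial_z_radial_part by assumption; exact E1. }
  destruct (invariant_divide _ Hu) as (i & Hi & Eu).
  { unfold radial_part; simpl; ring. }
  destruct (orthogonal_to_radial (fun p => A p - i p * coord ax p)
              (fun p => B p - i p * coord ay p)) as (w & Hw & EA & EB).
  { apply smooth3_minus; auto using invariant_times_coord. }
  { apply smooth3_minus; auto using invariant_times_coord. }
  { intros p; apply (ptwise _ _ p) in Eu; unfold radial_part, rho in Eu; lra. }
  assert (EA' : A = fun p => i p * coord ax p - coord ay p * w p).
  { apply functional_extensionality; intros p; apply (ptwise _ _ p) in EA; cbv beta in EA; lra. }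
  assert (EB' : B = fun p => i p * coord ay p + coord ax p * w p).
  { apply functional_extensionality; intros p; apply (ptwise _ _ p) in EB; cbv beta in EB; lra. }
  assert (Rw : forall p, rot w p = - partial az C p).
  { assert (K : (fun p => partial az C p + rot w p) = fun _ => 0).
    { apply (coord_cancel ax).
      - apply smooth3_cont, smooth3_plus; auto using smooth3_partial, rot_smooth3.
      - intros p; destruct (E p) as (_ & _ & E3).
        rewrite EB' in E3; rewrite rot_plus, rot_invariant_mult, rot_mult, rot_coord_x, rot_coord_y in E3
          by auto using invariant_times_coord, coord_mult_smooth3, smooth3_coord.
        rewrite EA' in E3; lra. }
    intros p; apply (ptwise _ _ p) in K; cbv beta in K; lra. }
  (* The differential of [h0] has planar part [T w]. Subtracting it leaves [C0] in the z direction,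
     and [rot w = - C_z] makes [C0] independent of z. *)
  set (h0 := zint w); assert (Hh0 : smooth3 h0) by now apply zint_smooth3.
  assert (Zh0 : partial az h0 = w) by now apply partial_zint.
  set (C0 := fun p => C p + rot h0 p).
  assert (HC0 : smooth3 C0) by (apply smooth3_plus; auto using rot_smooth3).
  assert (ZC0 : forall p, partial az C0 p = 0).
  { intros p; unfold C0; rewrite smooth3_partial_plus by auto using rot_smooth3.
    rewrite <- rot_partial_z, Zh0, Rw by exact Hh0; ring. }
  (* Now the zero-average part of [C0] is removed. Its inverse under [rot] is independent of z like
     [C0], so the z-derivative of [h] is still [w]. *)
  set (h := fun p => h0 p - rot_inv C0 p).
  assert (Hh : smooth3 h) by (apply smooth3_minus; auto using rot_inv_smooth3).
  assert (Zh : forall p, partial az h p = w p).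
  { intros p; unfold h; rewrite smooth3_partial_minus, Zh0, partial_z_rot_inv,
      rot_inv_zero_fun by auto using rot_inv_smooth3; ring. }
  assert (Rh : forall p, rot h p = rot h0 p - (C0 p - avg C0 p)).
  { intros p; unfold h; rewrite rot_minus, rot_rot_inv by auto using rot_inv_smooth3; ring. }
  exists i, (avg C0); repeat split.
  - apply Hi.
  - apply Hi.
  - apply Hi.
  - now apply avg_smooth3.
  - intros p; now apply rot_avg.
  - intros p; rewrite partial_z_avg by exact HC0; now apply avg_zero_fun.
  - intros p; now rewrite Eu.
  - intros p; unfold C0; rewrite avg_plus, avg_rot by auto using rot_smooth3; ring.
  - exists (fn h); split; [now apply multivector_fn|].
    rewrite dpi_fn, msub_mk1 by exact Hh.
    f_equal; apply functional_extensionality; intros p; rewrite ?Zh, ?Rh, ?EA', ?EB';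
      unfold C0; ring.
Qed.

(** The planar part of d h is a multiple of [T], so it has zero radial part, which here is rho i.
    The z component is - rot h, whose average is 0, while an invariant [g] equals its average. *)
Lemma coboundary_1_radial i g : invariant i -> invariant g ->
  coboundary pi_e2 1 (mk1 (fun p => i p * coord ax p) (fun p => i p * coord ay p) g) ->
  i = (fun _ => 0) /\ g = fun _ => 0.
Proof.
  intros Hi Hg (Q & HQ & E); destruct (multivector_0_elim Q HQ) as (h & Hh & ->).
  rewrite dpi_fn in E by exact Hh; apply mk1_inj in E; destruct E as (E1 & E2 & E3); split.
  - apply rho_cancel; [apply smooth3_cont, Hi|]; intros p.
    apply (ptwise _ _ p) in E1; apply (ptwise _ _ p) in E2; cbv beta in E1, E2.
    replace ((coord ax p ^ 2 + coord ay p ^ 2) * i p)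
      with (coord ax p * (i p * coord ax p) + coord ay p * (i p * coord ay p)) by ring.
    rewrite E1, E2; ring.
  - apply functional_extensionality; intros p.
    rewrite <- avg_invariant by apply Hg; rewrite E3.
    replace (fun q => - rot h q) with (rot (fun q => (-1) * h q))
      by (apply functional_extensionality; intros q; rewrite rot_scal by exact Hh; ring).
    now apply avg_rot, scal_smooth3.
Qed.

Lemma zint_axis w z : smooth3 w -> (forall t, w (on_axis t) = 0) -> zint w (on_axis z) = 0.
Proof.
  intros Hw H; unfold on_axis; rewrite zint_RInt by exact Hw.
  rewrite (RInt_ext _ (fun _ => 0)) by (intros t _; apply H).
  rewrite RInt_const; change ((z - 0) * 0 = 0); ring.
Qed.

Lemma partial_z_axis f z : (forall t, f (on_axis t) = 0) -> partial az f (on_axis z) = 0.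
Proof.
  intros H; unfold partial; simpl.
  rewrite (Derive_ext _ (fun _ => 0)) by (intros t; apply H); apply Derive_const.
Qed.

(** The z-derivative of [rot (zint w)] is [rot w = 0], and on the plane z = 0 the function [zint w]
    vanishes together with its x and y derivatives. *)
Lemma rot_zint w p : smooth3 w -> (forall q, rot w q = 0) -> rot (zint w) p = 0.
Proof.
  intros Hw Hr; pose proof (zint_smooth3 w Hw) as Hz.
  destruct p as [[x y] z].
  rewrite (z_invariant (rot (zint w)) (rot_smooth3 _ Hz)) with (z' := 0).
  - assert (K : forall i, i <> az -> partial i (zint w) (x, y, 0) = 0).
    { intros i Hi; unfold partial.
      rewrite (Derive_ext _ (fun _ => 0)); [apply Derive_const|].
      intros t; destruct i; [apply zint_plane | apply zint_plane | congruence]. }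
    unfold rot; rewrite !K by congruence; ring.
  - intros q; rewrite <- rot_partial_z, partial_zint by assumption; apply Hr.
Qed.

(** By [dpi_mk1] one needs U = x A + y B with U_z = - a and rot U = u. The cocycle equation rot a +
    u_z = 0 is the compatibility condition of this pair, and U must vanish on the axis to be split
    as x A + y B. *)
Lemma coboundary_2_criterion a b c : smooth3 a -> smooth3 b -> smooth3 c ->
  cocycle pi_e2 2 (mk2 a b c) -> (forall z, a (on_axis z) = 0) ->
  (forall p, avg (radial_part b c) p = 0) -> coboundary pi_e2 2 (mk2 a b c).
Proof.
  intros Ha Hb Hc H Ha0 Hu; pose proof (cocycle_mk2_elim a b c Ha Hb Hc H) as E; clear H.
  set (u := radial_part b c) in *.
  assert (Su : smooth3 u) by now apply radial_part_smooth3.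
  set (k := rot_inv u); assert (Hk : smooth3 k) by now apply rot_inv_smooth3.
  assert (Rk : forall p, rot k p = u p).
  { intros p; unfold k; rewrite rot_rot_inv, Hu by exact Su; ring. }
  assert (Ak : forall z, k (on_axis z) = 0).
  { intros z; apply rot_inv_axis_zero; unfold u, radial_part; simpl; ring. }
  (* [k] solves rot k = u; [r] is its error in the other equation. Compatibility makes [r]
     rotation-invariant, so subtracting [zint r] corrects the z-derivative without changing
     [rot]. *)
  set (r := fun p => a p + partial az k p).
  assert (Sr : smooth3 r) by (apply smooth3_plus; auto using smooth3_partial).
  assert (Rr : forall p, rot r p = 0).
  { intros p; unfold r; rewrite rot_plus, rot_partial_z by auto using smooth3_partial.
    replace (rot k) with u by (apply functional_extensionality; intros q; now rewrite Rk).
    unfold u; rewrite partial_z_radial_part by assumption; specialize (E p); lra. }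
  assert (Ar : forall z, r (on_axis z) = 0).
  { intros z; unfold r; rewrite Ha0, partial_z_axis by exact Ak; ring. }
  set (U := fun p => k p - zint r p).
  assert (Sz : smooth3 (zint r)) by now apply zint_smooth3.
  assert (SU : smooth3 U) by now apply smooth3_minus.
  assert (ZU : forall p, partial az U p = - a p).
  { intros p; unfold U; rewrite smooth3_partial_minus, partial_zint by assumption.
    unfold r; ring. }
  assert (RU : forall p, rot U p = u p).
  { intros p; unfold U; rewrite rot_minus, rot_zint, Rk by assumption; ring. }
  destruct (hadamard_axis U SU) as (A & B & HA & HB & EU).
  { intros z; unfold U; rewrite Ak, zint_axis by assumption; ring. }
  fold (radial_part A B) in EU.
  (* The remainder of (b, c) has zero radial part because rot U = u, so it is [w] times [T]; it is
     produced by a z component [C] with C_z = w. *)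
  destruct (orthogonal_to_radial (fun p => b p - (rot A p + B p)) (fun p => c p - (rot B p - A p)))
    as (w & Hw & Eb & Ec).
  { apply smooth3_minus; [|apply smooth3_plus]; auto using rot_smooth3. }
  { apply smooth3_minus; [|apply smooth3_minus]; auto using rot_smooth3. }
  { intros p; specialize (RU p); rewrite EU, rot_radial_part in RU by assumption.
    unfold u, radial_part in RU; lra. }
  exists (mk1 A B (zint w)).
  assert (Sw : smooth3 (zint w)) by now apply zint_smooth3.
  split; [now apply multivector_mk1|].
  rewrite dpi_mk1, partial_zint by assumption.
  f_equal; apply functional_extensionality; intros p.
  - specialize (ZU p); rewrite EU, partial_z_radial_part in ZU by assumption; lra.
  - apply (ptwise _ _ p) in Eb; cbv beta in Eb; lra.
  - apply (ptwise _ _ p) in Ec; cbv beta in Ec; lra.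
Qed.

Lemma cocycle_2_normal_form a b c : smooth3 a -> smooth3 b -> smooth3 c ->
  cocycle pi_e2 2 (mk2 a b c) -> exists i, invariant i /\
    coboundary pi_e2 2 (mk2 a b c [-] mk2 (of_z (fun z => a (on_axis z)))
      (fun p => i p * coord ax p) (fun p => i p * coord ay p)).
Proof.
  intros Ha Hb Hc H; pose proof (cocycle_mk2_elim a b c Ha Hb Hc H) as E.
  assert (Su : smooth3 (radial_part b c)) by now apply radial_part_smooth3.
  assert (Hv : invariant (avg (radial_part b c))).
  { apply invariant_avg; [exact Su|]; intros p.
    (* By the cocycle equation u_z = - rot a, and the average of a rotational derivative is 0. Hence
       the average of u does not depend on z. *)
    replace (partial az (radial_part b c)) with (rot (fun q => (-1) * a q)).
    - now apply avg_rot, scal_smooth3.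
    - apply functional_extensionality; intros q.
      rewrite rot_scal, partial_z_radial_part by assumption; specialize (E q); lra. }
  destruct (invariant_divide _ Hv) as (i & Hi & Ei).
  { apply (avg_axis_zero _ 0); unfold radial_part; simpl; ring. }
  assert (Hg : smooth_line (fun z => a (on_axis z))) by now apply smooth_line_of_axis.
  assert (Sg := of_z_smooth3 _ Hg).
  exists i; split; [exact Hi|].
  pose proof (cocycle_sub 2 _ _ H (cocycle_radial_2 i _ Hi Hg)) as HD.
  rewrite msub_mk2 in *.
  apply coboundary_2_criterion; auto using smooth3_minus, invariant_times_coord.
  - intros z; simpl; ring.
  - intros p.
    replace (radial_part (fun q => b q - i q * coord ax q) (fun q => c q - i q * coord ay q))
      with (fun q => radial_part b c q + (-1) * (rho q * i q))
      by (apply functional_extensionality; intros q; unfold radial_part, rho; ring).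
    pose proof (invariant_mult _ _ (invariant_const (-1)) (invariant_mult _ _ invariant_rho Hi))
      as (S1 & R1 & _).
    rewrite avg_plus, (avg_invariant (fun q => -1 * (rho q * i q))), Ei by assumption; ring.
Qed.

(** The radial part rho i of the pair (b, c) would be [rot (x A + y B)], of zero average, while an
    invariant function is its own average. The remaining coefficient - (x A_z + y B_z) is 0 on the
    axis, which determines a function of z alone. *)
Lemma coboundary_2_radial i g : invariant i -> 
  coboundary pi_e2 2 (mk2 (of_z g) (fun p => i p * coord ax p) (fun p => i p * coord ay p)) ->
  i = (fun _ => 0) /\ of_z g = fun _ => 0.
Proof.
  intros Hi (Q & HQ & E); destruct (multivector_1_elim Q HQ) as (A & B & C & HA & HB & HC & ->).
  rewrite dpi_mk1 in E by assumption; apply mk2_inj in E; destruct E as (E1 & E2 & E3); split.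
  - apply rho_cancel; [apply smooth3_cont, Hi|]; intros p.
    pose proof (invariant_mult _ _ invariant_rho Hi) as (S1 & R1 & _).
    change (coord ax p ^ 2 + coord ay p ^ 2) with (rho p).
    rewrite <- (avg_invariant (fun q => rho q * i q)) by assumption.
    replace (fun q => rho q * i q) with (rot (radial_part A B)).
    + now apply avg_rot, radial_part_smooth3.
    + apply functional_extensionality; intros q.
      apply (ptwise _ _ q) in E2; apply (ptwise _ _ q) in E3; cbv beta in E2, E3.
      rewrite rot_radial_part by assumption.
      replace (rho q * i q) with (coord ax q * (i q * coord ax q) + coord ay q * (i q * coord ay q))
        by (unfold rho; ring).
      rewrite E2, E3; ring.
  - apply functional_extensionality; intros [[x y] z].
    transitivity (of_z g (0, 0, z)); [reflexivity|]; rewrite E1; simpl; ring.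
Qed.

(** Splitting m = x b + y c, the integrals of - b and - c in z are a primitive. *)
Lemma coboundary_3_criterion m : smooth3 m -> (forall z, m (on_axis z) = 0) ->
  coboundary pi_e2 3 (mk3 m).
Proof.
  intros Hm H0; destruct (hadamard_axis m Hm H0) as (b & c & Hb & Hc & E).
  assert (Sb : smooth3 (fun p => - zint b p)) by now apply smooth3_opp, zint_smooth3.
  assert (Sc : smooth3 (fun p => - zint c p)) by now apply smooth3_opp, zint_smooth3.
  pose proof (smooth3_const 0) as S0.
  exists (mk2 (fun _ => 0) (fun p => - zint b p) (fun p => - zint c p)).
  split; [now apply multivector_mk2|].
  rewrite dpi_mk2, !partial_opp, !partial_zint by assumption.
  f_equal; apply functional_extensionality; intros p; rewrite E.
  unfold rot; rewrite !partial_const; ring.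
Qed.

Lemma coboundary_3_axis m : coboundary pi_e2 3 (mk3 m) -> forall z, m (on_axis z) = 0.
Proof.
  intros (Q & HQ & E) z; destruct (multivector_2_elim Q HQ) as (a & b & c & Ha & Hb & Hc & ->).
  rewrite dpi_mk2 in E by assumption; apply mk3_inj, (ptwise _ _ (on_axis z)) in E.
  rewrite E; unfold rot; simpl; ring.
Qed.

(** The difference of the two cocycles has the normal form with i = 0 and g = 0, because rho i is
    its radial part and [g] the average of its z component. *)
Lemma class_eq_1 A B C A' B' C' : cocycle pi_e2 1 (mk1 A B C) -> cocycle pi_e2 1 (mk1 A' B' C') ->
  (forall p, radial_part A B p = radial_part A' B' p) -> (forall p, C p = C' p) ->
  class pi_e2 1 (mk1 A B C) = class pi_e2 1 (mk1 A' B' C').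
Proof.
  intros H H' Hr Hc; apply class_eq; pose proof (cocycle_sub _ _ _ H H') as HD.
  rewrite msub_mk1 in *; pose proof (fun I => multivector_smooth3 1 _ I (proj1 HD)) as S.
  destruct (cocycle_1_normal_form _ _ _ (S (true, false, false)) (S (false, true, false))
    (S (false, false, true)) HD) as (i & g & Hi & Hg & Ei & Eg & K).
  cbv [mk1] in Ei, Eg.
  assert (Zi : i = fun _ => 0).
  { apply rho_cancel; [apply smooth3_cont, Hi|]; intros p; specialize (Hr p).
    change ((coord ax p ^ 2 + coord ay p ^ 2) * i p) with (rho p * i p); rewrite <- Ei.
    unfold radial_part in *; lra. }
  assert (Zg : g = fun _ => 0).
  { apply functional_extensionality; intros p; rewrite Eg; apply avg_zero_fun.
    intros q; rewrite Hc; ring. }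
  subst i g; rewrite msub_mk1 in K; refine (eq_ind _ (coboundary pi_e2 1) K _ _).
  f_equal; apply functional_extensionality; intros p; cbv [mk1]; ring.
Qed.

(** Together with [class_eq_3] this is how the relations and tables are proved: differences on which
    the classifying data vanish are exact, so coefficients are compared on the axis and through
    their radial parts. *)
Lemma class_eq_2 a b c a' b' c' : cocycle pi_e2 2 (mk2 a b c) -> cocycle pi_e2 2 (mk2 a' b' c') ->
  (forall z, a (on_axis z) = a' (on_axis z)) ->
  (forall p, radial_part b c p = radial_part b' c' p) ->
  class pi_e2 2 (mk2 a b c) = class pi_e2 2 (mk2 a' b' c').
Proof.
  intros H H' Ha Hr; apply class_eq; pose proof (cocycle_sub _ _ _ H H') as HD.
  rewrite msub_mk2 in *; pose proof (fun I => multivector_smooth3 2 _ I (proj1 HD)) as S.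
  apply coboundary_2_criterion; [exact (S (true, true, false)) | exact (S (true, false, true))
    | exact (S (false, true, true)) | exact HD | |].
  - intros z; rewrite Ha; ring.
  - intros p; apply avg_zero_fun; intros q; specialize (Hr q); unfold radial_part in *; lra.
Qed.

Lemma class_eq_3 m m' : smooth3 m -> smooth3 m' -> (forall z, m (on_axis z) = m' (on_axis z)) ->
  class pi_e2 3 (mk3 m) = class pi_e2 3 (mk3 m').
Proof.
  intros H H' Hm; apply class_eq; rewrite msub_mk3.
  apply coboundary_3_criterion; [now apply smooth3_minus|]; intros z; rewrite Hm; ring.
Qed.

(** * Products and brackets of representatives *)

Ltac mvf_compute :=
  mvf_ext; match goal with K : mindex |- _ => destruct K as [[[] []] []] end;
  cbv [rep1 rep2 rep3 E_e2 T_e2 mk1 mk2 mk3 fn wedge Rsum mindices list_prod map fold_right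
    msubset forallb axes implb mem andb app madd fmul dd meqb mk_mindex single mdiff axis_rank
    Nat.eqb negb inversions filter length Nat.ltb Nat.leb fst snd pow]; ring.

Lemma E_e2_mk1 : E_e2 = mk1 (coord ax) (coord ay) (fun _ => 0).
Proof. mvf_compute. Qed.

Lemma dd_az_mk1 : dd az = mk1 (fun _ => 0) (fun _ => 0) (fun _ => 1).
Proof. mvf_compute. Qed.

Lemma rep1_mk1 f g : rep1 f g =
  mk1 (fun p => of_rho f p * coord ax p) (fun p => of_rho f p * coord ay p) (of_rho g).
Proof. mvf_compute. Qed.

Lemma rep2_mk2 f g : rep2 f g =
  mk2 (of_z g) (fun p => of_rho f p * coord ax p) (fun p => of_rho f p * coord ay p).
Proof. mvf_compute. Qed.

Lemma rep3_mk3 g : rep3 g = mk3 (of_z g).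
Proof. mvf_compute. Qed.

Lemma fmul_xy f : f [*] (dd ax [^] dd ay) = mk2 f (fun _ => 0) (fun _ => 0).
Proof. mvf_compute. Qed.

Lemma fmul_xyz f : f [*] (dd ax [^] dd ay [^] dd az) = mk3 f.
Proof. mvf_compute. Qed.

Lemma of_rho_at f p : of_rho f p = f (rho p).
Proof. now rewrite of_rho_eq. Qed.

Lemma of_rho_axis f z : of_rho f (on_axis z) = f 0.
Proof. rewrite of_rho_at; f_equal; unfold rho; simpl; ring. Qed.

Lemma invariant_ext f g : (forall p, f p = g p) -> invariant f -> invariant g.
Proof. intros H; replace g with f; auto; now apply functional_extensionality. Qed.

Lemma smooth_line_of_smooth3 g : smooth3 (of_z g) -> smooth_line g.
Proof. intros H; exact (smooth_line_of_axis (of_z g) H). Qed.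

(** Closure is borrowed from [smooth3]: pass to functions of z on space, combine there, and restrict
    to the axis. *)
Lemma smooth_line_linear c d g h : smooth_line g -> smooth_line h ->
  smooth_line (fun z => c * g z + d * h z).
Proof.
  intros Hg Hh; apply smooth_line_of_smooth3.
  apply (smooth3_ext (fun p => c * of_z g p + d * of_z h p)).
  - intros [[x y] z]; reflexivity.
  - apply smooth3_plus; now apply scal_smooth3, of_z_smooth3.
Qed.

Lemma smooth_line_ext g h : (forall z, g z = h z) -> smooth_line g -> smooth_line h.
Proof. intros H; replace h with g; auto; now apply functional_extensionality. Qed.

Lemma partial_radial f f' i j p : smooth_half f -> deriv_half f f' ->
  partial i (fun q => of_rho f q * coord j q) p =
  match i with ax => 2 * coord ax p | ay => 2 * coord ay p | az => 0 end * of_rho f' p * coord j p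
  + of_rho f p * (if Nat.eqb (axis_rank i) (axis_rank j) then 1 else 0).
Proof.
  intros Hf Hf'; rewrite smooth3_partial_mult, (partial_of_rho f f'), partial_coord
    by auto using smooth3_coord, smooth_half_smooth3; ring.
Qed.

Lemma invariant_two_rho i : invariant i -> invariant (fun p => 2 * rho p * i p).
Proof.
  intros Hi; apply (invariant_ext (fun p => 2 * (rho p * i p))); [intros p; ring|].
  apply invariant_mult; [apply invariant_const|].
  apply invariant_mult; [apply invariant_rho | exact Hi].
Qed.

(** * The clauses on individual degrees and the two relations *)

Lemma poisson_pi_e2 : poisson pi_e2.
Proof.
  split; [apply multivector_pi|].
  rewrite <- (sem_pi (fun _ _ => 0)), <- sem_schouten by (intros; apply smooth3_const).
  mvf_ext; destruct K as [[[] []] []]; unfold sem;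
    match goal with |- interp ?env ?e ?q = _ =>
      let a := eval vm_compute in e in change (interp env a q = 0) end;
    cbn [interp]; ring.
Qed.

Lemma casimir_iff a : casimir pi_e2 a <-> exists f, smooth_half f /\ a = of_rho f.
Proof.
  rewrite casimir_invariant; split; [apply smooth_half_of_invariant|].
  intros (f & Hf & ->); now apply invariant_of_smooth_half.
Qed.

(** In degree 0 only the zero field is a coboundary, so every class is a singleton. *)
Lemma representatives_0 : uniquely_represented pi_e2 0
  (fun P => exists f, smooth_half f /\ P = fn (of_rho f)).
Proof.
  split.
  - intros P (f & Hf & ->); now apply cocycle_fn, invariant_of_smooth_half.
  - intros C HC; destruct (cohomology_0_elim C HC) as (i & Hi & ->).
    exists (fn i); split; [split|].
    + destruct (smooth_half_of_invariant i Hi) as (f & Hf & ->); now exists f.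
    + now apply class_self, cocycle_fn.
    + intros P [_ [HP E]]; simpl in E.
      mvf_ext; pose proof (f_equal (fun P : mvf => P K x) E) as E'.
      unfold msub, mzero in E'; lra.
Qed.

Lemma cocycle_1_generators : cocycle pi_e2 1 E_e2 /\ cocycle pi_e2 1 (dd az).
Proof.
  split.
  - pose proof (cocycle_radial_1 _ _ (invariant_const 1) (invariant_const 0)) as H.
    rewrite E_e2_mk1; refine (eq_ind _ (cocycle pi_e2 1) H _ _); f_equal;
      apply functional_extensionality; intros p; ring.
  - pose proof (cocycle_radial_1 _ _ (invariant_const 0) (invariant_const 1)) as H.
    rewrite dd_az_mk1; refine (eq_ind _ (cocycle pi_e2 1) H _ _); f_equal;
      apply functional_extensionality; intros p; ring.
Qed.

Lemma module_combination i g : invariant i -> invariant g ->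
  class_add pi_e2 1
    (class_wedge pi_e2 0 1 (class pi_e2 0 (fn i)) (class pi_e2 1 E_e2))
    (class_wedge pi_e2 0 1 (class pi_e2 0 (fn g)) (class pi_e2 1 (dd az))) =
  class pi_e2 1 (mk1 (fun p => i p * coord ax p) (fun p => i p * coord ay p) g).
Proof.
  intros Hi Hg.
  destruct cocycle_1_generators as [HE HZ].
  pose proof (cocycle_fn i Hi) as Ci; pose proof (cocycle_fn g Hg) as Cg.
  rewrite !class_wedge_class by assumption.
  rewrite class_add_class by (apply (cocycle_wedge 0 1); assumption).
  f_equal; rewrite E_e2_mk1, dd_az_mk1, !wedge_01
    by first [apply Hi | apply Hg | apply smooth3_coord | apply smooth3_const].
  mvf_compute.
Qed.

Lemma free_module_1 : free_on_two pi_e2 1 (class pi_e2 1 E_e2) (class pi_e2 1 (dd az)).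
Proof.
  destruct cocycle_1_generators as [HE HZ].
  split; [now apply cohomology_class|split; [now apply cohomology_class|split]].
  - intros A B HA HB.
    destruct (cohomology_0_elim A HA) as (i & Hi & ->).
    destruct (cohomology_0_elim B HB) as (g & Hg & ->).
    rewrite module_combination by assumption.
    now apply cohomology_class, cocycle_radial_1.
  - intros C (P & HP & ->).
    destruct (multivector_1_elim P (proj1 HP)) as (A & B & D & HA & HB & HD & ->).
    destruct (cocycle_1_normal_form A B D HA HB HD HP) as (i & g & Hi & Hg & _ & _ & K).
    apply class_eq in K; rewrite K.
    exists (class pi_e2 0 (fn i), class pi_e2 0 (fn g)); split.
    + split; [now apply cohomology_class, cocycle_fn|].
      split; [now apply cohomology_class, cocycle_fn|].
      symmetry; now apply module_combination.
    + intros [X Y]; simpl; intros (HX & HY & E).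
      destruct (cohomology_0_elim X HX) as (i' & Hi' & ->).
      destruct (cohomology_0_elim Y HY) as (g' & Hg' & ->).
      rewrite module_combination in E by assumption.
      apply class_eq_inv in E; [|now apply cocycle_radial_1].
      rewrite msub_mk1 in E.
      destruct (coboundary_1_radial (fun p => i p - i' p) (fun p => g p - g' p)) as [Ei Eg].
      * now apply invariant_minus.
      * now apply invariant_minus.
      * refine (eq_ind _ (coboundary pi_e2 1) E _ _); f_equal;
          apply functional_extensionality; intros p; ring.
      * f_equal; f_equal; f_equal; apply functional_extensionality; intros p.
        -- apply (ptwise _ _ p) in Ei; cbv beta in Ei; lra.
        -- apply (ptwise _ _ p) in Eg; cbv beta in Eg; lra.
Qed.

Lemma representatives_2 : uniquely_represented pi_e2 2
  (fun P => exists f g, smooth_half f /\ smooth_line g /\ P = rep2 f g).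
Proof.
  split.
  - intros P (f & g & Hf & Hg & ->); rewrite rep2_mk2.
    now apply cocycle_radial_2; [apply invariant_of_smooth_half|].
  - intros C (P & HP & ->).
    destruct (multivector_2_elim P (proj1 HP)) as (a & b & c & Ha & Hb & Hc & ->).
    destruct (cocycle_2_normal_form a b c Ha Hb Hc HP) as (i & Hi & K).
    destruct (smooth_half_of_invariant i Hi) as (f & Hf & ->).
    assert (Hg : smooth_line (fun z => a (on_axis z))) by now apply smooth_line_of_axis.
    apply class_eq in K; rewrite K, <- rep2_mk2.
    exists (rep2 f (fun z => a (on_axis z))); split; [split|].
    + exists f, (fun z => a (on_axis z)); auto.
    + rewrite rep2_mk2; now apply class_self, cocycle_radial_2.
    + intros P [(f' & g' & Hf' & Hg' & ->) [_ E]].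
      rewrite !rep2_mk2, msub_mk2 in E.
      pose proof (invariant_of_smooth_half f' Hf') as Hi'.
      destruct (coboundary_2_radial (fun p => of_rho f' p - of_rho f p)
        (fun z => g' z - a (on_axis z))) as [Ei Eg].
      * now apply invariant_minus.
      * refine (eq_ind _ (coboundary pi_e2 2) E _ _); f_equal;
          apply functional_extensionality; intros p; [|ring|ring].
        rewrite !of_z_eq; ring.
      * rewrite !rep2_mk2; f_equal; apply functional_extensionality; intros p.
        -- apply (ptwise _ _ p) in Eg; destruct p as [[x y] z]; simpl in *; lra.
        -- apply (ptwise _ _ p) in Ei; cbv beta in Ei; f_equal; lra.
        -- apply (ptwise _ _ p) in Ei; cbv beta in Ei; f_equal; lra.
Qed.

Lemma representatives_3 : uniquely_represented pi_e2 3
  (fun P => exists g, smooth_line g /\ P = rep3 g).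
Proof.
  split.
  - intros P (g & Hg & ->); rewrite rep3_mk3; now apply cocycle_mk3, of_z_smooth3.
  - intros C (P & HP & ->).
    destruct (multivector_3_elim P (proj1 HP)) as (m & Hm & ->).
    assert (Hg : smooth_line (fun z => m (on_axis z))) by now apply smooth_line_of_axis.
    assert (K : class pi_e2 3 (mk3 m) = class pi_e2 3 (rep3 (fun z => m (on_axis z)))).
    { rewrite rep3_mk3; apply class_eq_3; auto using of_z_smooth3. }
    rewrite K; exists (rep3 (fun z => m (on_axis z))); split; [split|].
    + exists (fun z => m (on_axis z)); auto.
    + rewrite rep3_mk3; now apply class_self, cocycle_mk3, of_z_smooth3.
    + intros P [(g' & Hg' & ->) [_ E]].
      rewrite !rep3_mk3, msub_mk3 in *.
      f_equal; apply functional_extensionality; intros [[x y] z].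
      pose proof (coboundary_3_axis _ E z) as E'; simpl in E' |- *; lra.
Qed.

(** Both fields have only a d_x /\ d_y component and agree on the axis. Smoothness of [h 0] comes
    from restricting the coefficient to the axis. *)
Lemma relation_2 h : smooth3 (of_rho_z h) ->
  cocycle pi_e2 2 (of_rho_z h [*] (dd ax [^] dd ay)) ->
  class pi_e2 2 (of_rho_z h [*] (dd ax [^] dd ay)) =
  class pi_e2 2 (of_z (h 0) [*] (dd ax [^] dd ay)).
Proof.
  intros Hs; rewrite !fmul_xy; intros H.
  assert (Hg : smooth_line (h 0)).
  { apply (smooth_line_ext (fun z => of_rho_z h (on_axis z))).
    - intros z; simpl; f_equal; ring.
    - now apply smooth_line_of_axis. }
  apply class_eq_2; [exact H| | |].
  - pose proof (cocycle_radial_2 _ _ (invariant_const 0) Hg) as H0.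
    refine (eq_ind _ (cocycle pi_e2 2) H0 _ _); f_equal;
      apply functional_extensionality; intros p; ring.
  - intros z; simpl; f_equal; ring.
  - reflexivity.
Qed.

Lemma relation_3 h : smooth3 (of_rho_z h) ->
  class pi_e2 3 (of_rho_z h [*] (dd ax [^] dd ay [^] dd az)) =
  class pi_e2 3 (of_z (h 0) [*] (dd ax [^] dd ay [^] dd az)).
Proof.
  intros Hs; rewrite !fmul_xyz.
  apply class_eq_3; [exact Hs | |].
  - apply of_z_smooth3, (smooth_line_ext (fun z => of_rho_z h (on_axis z))).
    + intros z; simpl; f_equal; ring.
    + now apply smooth_line_of_axis.
  - intros z; simpl; f_equal; ring.
Qed.

Ltac invariants :=
  repeat match goal with
  | H : smooth_half ?f |- _ =>
      lazymatch goal with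
      | _ : invariant (of_rho f) |- _ => fail
      | _ => assert (invariant (of_rho f)) by exact (invariant_of_smooth_half f H) end
  | H : smooth_half ?f, H' : deriv_half ?f ?f' |- _ =>
      lazymatch goal with
      | _ : invariant (of_rho f') |- _ => fail
      | _ => assert (invariant (of_rho f')) by exact (deriv_invariant f f' H H') end
  | H : smooth_line ?g |- _ =>
      lazymatch goal with
      | _ : smooth3 (of_z g) |- _ => fail
      | _ => assert (smooth3 (of_z g)) by exact (of_z_smooth3 g H) end
  | H : invariant ?i |- _ =>
      lazymatch goal with
      | _ : smooth3 i |- _ => fail
      | _ => assert (smooth3 i) by exact (proj1 H) end
  end.

Ltac smooth_side := first [assumption | apply invariant_times_coord; assumption].

Ltac pointwise := f_equal; apply functional_extensionality; intros ?p;
  rewrite ?of_z_eq, ?of_rho_at; unfold rho; ring.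

(** A factor a(x^2 + y^2) in front of g(z) may be replaced by its value a(0) on the axis;
    [E /\ E = 0] removes the remaining products of radial terms. *)
Lemma wedge_representatives (a b f1 g1 f2 g2 u v : R -> R) :
  smooth_half a -> smooth_half b ->
  smooth_half f1 -> smooth_half g1 -> smooth_half f2 -> smooth_half g2 ->
  smooth_half u -> smooth_line v ->
  class pi_e2 0 (rep0 a [^] rep0 b) = class pi_e2 0 (rep0 (fun s => a s * b s)) /\
  class pi_e2 1 (rep0 a [^] rep1 f1 g1) =
    class pi_e2 1 (rep1 (fun s => a s * f1 s) (fun s => a s * g1 s)) /\
  class pi_e2 2 (rep0 a [^] rep2 u v) =
    class pi_e2 2 (rep2 (fun s => a s * u s) (fun z => a 0 * v z)) /\
  class pi_e2 3 (rep0 a [^] rep3 v) = class pi_e2 3 (rep3 (fun z => a 0 * v z)) /\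
  class pi_e2 2 (rep1 f1 g1 [^] rep1 f2 g2) =
    class pi_e2 2 (rep2 (fun s => f1 s * g2 s - g1 s * f2 s) (fun _ => 0)) /\
  class pi_e2 3 (rep1 f1 g1 [^] rep2 u v) = class pi_e2 3 (rep3 (fun z => g1 0 * v z)).
Proof.
  intros Ha Hb Hf1 Hg1 Hf2 Hg2 Hu Hv; invariants.
  assert (Hav : forall c, smooth_line (fun z => c * v z)).
  { intros c; apply (smooth_line_ext (fun z => c * v z + 0 * v z)); [intros z; ring|].
    now apply smooth_line_linear. }
  rewrite !rep1_mk1, !rep2_mk2, !rep3_mk3; unfold rep0; repeat split.
  - rewrite wedge_00 by smooth_side; do 2 f_equal; pointwise.
  - rewrite wedge_01 by smooth_side; f_equal; pointwise.
  - rewrite wedge_02 by smooth_side; apply class_eq_2.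
    + rewrite <- wedge_02 by smooth_side.
      apply (cocycle_wedge 0 2); [now apply cocycle_fn | now apply cocycle_radial_2].
    + apply cocycle_radial_2; [|apply Hav].
      apply (invariant_ext (fun p => of_rho a p * of_rho u p)); [|now apply invariant_mult].
      intros p; now rewrite !of_rho_at.
    + intros z; now rewrite of_rho_axis.
    + intros p; unfold radial_part; rewrite !of_rho_at; ring.
  - rewrite wedge_03 by smooth_side; apply class_eq_3.
    + now apply smooth3_mult.
    + apply of_z_smooth3, Hav.
    + intros z; now rewrite of_rho_axis.
  - rewrite wedge_11 by smooth_side; f_equal; pointwise.
  - rewrite wedge_12 by smooth_side; apply class_eq_3.
    (* The first two terms are the expanded [E /\ E /\ d_z]; they cancel only as functions, so
       smoothness is shown term by term. *)
    + apply (smooth3_plus (fun p => of_rho f1 p * coord ax p * (of_rho u p * coord ay p)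
        - of_rho f1 p * coord ay p * (of_rho u p * coord ax p)) (fun p => of_rho g1 p * of_z v p)).
      * apply smooth3_minus; apply smooth3_mult; smooth_side.
      * now apply smooth3_mult.
    + apply of_z_smooth3, Hav.
    + intros z; rewrite !of_rho_axis; simpl; ring.
Qed.

Ltac partials :=
  repeat match goal with
  | Hf : smooth_half ?f, H : deriv_half ?f ?f' |-
      context [partial ?i (fun q => of_rho ?f q * coord ?j q) ?p] =>
      rewrite (partial_radial f f' i j p Hf H)
  | H : deriv_half ?f ?f' |- context [partial ?i (of_rho ?f) ?p] =>
      rewrite (partial_of_rho f f' i p H)
  | H : smooth_line ?g |- context [partial ?i (of_z ?g) ?p] =>
      rewrite (partial_of_z g i p H)
  end; cbn [axis_rank Nat.eqb].

(** The factors 2 s come from E a(rho) = 2 rho a'(rho). The terms - 2 f1(0) v come from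
    [E, d_x /\ d_y] = - 2 d_x /\ d_y, and likewise the planar divergence 2 of [E] gives the
    coefficients 2 u(0) and 2 w(0) in the last line. *)
Lemma bracket_representatives (a a' f1 f1' g1 g1' f2 f2' g2 g2' u u' w v t : R -> R) :
  smooth_half a -> deriv_half a a' ->
  smooth_half f1 -> deriv_half f1 f1' ->
  smooth_half g1 -> deriv_half g1 g1' ->
  smooth_half f2 -> deriv_half f2 f2' ->
  smooth_half g2 -> deriv_half g2 g2' ->
  smooth_half u -> deriv_half u u' -> smooth_half w ->
  smooth_line v -> smooth_line t ->
  class pi_e2 0 (schouten 1 0 (rep1 f1 g1) (rep0 a)) =
    class pi_e2 0 (rep0 (fun s => 2 * s * f1 s * a' s)) /\
  class pi_e2 1 (schouten 2 0 (rep2 u v) (rep0 a)) =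
    class pi_e2 1 (rep1 (fun _ => 0) (fun s => - (2 * s * u s * a' s))) /\
  class pi_e2 2 (schouten 3 0 (rep3 v) (rep0 a)) = class pi_e2 2 mzero /\
  class pi_e2 1 (schouten 1 1 (rep1 f1 g1) (rep1 f2 g2)) =
    class pi_e2 1
      (rep1 (fun s => 2 * s * (f1 s * f2' s - f2 s * f1' s))
            (fun s => 2 * s * (f1 s * g2' s - f2 s * g1' s))) /\
  class pi_e2 2 (schouten 1 2 (rep1 f1 g1) (rep2 u v)) =
    class pi_e2 2
      (rep2 (fun s => 2 * s * (f1 s * u' s - u s * f1' s))
            (fun z => g1 0 * Derive v z - 2 * f1 0 * v z)) /\
  class pi_e2 3 (schouten 1 3 (rep1 f1 g1) (rep3 v)) =
    class pi_e2 3 (rep3 (fun z => g1 0 * Derive v z - 2 * f1 0 * v z)) /\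
  class pi_e2 3 (schouten 2 2 (rep2 u v) (rep2 w t)) =
    class pi_e2 3 (rep3 (fun z => 2 * u 0 * t z + 2 * w 0 * v z)).
Proof.
  intros Ha Ha' Hf1 Hf1' Hg1 Hg1' Hf2 Hf2' Hg2 Hg2' Hu Hu' Hw Hv Ht; invariants.
  (* The derivative of [w] enters the last bracket only with coordinate factors, which vanish on the
     axis; this is why it is absent from the answer. *)
  destruct (smooth_half_deriv w Hw) as (w' & _ & Hw').
  assert (Hl : smooth_line (fun z => g1 0 * Derive v z - 2 * f1 0 * v z)).
  { apply (smooth_line_ext (fun z => g1 0 * Derive v z + (- (2 * f1 0)) * v z)); [intros z; ring|].
    apply smooth_line_linear; [now apply smooth_line_Derive | exact Hv]. }
  assert (Hl' : smooth_line (fun z => 2 * u 0 * t z + 2 * w 0 * v z)) by now apply smooth_line_linear.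
  pose proof (cocycle_radial_1 (of_rho f1) (of_rho g1)) as C1.
  pose proof (cocycle_radial_2 (of_rho u) v) as C2.
  pose proof (cocycle_fn (of_rho a)) as C0.
  rewrite !rep1_mk1, !rep2_mk2, !rep3_mk3; unfold rep0; repeat split.
  - rewrite schouten_10 by smooth_side; do 2 f_equal; apply functional_extensionality; intros p.
    partials; rewrite !of_rho_at; unfold rho; ring.
  (* Closedness of the bracket is inherited from its arguments, so only the classifying data remain
     to be computed. *)
  - assert (C := cocycle_schouten 2 0 _ _ (C2 ltac:(assumption) Hv) (C0 ltac:(assumption))).
    rewrite schouten_20 in * by smooth_side; apply class_eq_1; [exact C| | |].
    + apply cocycle_radial_1.
      * apply (invariant_ext (fun _ => 0)); [intros p; now rewrite of_rho_at | apply invariant_const].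
      * apply (invariant_ext (fun p => 2 * rho p * (-1 * (of_rho u p * of_rho a' p)))).
        { intros p; rewrite !of_rho_at; ring. }
        apply invariant_two_rho, invariant_mult; [apply invariant_const | now apply invariant_mult].
    + intros p; unfold radial_part; partials; rewrite !of_rho_at; ring.
    + intros p; partials; rewrite !of_rho_at; unfold rho; ring.
  - assert (C := cocycle_schouten 3 0 _ _ (cocycle_mk3 (of_z v) ltac:(assumption))
      (C0 ltac:(assumption))).
    rewrite schouten_30, mzero_mk2 in * by smooth_side; apply class_eq_2; [exact C| | |].
    + rewrite <- mzero_mk2; apply cocycle_zero.
    + intros z; partials; ring.
    + intros p; unfold radial_part; partials; ring.
  - rewrite schouten_11 by smooth_side; f_equal.
    f_equal; apply functional_extensionality; intros p;
      partials; rewrite !of_rho_at; unfold rho; ring.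
  - assert (C := cocycle_schouten 1 2 _ _ (C1 ltac:(assumption) ltac:(assumption))
      (C2 ltac:(assumption) Hv)).
    rewrite schouten_12 in * by smooth_side; apply class_eq_2; [exact C| | |].
    + apply cocycle_radial_2; [|exact Hl].
      apply (invariant_ext (fun p => 2 * rho p * (of_rho f1 p * of_rho u' p - of_rho u p * of_rho f1' p))).
      { intros p; rewrite !of_rho_at; ring. }
      apply invariant_two_rho, invariant_minus; now apply invariant_mult.
    + intros z; partials; rewrite !of_rho_axis; simpl; ring.
    + intros p; unfold radial_part; partials; rewrite !of_rho_at; unfold rho; ring.
  - assert (C := cocycle_schouten 1 3 _ _ (C1 ltac:(assumption) ltac:(assumption))
      (cocycle_mk3 (of_z v) ltac:(assumption))).
    rewrite schouten_13 in * by smooth_side; apply class_eq_3.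
    + exact (multivector_smooth3 3 _ (true, true, true) (proj1 C)).
    + now apply of_z_smooth3.
    + intros z; partials; rewrite !of_rho_axis; simpl; ring.
  - assert (C := cocycle_schouten 2 2 _ _ (C2 ltac:(assumption) Hv)
      (cocycle_radial_2 (of_rho w) t ltac:(assumption) Ht)).
    rewrite schouten_22 in * by smooth_side; apply class_eq_3.
    + exact (multivector_smooth3 3 _ (true, true, true) (proj1 C)).
    + now apply of_z_smooth3.
    + intros z; partials; rewrite !of_rho_axis; simpl; ring.
Qed.

Theorem mainTheorem3 :
  poisson pi_e2 /\
  (* degree 0 *)
  (forall a : R3 -> R,
     casimir pi_e2 a <-> exists f, smooth_half f /\ a = of_rho f) /\
  uniquely_represented pi_e2 0
    (fun P => exists f, smooth_half f /\ P = fn (of_rho f)) /\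
  (* degree 1 *)
  free_on_two pi_e2 1 (class pi_e2 1 E_e2) (class pi_e2 1 (dd az)) /\
  (* degree 2 *)
  uniquely_represented pi_e2 2
    (fun P => exists f g, smooth_half f /\ smooth_line g /\
       P = of_rho f [*] (E_e2 [^] dd az) [+] of_z g [*] (dd ax [^] dd ay)) /\
  (* degree 3 *)
  uniquely_represented pi_e2 3
    (fun P => exists g, smooth_line g /\
       P = of_z g [*] (dd ax [^] dd ay [^] dd az)) /\
  (* the wedge product and the bracket are computed on representatives *)
  (forall (p q : nat) (P Q : mvf),
     cocycle pi_e2 p P -> cocycle pi_e2 q Q ->
     cocycle pi_e2 (p + q) (P [^] Q) /\
     class_wedge pi_e2 p q (class pi_e2 p P) (class pi_e2 q Q) =
       class pi_e2 (p + q) (P [^] Q) /\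
     cocycle pi_e2 (p + q - 1) (schouten p q P Q) /\
     class_bracket pi_e2 p q (class pi_e2 p P) (class pi_e2 q Q) =
       class pi_e2 (p + q - 1) (schouten p q P Q)) /\
  (* the relations in cohomology *)
  (forall h : R -> R -> R, smooth_half_plane h ->
     (cocycle pi_e2 2 (of_rho_z h [*] (dd ax [^] dd ay)) ->
      class pi_e2 2 (of_rho_z h [*] (dd ax [^] dd ay)) =
      class pi_e2 2 (of_z (h 0) [*] (dd ax [^] dd ay))) /\
     (cocycle pi_e2 3 (of_rho_z h [*] (dd ax [^] dd ay [^] dd az)) ->
      class pi_e2 3 (of_rho_z h [*] (dd ax [^] dd ay [^] dd az)) =
      class pi_e2 3 (of_z (h 0) [*] (dd ax [^] dd ay [^] dd az)))) /\
  (* the resulting wedge products of representatives *)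
  (forall a b f1 g1 f2 g2 u v : R -> R,
     smooth_half a -> smooth_half b ->
     smooth_half f1 -> smooth_half g1 -> smooth_half f2 -> smooth_half g2 ->
     smooth_half u -> smooth_line v ->
     class pi_e2 0 (rep0 a [^] rep0 b) =
       class pi_e2 0 (rep0 (fun s => a s * b s)) /\
     class pi_e2 1 (rep0 a [^] rep1 f1 g1) =
       class pi_e2 1 (rep1 (fun s => a s * f1 s) (fun s => a s * g1 s)) /\
     class pi_e2 2 (rep0 a [^] rep2 u v) =
       class pi_e2 2 (rep2 (fun s => a s * u s) (fun z => a 0 * v z)) /\
     class pi_e2 3 (rep0 a [^] rep3 v) =
       class pi_e2 3 (rep3 (fun z => a 0 * v z)) /\
     class pi_e2 2 (rep1 f1 g1 [^] rep1 f2 g2) =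
       class pi_e2 2 (rep2 (fun s => f1 s * g2 s - g1 s * f2 s) (fun _ => 0)) /\
     class pi_e2 3 (rep1 f1 g1 [^] rep2 u v) =
       class pi_e2 3 (rep3 (fun z => g1 0 * v z))) /\
  (* the resulting brackets of representatives *)
  (forall a a' f1 f1' g1 g1' f2 f2' g2 g2' u u' w v t : R -> R,
     smooth_half a -> deriv_half a a' ->
     smooth_half f1 -> deriv_half f1 f1' ->
     smooth_half g1 -> deriv_half g1 g1' ->
     smooth_half f2 -> deriv_half f2 f2' ->
     smooth_half g2 -> deriv_half g2 g2' ->
     smooth_half u -> deriv_half u u' -> smooth_half w ->
     smooth_line v -> smooth_line t ->
     class pi_e2 0 (schouten 1 0 (rep1 f1 g1) (rep0 a)) =
       class pi_e2 0 (rep0 (fun s => 2 * s * f1 s * a' s)) /\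
     class pi_e2 1 (schouten 2 0 (rep2 u v) (rep0 a)) =
       class pi_e2 1 (rep1 (fun _ => 0) (fun s => - (2 * s * u s * a' s))) /\
     class pi_e2 2 (schouten 3 0 (rep3 v) (rep0 a)) = class pi_e2 2 mzero /\
     class pi_e2 1 (schouten 1 1 (rep1 f1 g1) (rep1 f2 g2)) =
       class pi_e2 1
         (rep1 (fun s => 2 * s * (f1 s * f2' s - f2 s * f1' s))
               (fun s => 2 * s * (f1 s * g2' s - f2 s * g1' s))) /\
     class pi_e2 2 (schouten 1 2 (rep1 f1 g1) (rep2 u v)) =
       class pi_e2 2
         (rep2 (fun s => 2 * s * (f1 s * u' s - u s * f1' s))
               (fun z => g1 0 * Derive v z - 2 * f1 0 * v z)) /\
     class pi_e2 3 (schouten 1 3 (rep1 f1 g1) (rep3 v)) =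
       class pi_e2 3 (rep3 (fun z => g1 0 * Derive v z - 2 * f1 0 * v z)) /\
     class pi_e2 3 (schouten 2 2 (rep2 u v) (rep2 w t)) =
       class pi_e2 3 (rep3 (fun z => 2 * u 0 * t z + 2 * w 0 * v z))).
Proof.
  split; [exact poisson_pi_e2|].
  split; [exact casimir_iff|].
  split; [exact representatives_0|].
  split; [exact free_module_1|].
  split; [exact representatives_2|].
  split; [exact representatives_3|].
  split; [|split; [|split; [exact wedge_representatives | exact bracket_representatives]]].
  - intros p q P Q HP HQ; split; [now apply cocycle_wedge|].
    split; [now apply class_wedge_class|].
    split; [now apply cocycle_schouten | now apply class_bracket_class].
  - intros h _; split; intros H.
    + apply relation_2; [|exact H].
      rewrite fmul_xy in H; exact (multivector_smooth3 2 _ (true, true, false) (proj1 H)).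
    + apply relation_3.
      rewrite fmul_xyz in H; exact (multivector_smooth3 3 _ (true, true, true) (proj1 H)).
Qed.
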